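(* Suppose that the standing Assumption (stated in the context) holds. For $0<\Delta\le T$ let $u^{\Delta}\in\mathcal{C}_b(\bar Q_T)$ satisfy the approximation scheme with time step $\Delta$ described in the context, and let $u\in\mathcal{C}_b^1(\bar Q_T)$ be the unique viscosity solution of $$-\partial_tu-\tfrac12\mathrm{Trace}\left(\sigma\sigma^T(t,x)\partial_{xx}u\right)-b(t,x)\cdot\partial_xu+H(t,x,\partial_xu)=0\ \text{ in } Q_T,\qquad u(T,x)=U(x)\ \text{ in }\mathbb{R}^n .$$ Then there exists a constant $C$, depending only on $M$ and $T$ (in particular not on $\Delta$), such that $$u-u^{\Delta}\ge -C\Delta^{\frac1{10}}\quad\text{in }\bar Q_T .$$
   Context: Notation. $T>0$ and $n\ge1$ are fixed; $Q_s=[0,s)\times\mathbb{R}^n$ and $\bar Q_s=[0,s]\times\mathbb{R}^n$. For a function $f$ of $(t,x)$: $|f|_0=\sup|f|$, $[f]_{1,1/2}=\sup_{t\ne t',x}\frac{|f(t,x)-f(t',x)|}{|t-t'|^{1/2}}$, $[f]_{2,1}=\sup_{t,x\ne x'}\frac{|f(t,x)-f(t,x')|}{|x-x'|}$, $[f]_1=[f]_{1,1/2}+[f]_{2,1}$, $|f|_1=|f|_0+[f]_1$. For a function $g$ of $x$ only: $|g|_0=\sup|g|$, $[g]_1=\sup_{x\neq x'}\frac{|g(x)-g(x')|}{|x-x'|}$, $|g|_1=|g|_0+[g]_1$. $\mathcal{C}(S)$ denotes continuous functions on $S$, $\mathcal{C}_b(S)$ bounded continuous functions, and $\mathcal{C}_b^1(S)$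 bounded continuous functions with $|f|_1<\infty$. Standing Assumption. (i) $\sigma\in\mathcal{C}_b^1(Q_T)$ ($n\times n$ matrix valued), $b\in\mathcal{C}_b^1(Q_T)$ ($\mathbb{R}^n$ valued) and $U\in\mathcal{C}_b^1(\mathbb{R}^n)$ (real valued) satisfy $|\sigma|_1,|b|_1,|U|_1\le M$ for some $M>0$. (ii) $H\in\mathcal{C}(Q_T\times\mathbb{R}^n)$ is real valued, $H(t,x,p)$ is convex in $p$, $\lim_{|p|\to\infty}H(t,x,p)/|p|=\infty$ uniformly in $(t,x)\in Q_T$; for every $p$, $[H(\cdot,\cdot,p)]_1\le M$; and the functions $H_*(p)=\inf_{(t,x)\in Q_T}H(t,x,p)$, $H^*(p)=\sup_{(t,x)\in Q_T}H(t,x,p)$ are real valued and locally bounded on $\mathbb{R}^n$. Legendre transform: $L(t,x,q)=\sup_{p\in\mathbb{R}^n}\{p\cdot q-H(t,x,p)\}$. Backward operator: for $0\le t<t+\Delta\le T$ and $\phi\in\mathcal{C}_b(\mathbb{R}^n)$, $$\mathbf{S}_t(\Delta)\phi(x)=\min_{y\in\mathbb{R}^n}\left\{\Delta L\left(t,x,\tfrac{x-y}{\Delta}\right)+\mathbf{E}[\phi(Y^{t,y}_{t+\Delta})|\mathcal{F}_t]\right\},\quad Y^{t,y}_s=y+b(t,y)(s-t)+\sigma(t,y)(W_s-W_t),\ s\in[t,t+\Delta],$$ where $W$ is an $n$-dimensional Brownian motion with augmented filtration $(\mathcal{F}_t)$. Approximation scheme with step $\Delta$: $u^\Delta(t,x)=\mathbf{S}_t(\Delta)u^\Delta(t+\Delta,\cdot)(x)$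 for $(t,x)\in\bar Q_{T-\Delta}$, and $u^\Delta(t,x)=g^\Delta(t,x)$ for $(t,x)\in\bar Q_T\setminus\bar Q_{T-\Delta}$, where $g^\Delta(t,x)=\frac{t+\Delta-T}{\Delta}U(x)+\frac{T-t}{\Delta}\mathbf{S}_{T-\Delta}(\Delta)U(x)$. Convention on constants: the dimension $n$ and the Hamiltonian are regarded as fixed, so a constant ''depending only on $M$ and $T$'' may also depend on $n$ and on the envelopes $H_*,H^*$. *)

(* Defs.v *)
From HB Require Import structures.
From mathcomp Require Import all_boot all_order all_algebra.
From mathcomp Require Import all_classical all_reals all_analysis.

Set Implicit Arguments.
Unset Strict Implicit.
Unset Printing Implicit Defensive.

Import Order.TTheory GRing.Theory Num.Theory.
Import numFieldNormedType.Exports.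

Local Open Scope classical_set_scope.
Local Open Scope ring_scope.

Section euclidean.
Context {R : realType}.

(* The library norm on matrices is the sup norm, hence these definitions.
   [enorm] is the Euclidean norm on column vectors and the Frobenius norm
   on square matrices. *)
Definition dot {n : nat} (p q : 'cV[R]_n) : R := \sum_i p i 0 * q i 0.

Definition enorm {m n : nat} (A : 'M[R]_(m, n)) : R :=
  Num.sqrt (\sum_i \sum_j A i j ^+ 2).

End euclidean.

(* A function of (t, x) on I x R^n is a curried total function; only its values
   at times t in I matter.  [N] is the norm used on the target space. *)
Section function_spaces.
Context {R : realType} {n : nat} {V : normedModType R}.
Implicit Types (I : set R) (N : V -> R).
Implicit Types (f : R -> 'cV[R]_n -> V) (g : 'cV[R]_n -> V).

Definition times_Q (T : R) : set R := [set t | 0 <= t < T].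
Definition times_Qbar (T : R) : set R := [set t | 0 <= t <= T].

Definition cont_on I f : Prop :=
  {within [set z : R * 'cV[R]_n | I z.1], continuous (fun z => f z.1 z.2)}.

Definition norm0 I N f : \bar R :=
  ereal_sup [set (N (f z.1 z.2))%:E | z in [set z : R * 'cV[R]_n | I z.1]].

Definition semi_time I N f : \bar R :=
  ereal_sup [set r | exists t t' x, [/\ I t, I t', t != t' &
    r = (N (f t x - f t' x) / Num.sqrt `|t - t'|)%:E]].

Definition semi_space I N f : \bar R :=
  ereal_sup [set r | exists t x x', [/\ I t, x != x' &
    r = (N (f t x - f t x') / enorm (x - x'))%:E]].

Definition semi1 I N f : \bar R := (semi_time I N f + semi_space I N f)%E.

Definition norm1 I N f : \bar R := (norm0 I N f + semi1 I N f)%E.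

Definition in_Cb I N f : Prop := cont_on I f /\ (norm0 I N f < +oo)%E.

Definition in_Cb1 I N f : Prop :=
  [/\ cont_on I f, (norm0 I N f < +oo)%E & (norm1 I N f < +oo)%E].

Definition norm0_space N g : \bar R :=
  ereal_sup [set (N (g x))%:E | x in [set: 'cV[R]_n]].

Definition semi1_space N g : \bar R :=
  ereal_sup [set r | exists x x', x != x' /\
    r = (N (g x - g x') / enorm (x - x'))%:E].

Definition norm1_space N g : \bar R := (norm0_space N g + semi1_space N g)%E.

Definition in_Cb1_space N g : Prop :=
  [/\ continuous g, (norm0_space N g < +oo)%E & (norm1_space N g < +oo)%E].

End function_spaces.

(* [Hlo] and [Hhi] are the envelopes H_* and H^*. *)
Record standing_assumption {R : realType} {n : nat} (T M : R)
    (Hlo Hhi : 'cV[R]_n -> R)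
    (sigma : R -> 'cV[R]_n -> 'M[R]_n) (b : R -> 'cV[R]_n -> 'cV[R]_n)
    (U : 'cV[R]_n -> R) (H : R -> 'cV[R]_n -> 'cV[R]_n -> R) : Prop := {
  sa_sigma : in_Cb1 (times_Q T) enorm sigma ;
  sa_b : in_Cb1 (times_Q T) enorm b ;
  sa_U : in_Cb1_space Num.norm U ;
  sa_sigma_le : (norm1 (times_Q T) enorm sigma <= M%:E)%E ;
  sa_b_le : (norm1 (times_Q T) enorm b <= M%:E)%E ;
  sa_U_le : (norm1_space Num.norm U <= M%:E)%E ;
  sa_H_cont : {within [set z : (R * 'cV[R]_n) * 'cV[R]_n | times_Q T z.1.1],
    continuous (fun z => H z.1.1 z.1.2 z.2)} ;
  sa_H_convex : forall t x, times_Q T t -> convex_function setT (H t x) ;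
  sa_H_superlinear : forall K : R, exists rho : R, 0 < rho /\
    forall t x p, times_Q T t -> rho <= enorm p -> K <= H t x p / enorm p ;
  sa_H_semi : forall p,
    (semi1 (times_Q T) Num.norm (fun t x => H t x p) <= M%:E)%E ;
  sa_Hlo : forall p, ereal_inf [set (H z.1 z.2 p)%:E |
    z in [set z : R * 'cV[R]_n | times_Q T z.1]] = (Hlo p)%:E ;
  sa_Hhi : forall p, ereal_sup [set (H z.1 z.2 p)%:E |
    z in [set z : R * 'cV[R]_n | times_Q T z.1]] = (Hhi p)%:E ;
  sa_Hlo_bounded : forall p : 'cV[R]_n, exists K : R,
    \forall p' \near nbhs p, `|Hlo p'| <= K ;
  sa_Hhi_bounded : forall p : 'cV[R]_n, exists K : R,
    \forall p' \near nbhs p, `|Hhi p'| <= K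
}.

(* Under the standing assumption the set below is bounded above whenever
   0 <= t < T (superlinearity of H), so the real-valued [sup] is the true one. *)
Definition legendre {R : realType} {n : nat}
    (H : R -> 'cV[R]_n -> 'cV[R]_n -> R) (t : R) (x q : 'cV[R]_n) : R :=
  sup [set dot p q - H t x p | p in [set: 'cV[R]_n]].

Section brownian.
Context {d : measure_display} {Omega : measurableType d} {R : realType}.
Context {n : nat}.
Variables (P : probability Omega R) (W : R -> Omega -> 'cV[R]_n).

Definition past_events (t : R) : set (set Omega) :=
  [set A | exists s (i : 'I_n) (B : set R),
    [/\ 0 <= s <= t, measurable B & A = (fun w => W s w i 0) @^-1` B]].

Definition raw_filtration (t : R) : set (set Omega) := <<s past_events t >>.

(* When P is complete, the measurable sets of measure zero are all the
   P-negligible sets. *)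
Definition aug_filtration (t : R) : set (set Omega) :=
  <<s past_events t `|` [set A | measurable A /\ P A = 0%E] >>.

Definition incr_event (s t : R) (B : 'I_n -> set R) : set Omega :=
  [set w | forall i, B i ((W t w - W s w) i 0)].

Record brownian_motion : Prop := {
  bm_measurable : forall t i, 0 <= t ->
    measurable_fun [set: Omega] (fun w => W t w i 0) ;
  bm_start : {ae P, forall w, W 0 w = 0} ;
  bm_continuous : {ae P, forall w,
    {within [set t | 0 <= t], continuous (W^~ w)}} ;
  bm_gaussian : forall s t (B : 'I_n -> set R), 0 <= s -> s < t ->
    (forall i, measurable (B i)) ->
    P (incr_event s t B) = (\prod_i normal_prob 0 (Num.sqrt (t - s)) (B i))%E ;
  bm_indep : forall s t (A : set Omega) (B : 'I_n -> set R), 0 <= s -> s < t ->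
    raw_filtration s A -> (forall i, measurable (B i)) ->
    P (A `&` incr_event s t B) = (P A * P (incr_event s t B))%E
}.

Definition is_cond_exp (G : set (set Omega)) (X Z : Omega -> R) : Prop :=
  [/\ P.-integrable setT (EFin \o X),
      P.-integrable setT (EFin \o Z),
      forall B : set R, measurable B -> G (Z @^-1` B) &
      forall A, G A -> (\int[P]_(w in A) (Z w)%:E = \int[P]_(w in A) (X w)%:E)%E].

Variables (sigma : R -> 'cV[R]_n -> 'M[R]_n) (b : R -> 'cV[R]_n -> 'cV[R]_n).
Variables (U : 'cV[R]_n -> R) (H : R -> 'cV[R]_n -> 'cV[R]_n -> R).

Definition euler_step (t : R) (y : 'cV[R]_n) (s : R) (w : Omega) : 'cV[R]_n :=
  y + (s - t) *: b t y + sigma t y *m (W s w - W t w).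

(* [backward t Delta phi x v] says that v = S_t(Delta) phi (x).  Since the
   increment of W after t is independent of the filtration at t, the conditional
   expectation is almost surely equal to a real number [e y]. *)
Definition backward (t Delta : R) (phi : 'cV[R]_n -> R) (x : 'cV[R]_n) (v : R)
    : Prop :=
  exists e : 'cV[R]_n -> R,
    (forall y, is_cond_exp (aug_filtration t)
      (fun w => phi (euler_step t y (t + Delta) w)) (cst (e y))) /\
    let cost y := Delta * legendre H t x (Delta^-1 *: (x - y)) + e y in
    (exists y, v = cost y) /\ (forall y, v <= cost y).

Definition approx_scheme (T Delta : R) (v : R -> 'cV[R]_n -> R) : Prop :=
  (forall t x, 0 <= t <= T - Delta ->
    backward t Delta (v (t + Delta)) x (v t x)) /\
  (forall t x, T - Delta < t <= T -> exists2 r : R,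
    backward (T - Delta) Delta U x r &
    v t x = (t + Delta - T) / Delta * U x + (T - t) / Delta * r).

End brownian.

Section viscosity.
Context {R : realType} {n : nat}.
Implicit Types (phi : R -> 'cV[R]_n -> R).

Definition d_t phi (t : R) (x : 'cV[R]_n) : R := 'D_1 (phi^~ x) t.

Definition d_i (i : 'I_n) phi (t : R) (x : 'cV[R]_n) : R :=
  'D_(delta_mx i 0) (phi t) x.

Definition grad phi t x : 'cV[R]_n := \col_i d_i i phi t x.

Definition hess phi t x : 'M[R]_n := \matrix_(i, j) d_i i (d_i j phi) t x.

Record C12 phi : Prop := {
  C12_cont : cont_on setT phi ;
  C12_t : forall t x, derivable (phi^~ x) t 1 ;
  C12_t_cont : cont_on setT (d_t phi) ;
  C12_x : forall i t x, derivable (phi t) x (delta_mx i 0) ;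
  C12_x_cont : forall i, cont_on setT (d_i i phi) ;
  C12_xx : forall i j t x, derivable (d_i j phi t) x (delta_mx i 0) ;
  C12_xx_cont : forall i j, cont_on setT (d_i i (d_i j phi))
}.

Variables (T : R) (sigma : R -> 'cV[R]_n -> 'M[R]_n).
Variables (b : R -> 'cV[R]_n -> 'cV[R]_n).
Variables (H : R -> 'cV[R]_n -> 'cV[R]_n -> R) (U : 'cV[R]_n -> R).

Definition pde_lhs phi (t : R) (x : 'cV[R]_n) : R :=
  - d_t phi t x - 2^-1 * \tr (sigma t x *m (sigma t x)^T *m hess phi t x)
  - dot (b t x) (grad phi t x) + H t x (grad phi t x).

(* Contact points range over [0, T) x R^n and the extremum is local relative to
   that set, hence one-sided in time at t = 0.  Test functions are C^{1,2} on
   R x R^n: every C^{1,2} function on [0, T) x R^n coincides near a given point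
   with such a function. *)
Definition viscosity_subsolution (u : R -> 'cV[R]_n -> R) : Prop :=
  forall phi t x, C12 phi -> times_Q T t ->
  (\forall z \near ((t, x) : R * 'cV[R]_n), times_Q T z.1 ->
     u z.1 z.2 - phi z.1 z.2 <= u t x - phi t x) ->
  pde_lhs phi t x <= 0.

Definition viscosity_supersolution (u : R -> 'cV[R]_n -> R) : Prop :=
  forall phi t x, C12 phi -> times_Q T t ->
  (\forall z \near ((t, x) : R * 'cV[R]_n), times_Q T z.1 ->
     u t x - phi t x <= u z.1 z.2 - phi z.1 z.2) ->
  0 <= pde_lhs phi t x.

Definition viscosity_solution (u : R -> 'cV[R]_n -> R) : Prop :=
  [/\ viscosity_subsolution u, viscosity_supersolution u &
      forall x, u T x = U x].

End viscosity.

(* Main.v *)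
From HB Require Import structures.
Require Import Defs.
From mathcomp Require Import all_boot all_order all_algebra.
From mathcomp Require Import all_classical all_reals all_analysis.
From mathcomp Require Import measurable_realfun.
From mathcomp Require Import ring lra.

Set Implicit Arguments.
Unset Strict Implicit.
Unset Printing Implicit Defensive.

Import Order.TTheory GRing.Theory Num.Theory.
Import numFieldNormedType.Exports.

Local Open Scope classical_set_scope.
Local Open Scope ring_scope.


(** The proof compares [u] with a smooth subsolution built from the scheme. The scheme
    enters through the inequality that bounds [uDelta], at each step, by the cost of
    each control.

    Write [theta] for the tenth root of the step [D]. Starting from [U], one runs
    the scheme backwards along a grid that ends less than one step before [T], but
    with shaken coefficients: the infimum is also taken over translations, of
    length [O(theta)], of the point at which [sigma], [b] and [H] are read
    ([shaken_step]). The resulting functions are Lipschitz uniformly in the grid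
    ([iterate_lip]), change by [O(sqrt D)] per step ([iterate_increment]), and lie
    above [uDelta] up to [O(theta)] ([scheme_le_iterate]): two states driven by the
    same control and the same increment of [W] separate at a bounded rate, and the
    error made by reading the coefficients elsewhere is a perturbation of their
    initial distance ([cost_coupling]).

    The purpose of the shaking is that all small translates of these functions
    satisfy dynamic programming inequalities with one and the same set of
    coefficients, so that their averages do as well ([shaken_moll]). The averages
    used are iterated Steklov averages, twice in each coordinate direction, at scale
    [theta]: derivatives of the average are averages of difference quotients, so
    that first derivatives are bounded, and second and third derivatives are
    [O(1 / theta)] and [O(1 / theta ^ 2)].

    For a smooth function the dynamic programming inequality can be expanded. The
    expectation produces the second-order operator with an error
    [O(D ^ (3/2) / theta ^ 2)] ([gm_taylor]), and Legendre duality with a bounded,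
    nearly optimal control produces the Hamiltonian ([approximate_duality]). Hence
    the piecewise linear interpolation in time of the smoothed functions is a
    subsolution up to [O(sqrt D / theta ^ 2) = O(theta ^ 3)] ([consistency]). On
    each time slab it is compared with the supersolution [u]; convexity of the
    equation allows to subtract a small multiple of a smoothed norm, so that maxima
    are attained ([slab_comparison]). Adding up the slabs, the total error is the sum
    of [O(theta)] from shaking and smoothing, of [O(theta ^ 3)] from the equation,
    and of [O(D / theta)] from the incomplete slab before [T]
    ([error_estimate]).

    The probabilistic input is reduced to a linear mean that respects quartic
    majorants ([gaussian_mean]), verified for Brownian increments from the moments
    of the normal law ([brownian_gaussian_mean]). *)

(** * Euclidean norms *)

Section EuclideanNorm.
Context {R : realType}.

Lemma enorm_ge0 m n (A : 'M[R]_(m, n)) : 0 <= enorm A.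
Proof. exact: sqrtr_ge0. Qed.

Lemma enorm_sqr m n (A : 'M[R]_(m, n)) :
  enorm A ^+ 2 = \sum_i \sum_j A i j ^+ 2.
Proof.
by rewrite sqr_sqrtr//; do 2! apply: sumr_ge0 => ? _; exact: sqr_ge0.
Qed.

Lemma enormN m n (A : 'M[R]_(m, n)) : enorm (- A) = enorm A.
Proof.
by congr Num.sqrt; do 2! apply: eq_bigr => ? _; rewrite mxE sqrrN.
Qed.

Lemma enormZ m n a (A : 'M[R]_(m, n)) : enorm (a *: A) = `|a| * enorm A.
Proof.
rewrite /enorm -sqrtr_sqr -sqrtrM ?sqr_ge0//; congr Num.sqrt.
rewrite mulr_sumr; apply: eq_bigr => i _; rewrite mulr_sumr.
by apply: eq_bigr => j _; rewrite mxE exprMn.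
Qed.

Lemma enorm0 m n : enorm (0 : 'M[R]_(m, n)) = 0.
Proof. by rewrite -(scale0r 0) enormZ normr0 mul0r. Qed.

Lemma le_enorm m n (A : 'M[R]_(m, n)) r :
  0 <= r -> (enorm A <= r) = (enorm A ^+ 2 <= r ^+ 2).
Proof. by move=> r0; rewrite ler_sqr ?nnegrE ?enorm_ge0. Qed.

Lemma coord_le_enorm m n (A : 'M[R]_(m, n)) i j : `|A i j| <= enorm A.
Proof.
rewrite -ler_sqr ?nnegrE ?enorm_ge0// real_normK ?num_real// enorm_sqr.
rewrite (bigD1 i)//= (bigD1 j)//= -addrA lerDl addr_ge0//.
  by apply: sumr_ge0 => *; exact: sqr_ge0.
by do 2! apply: sumr_ge0 => *; exact: sqr_ge0.
Qed.

Lemma enorm_eq0 m n (A : 'M[R]_(m, n)) : enorm A = 0 -> A = 0.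
Proof.
move=> A0; apply/matrixP => i j; rewrite mxE; apply/eqP.
by rewrite -normr_le0 -A0 coord_le_enorm.
Qed.

Lemma enorm_delta n (i : 'I_n) : enorm (delta_mx i 0 : 'cV[R]_n) = 1.
Proof.
have e : enorm (delta_mx i 0 : 'cV[R]_n) ^+ 2 = 1.
  rewrite enorm_sqr (bigD1 i)//= big_ord1 mxE !eqxx expr1n big1 ?addr0// => j ji.
  by rewrite big_ord1 mxE (negbTE ji) expr0n.
by apply/eqP; rewrite -(eqrXn2 (n := 2))// ?enorm_ge0// e expr1n.
Qed.

Variable n : nat.
Implicit Types p q x y : 'cV[R]_n.

Lemma enorm_sqr_cV x : enorm x ^+ 2 = \sum_i x i 0 ^+ 2.
Proof. by rewrite enorm_sqr; apply: eq_bigr => i _; rewrite big_ord1. Qed.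

Lemma enorm_sqr_dot x : enorm x ^+ 2 = dot x x.
Proof. by rewrite enorm_sqr_cV; apply: eq_bigr => i _; rewrite expr2. Qed.

Lemma dotC p q : dot p q = dot q p.
Proof. by apply: eq_bigr => i _; rewrite mulrC. Qed.

Lemma dotDl p q x : dot (p + q) x = dot p x + dot q x.
Proof. by rewrite -big_split; apply: eq_bigr => i _; rewrite mxE mulrDl. Qed.

Lemma dotZl a p x : dot (a *: p) x = a * dot p x.
Proof. by rewrite mulr_sumr; apply: eq_bigr => i _; rewrite mxE mulrA. Qed.

Lemma dotNl p x : dot (- p) x = - dot p x.
Proof. by rewrite -scaleN1r dotZl mulN1r. Qed.

Lemma dotDr p q x : dot x (p + q) = dot x p + dot x q.
Proof. by rewrite !(dotC x) dotDl. Qed.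

Lemma dotZr a p x : dot x (a *: p) = a * dot x p.
Proof. by rewrite !(dotC x) dotZl. Qed.

Lemma dotNr p x : dot x (- p) = - dot x p.
Proof. by rewrite !(dotC x) dotNl. Qed.

Lemma dot0l x : dot 0 x = 0.
Proof. by rewrite -(scale0r 0) dotZl mul0r. Qed.

Lemma dot0r x : dot x 0 = 0.
Proof. by rewrite dotC dot0l. Qed.

Lemma enorm_sqrD p q :
  enorm (p + q) ^+ 2 = enorm p ^+ 2 + 2 * dot p q + enorm q ^+ 2.
Proof. by rewrite !enorm_sqr_dot !dotDl !dotDr (dotC q p); ring. Qed.

Lemma dot_le_enorm p q : dot p q <= enorm p * enorm q.
Proof.
have [p0|pN0] := eqVneq (enorm p) 0.
  by rewrite (enorm_eq0 p0) dot0l enorm0 mul0r.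
have [q0|qN0] := eqVneq (enorm q) 0.
  by rewrite (enorm_eq0 q0) dot0r enorm0 mulr0.
have := sqr_ge0 (enorm (enorm q *: p + (- enorm p) *: q)).
rewrite enorm_sqrD !enormZ !dotZl !dotZr !exprMn !real_normK ?num_real//.
have pq : 0 < enorm p * enorm q.
  by rewrite mulr_gt0// lt_def enorm_ge0 ?pN0 ?qN0.
move=> h; rewrite -(ler_pM2l pq); lra.
Qed.

Lemma normr_dot_le p q : `|dot p q| <= enorm p * enorm q.
Proof.
by rewrite ler_norml dot_le_enorm andbT lerNl -dotNl -(enormN p) dot_le_enorm.
Qed.

Lemma ler_enormD p q : enorm (p + q) <= enorm p + enorm q.
Proof.
rewrite le_enorm ?addr_ge0 ?enorm_ge0// enorm_sqrD.
have := dot_le_enorm p q; lra.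
Qed.

Lemma ler_enormB p q : enorm (p - q) <= enorm p + enorm q.
Proof. by rewrite -(enormN q) ler_enormD. Qed.

Lemma enorm_le_sum x : enorm x <= \sum_i `|x i 0|.
Proof.
have s0 : 0 <= \sum_i `|x i 0| by apply: sumr_ge0.
rewrite le_enorm// enorm_sqr_cV [leRHS]expr2 mulr_suml ler_sum// => i _.
rewrite -real_normK ?num_real// expr2 ler_wpM2l// (bigD1 i)//= lerDl.
exact: sumr_ge0.
Qed.

Lemma sum_le_enorm x : \sum_i `|x i 0| <= n%:R * enorm x.
Proof.
apply: (le_trans (ler_sum _ (fun i _ => coord_le_enorm x i 0))).
by rewrite sumr_const card_ord mulr_natl.
Qed.

Lemma mx_norm_le_enorm x : `|x| <= enorm x.
Proof.
rewrite [leLHS]/Num.norm /= mx_normrE; apply/bigmax_leP; split=> [|[i j] _].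
  exact: enorm_ge0.
by rewrite /= coord_le_enorm.
Qed.

Lemma coord_le_mx_norm x i : `|x i 0| <= `|x|.
Proof.
by rewrite [leRHS]/Num.norm /= mx_normrE; apply: (le_bigmax _ (fun ij => `|x ij.1 ij.2|) (i, 0)).
Qed.

Lemma enorm_le_mx_norm x : enorm x <= n%:R * `|x|.
Proof.
apply: (le_trans (enorm_le_sum x)).
apply: (le_trans (ler_sum _ (fun i _ => coord_le_mx_norm x i))).
by rewrite sumr_const card_ord mulr_natl.
Qed.

End EuclideanNorm.

(** * Steklov averages *)

Section OneDimensional.
Context {R : realType}.
Implicit Types (g G : R -> R) (a b x y : R).

(** The base point [a] lies strictly to the left of the points of interest, which
    are therefore interior: no one-sided derivative ever occurs. *)
Lemma antiderivative_exists g a : continuous g ->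
  exists G, forall y, a < y -> is_derive y 1 G (g y).
Proof.
move=> cg; pose G y := (\int[lebesgue_measure]_(t in `[a, y]) g t)%R.
exists G => y ay.
have int_g : lebesgue_measure.-integrable `[a, y + 1] (EFin \o g).
  apply: continuous_compact_integrable; first exact: segment_compact.
  exact: continuous_subspaceT.
have y1 : y < y + 1 by rewrite ltrDl.
have [dG GE] := continuous_FTC1_closed y1 int_g ay (cg y).
by rewrite -GE derive1E; apply: DeriveDef.
Qed.

Lemma antiderivative_mvt g G a x y :
  (forall z, a < z -> is_derive z 1 G (g z)) -> a < x -> x <= y ->
  exists c, [/\ x <= c, c <= y & G y - G x = g c * (y - x)].
Proof.
move=> dG ax xy.
have [||c] := @MVT_segment _ G g x y xy.
- by move=> z /[!in_itv]/= /andP[xz _]; apply: dG; exact: lt_trans xz.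
- apply: derivable_within_continuous => z /[!in_itv]/= /andP[xz _].
  by have [] := dG z (lt_le_trans ax xz).
- by rewrite in_itv/= => /andP[xc cy] e; exists c.
Qed.

Lemma integral_antiderivative g G a x y : continuous g ->
  (forall z, a < z -> is_derive z 1 G (g z)) -> a < x -> x < y ->
  (\int[lebesgue_measure]_(t in `[x, y]) g t)%R = G y - G x.
Proof.
move=> cg dG ax xy; rewrite /Rintegral (@continuous_FTC2 _ g G)//.
- exact: continuous_subspaceT.
- have cG z : a < z -> {for z, continuous G}.
    by move=> /dG[+ _] => /derivable1_diffP/differentiable_continuous.
  split; first by move=> z /[!in_itv]/= /andP[xz _]; case: (dG z (lt_trans ax xz)).
    exact/cvg_at_right_filter/cG.
  exact/cvg_at_left_filter/cG/(lt_trans ax).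
- move=> z /[!in_itv]/= /andP[xz _]; rewrite derive1E.
  by have [_ ->] := dG z (lt_trans ax xz).
Qed.

Lemma is_derive_comp_shift G a x h :
  is_derive (x + h) 1 G a -> is_derive x 1 (G \o shift h) a.
Proof.
move=> dG; rewrite -[a]mulr1; apply: is_derive1_comp; exact: is_derive_shift.
Qed.

Lemma le_of_inv_succ (x C : R) : 0 <= C ->
  (forall m : nat, x <= C / m.+1%:R) -> x <= 0.
Proof.
move=> C0 h; rewrite leNgt; apply/negP => x0.
pose m := Num.truncn (C / x).
have := h m; rewrite leNgt => /negP; apply.
rewrite ltr_pdivrMr ?ltr0n// mulrC -ltr_pdivrMr//.
exact: truncnS_gt.
Qed.

Lemma eq_of_inv_succ (x y C : R) : 0 <= C ->
  (forall m : nat, `|x - y| <= C / m.+1%:R) -> x = y.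
Proof.
move=> C0 /(le_of_inv_succ C0); rewrite normr_le0 subr_eq0.
by move/eqP.
Qed.

End OneDimensional.

Section Lipschitz.
Context {R : realType} {n : nat}.
Implicit Types (f g : 'cV[R]_n -> R) (x y z : 'cV[R]_n) (K L e : R).

Definition lip K f := forall x y, `|f x - f y| <= K * enorm (x - y).

Lemma lip_le K L f : K <= L -> lip K f -> lip L f.
Proof.
by move=> KL h x y; rewrite (le_trans (h x y))// ler_wpM2r// enorm_ge0.
Qed.

Lemma lip_shift K f z : lip K f -> lip K (fun x => f (x + z)).
Proof. by move=> h x y; rewrite (le_trans (h _ _))// opprD addrACA subrr addr0. Qed.

Lemma lipD K L f g : lip K f -> lip L g -> lip (K + L) (fun x => f x + g x).
Proof.
move=> hf hg x y; rewrite opprD addrACA mulrDl.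
exact/(le_trans (ler_normD _ _))/lerD.
Qed.

Lemma lipZ K a f : lip K f -> lip (`|a| * K) (fun x => a * f x).
Proof. by move=> h x y; rewrite -mulrBr normrM -mulrA ler_wpM2l. Qed.

Lemma lip_continuous K f : lip K f -> continuous f.
Proof.
move=> hf x; apply/(@cvgrPdist_lt _ _ _ _ (nbhs_filter x)) => e e0.
pose c := `|K| * n%:R + 1.
have c0 : 0 < c by rewrite ltr_wpDl ?mulr_ge0.
apply/(@nbhs_normP _ 'cV[R]_n x); exists (e / c); first exact: divr_gt0.
move=> y; rewrite /= ltr_pdivlMr// => xy.
apply: le_lt_trans (hf x y) _; apply: le_lt_trans xy.
have := enorm_le_mx_norm (x - y); have := enorm_ge0 (x - y).
have := normr_ge0 (x - y); have := ler_norm K; have := normr_ge0 K.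
move: (enorm _) => E; move: `|x - y| => N; rewrite /c => K0 KK N0 E0 EN.
apply: (@le_trans _ _ (`|K| * E)); first by rewrite ler_wpM2r.
apply: (@le_trans _ _ (`|K| * (n%:R * N))); first by rewrite ler_wpM2l.
lra.
Qed.

Lemma lip_enorm : lip 1 (@enorm R n 1).
Proof.
have h x y : enorm x - enorm y <= enorm (x - y).
  by rewrite lerBlDr -{1}(subrK y x) ler_enormD.
by move=> x y; rewrite mul1r ler_norml h andbT lerNl opprB -[leRHS]enormN opprB h.
Qed.

End Lipschitz.

Section Steklov.
Context {R : realType} {n : nat}.
Variable e : R.
Hypothesis e_gt0 : 0 < e.
Implicit Types (f g : 'cV[R]_n -> R) (x y z : 'cV[R]_n) (K L : R).
Implicit Types (i j : 'I_n) (s : seq 'I_n).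

Local Notation delta i := (delta_mx i 0 : 'cV[R]_n).

Definition steklov i f x : R :=
  e^-1 * (\int[lebesgue_measure]_(r in `[0, e]) f (x + r *: delta i))%R.

Definition mean (m : nat) i f x : R :=
  m.+1%:R^-1 * \sum_(k < m.+1) f (x + (k%:R * (e / m.+1%:R)) *: delta i).

Lemma line_continuous K f i x : lip K f ->
  continuous (fun r : R => f (x + r *: delta i)).
Proof.
move=> hf r; apply/(@cvgrPdist_lt _ _ _ _ (nbhs_filter r)) => d d0.
have K0 := normr_ge0 K.
apply/(@nbhs_normP _ R^o r); exists (d / (`|K| + 1)).
  by rewrite /= divr_gt0// ltr_wpDl.
move=> r'; rewrite /= ltr_pdivlMr ?ltr_wpDl// => rr'.
apply: le_lt_trans (hf _ _) _; apply: le_lt_trans rr'.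
rewrite opprD addrACA subrr add0r -scalerBl enormZ enorm_delta mulr1 mulrC.
by rewrite ler_wpM2l// (le_trans (ler_norm K))// lerDl.
Qed.

Lemma steklov_antiderivative K f i x (a : R) (G : R -> R) : lip K f -> a < 0 ->
  (forall r : R, a < r -> is_derive r 1 G (f (x + r *: delta i))) ->
  steklov i f x = e^-1 * (G e - G 0).
Proof.
move=> hf a0 dG; congr (_ * _).
by rewrite (integral_antiderivative (line_continuous hf) dG).
Qed.

(** The averages of a Lipschitz function are uniform limits of finite means, and
    inherit from them their commutation with one another and with expectations:
    exchanging integrals is reduced to exchanging finite sums. *)
Lemma steklov_mean K m i f x : lip K f ->
  `|steklov i f x - mean m i f x| <= K * e / m.+1%:R.
Proof.
move=> hf; have [G dG] := antiderivative_exists (-1) (line_continuous (i := i) (x := x) hf).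
rewrite (steklov_antiderivative hf _ dG) ?ltrN10//.
pose d := e / m.+1%:R.
have d0 : 0 < d by rewrite divr_gt0.
have md : m.+1%:R * d = e by rewrite mulrC divfK ?pnatr_eq0.
have -> : G e - G 0 = \sum_(k < m.+1) (G (k.+1%:R * d) - G (k%:R * d)).
  rewrite -(big_mkord xpredT (fun k => G (k.+1%:R * d) - G (k%:R * d))).
  by rewrite telescope_sumr// md mul0r.
have -> : K * e / m.+1%:R = K * d by rewrite -mulrA.
rewrite /mean -/d.
have -> : m.+1%:R^-1 = e^-1 * d by rewrite /d mulrA mulVf ?gt_eqF// mul1r.
rewrite -mulrA -mulrBr mulr_sumr -sumrB normrM gtr0_norm ?invr_gt0//.
rewrite ler_pdivrMl// mulrC.
apply: (le_trans (ler_norm_sum _ _ _)).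
have -> : K * d * e = \sum_(k < m.+1) (K * d * d).
  by rewrite sumr_const card_ord -mulr_natl -{1}md; ring.
apply: ler_sum => k _.
have kd : k%:R * d <= k.+1%:R * d by rewrite ler_pM2r// ler_nat.
have k0 : -1 < k%:R * d by apply: (lt_le_trans (ltrN10 _)); apply: mulr_ge0 => //; exact: ltW.
have [c [kc ck ->]] := antiderivative_mvt dG k0 kd.
have -> : k.+1%:R * d - k%:R * d = d by rewrite -natr1; ring.
rewrite [X in X - _]mulrC -mulrBr normrM (gtr0_norm d0) [leLHS]mulrC ler_wpM2r ?(ltW d0)//=.
apply: (le_trans (hf _ _)).
rewrite opprD addrACA subrr add0r -scalerBl enormZ enorm_delta mulr1.
have K0 : 0 <= K.
  have := hf (delta i) 0; rewrite subr0 enorm_delta mulr1.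
  exact: le_trans.
rewrite ler_wpM2l// ger0_norm ?subr_ge0//.
by rewrite lerBlDl; move: ck; rewrite -natr1 mulrDl mul1r.
Qed.

(** Because an average is one of the averaged values, pointwise bounds pass to
    averages, and by linearity so do distances and Lipschitz constants. *)
Lemma steklov_val K i f x : lip K f ->
  exists2 r, 0 <= r <= e & steklov i f x = f (x + r *: delta i).
Proof.
move=> hf; have [G dG] := antiderivative_exists (-1) (line_continuous (i := i) (x := x) hf).
rewrite (steklov_antiderivative hf _ dG) ?ltrN10//.
have [c [c0 ce ->]] := antiderivative_mvt dG (ltrN10 _) (ltW e_gt0).
by exists c; rewrite ?c0// subr0 mulrC mulfK// gt_eqF.
Qed.

Lemma steklov_lin K L a b i f g x : lip K f -> lip L g ->
  steklov i (fun y => a * f y + b * g y) x = a * steklov i f x + b * steklov i g x.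
Proof.
move=> hf hg.
have [F dF] := antiderivative_exists (-1) (line_continuous (i := i) (x := x) hf).
have [G dG] := antiderivative_exists (-1) (line_continuous (i := i) (x := x) hg).
rewrite (steklov_antiderivative hf _ dF) ?ltrN10//.
rewrite (steklov_antiderivative hg _ dG) ?ltrN10//.
have dFG (r : R) : -1 < r ->
    is_derive r 1 (a \*: F + b \*: G) (a * f (x + r *: delta i) + b * g (x + r *: delta i)).
  by move=> r1; have := dF r r1; have := dG r r1 => ? ?; apply: is_deriveD.
rewrite (steklov_antiderivative (lipD (lipZ a hf) (lipZ b hg)) (ltrN10 _) dFG).
transitivity (e^-1 * (a * F e + b * G e - (a * F 0 + b * G 0))); first by [].
by ring.
Qed.

Lemma lip_ge0 K i f : lip K f -> 0 <= K.
Proof.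
move=> hf; have := hf (delta i) 0.
by rewrite subr0 enorm_delta mulr1; exact: le_trans.
Qed.

Lemma steklov_shift i f x z :
  steklov i (fun y => f (y + z)) x = steklov i f (x + z).
Proof.
by congr (_ * _); apply: eq_Rintegral => r _; rewrite addrAC.
Qed.

Lemma steklov_lip K i f : lip K f -> lip K (steklov i f).
Proof.
move=> hf x y.
have := steklov_lin 1 (-1) i y (lip_shift (x - y) hf) hf.
rewrite steklov_shift subrKC mul1r mulN1r => <-.
have h : lip (`|1| * K + `|-1| * K) (fun z => 1 * f (z + (x - y)) + -1 * f z).
  by apply: lipD; apply: lipZ => //; exact: lip_shift.
have [r _ ->] := steklov_val i y h.
rewrite mul1r mulN1r (le_trans (hf _ _))//.
by rewrite addrAC subrr add0r.
Qed.

Lemma mean_comm m i j f x : mean m i (mean m j f) x = mean m j (mean m i f) x.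
Proof.
rewrite /mean; congr (_ * _); under eq_bigr do rewrite mulr_sumr.
rewrite exchange_big/=; apply: eq_bigr => k _; rewrite mulr_sumr.
by apply: eq_bigr => l _; rewrite addrAC.
Qed.

Lemma mean_dist m i f g x c : (forall y, `|f y - g y| <= c) ->
  `|mean m i f x - mean m i g x| <= c.
Proof.
move=> fg; rewrite /mean -mulrBr -sumrB normrM gtr0_norm ?invr_gt0//.
rewrite ler_pdivrMl//; apply: (le_trans (ler_norm_sum _ _ _)).
apply: (le_trans (ler_sum _ (fun k _ => fg _))).
by rewrite sumr_const card_ord mulr_natl.
Qed.

Lemma steklov_comm K i j f x : lip K f ->
  steklov i (steklov j f) x = steklov j (steklov i f) x.
Proof.
move=> hf; have K0 := lip_ge0 i hf.
have h i' j' m : `|steklov i' (steklov j' f) x - mean m i' (mean m j' f) x|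
    <= 2 * (K * e) / m.+1%:R.
  rewrite -(subrKA (mean m i' (steklov j' f) x)).
  apply: (le_trans (ler_normD _ _)).
  have := steklov_mean m i' x (steklov_lip j' hf).
  have := mean_dist m i' x (fun y => steklov_mean m j' y hf).
  have -> : 2 * (K * e) / m.+1%:R = K * e / m.+1%:R + K * e / m.+1%:R by ring.
  by move=> ? ?; apply: lerD.
apply: (@eq_of_inv_succ _ _ _ (4 * (K * e))); first by rewrite mulr_ge0// mulr_ge0// ltW.
move=> m; have h1 := h i j m; have h2 := h j i m.
rewrite mean_comm distrC in h2.
have -> : 4 * (K * e) / m.+1%:R =
  2 * (K * e) / m.+1%:R + 2 * (K * e) / m.+1%:R by ring.
rewrite -(subrKA (mean m i (mean m j f) x)).
exact/(le_trans (ler_normD _ _))/lerD.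
Qed.

Definition difference i f x : R := e^-1 * (f (x + e *: delta i) - f x).

(** Derivatives along [v] only see the line through [x]. *)
Lemma is_derive_line (f : 'cV[R]_n -> R) x v a :
  is_derive (0 : R) 1 (fun h => f (x + h *: v)) a -> is_derive x v f a.
Proof.
move=> h; have E : (fun h : R => h^-1 *: ((f \o shift x) (h *: v) - f x)) =
    (fun h : R => h^-1 *: (((fun h => f (x + h *: v)) \o shift 0) (h *: 1) - f (x + 0 *: v))).
  apply/funext => r /=; rewrite addr0 scale0r addr0 [r *: v + x]addrC.
  by rewrite [r *: 1](mulr1 r).
by case: h => d1 d2; split; [rewrite /derivable E|rewrite /derive E].
Qed.

Lemma steklov_derive K i f x : lip K f ->
  is_derive x (delta i) (steklov i f) (difference i f x).
Proof.
move=> hf; apply: is_derive_line.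
have [G dG] := antiderivative_exists (-1) (line_continuous (i := i) (x := x) hf).
have near1 : \forall h \near (0 : R),
    (e^-1 \*: (G \o shift e - G)) h = steklov i f (x + h *: delta i).
  near=> h.
  have h1 : -1 < h by near: h; apply: lt_nbhsr.
  rewrite -[RHS](steklov_shift i f x).
  have dGh (r : R) : -1 - h < r ->
      is_derive r 1 (G \o shift h) (f (x + r *: delta i + h *: delta i)).
    rewrite ltrBlDr => rh; have := dG _ rh.
    rewrite scalerDl addrA => dGr; exact: (is_derive_comp_shift dGr).
  have h0 : -1 - h < 0 by rewrite ltrBlDr add0r.
  rewrite (steklov_antiderivative (lip_shift (h *: delta i) hf) h0 dGh).
  by rewrite !fctE /= add0r (addrC e).
apply: near_eq_is_derive near1 _.
have D0 := dG 0 (ltrN10 _); have De := dG e (lt_trans (ltrN10 _) e_gt0).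
rewrite scale0r addr0 in D0.
apply: is_deriveZ; apply: is_deriveB.
by apply: is_derive_comp_shift; rewrite add0r.
Unshelve. all: by end_near. Qed.

Lemma difference_lip K i f : lip K f -> lip (2 * K / e) (difference i f).
Proof.
move=> hf x y; rewrite /difference -mulrBr normrM gtr0_norm ?invr_gt0//.
rewrite ler_pdivrMl//.
have := hf (x + e *: delta i) (y + e *: delta i); have := hf x y.
rewrite opprD addrACA subrr addr0 !ler_norml => /andP[h1 h2] /andP[h3 h4].
have -> : e * (2 * K / e * enorm (x - y)) = 2 * (K * enorm (x - y)).
  by field; rewrite gt_eqF.
by apply/andP; split; lra.
Qed.

Lemma difference_bound K i f x : lip K f -> `|difference i f x| <= K.
Proof.
move=> hf; rewrite normrM gtr0_norm ?invr_gt0// ler_pdivrMl// mulrC.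
apply: (le_trans (hf _ _)).
by rewrite addrAC subrr add0r enormZ enorm_delta mulr1 gtr0_norm.
Qed.

Lemma difference_dist c i f g x : (forall y, `|f y - g y| <= c) ->
  `|difference i f x - difference i g x| <= 2 * c / e.
Proof.
move=> fg; rewrite -mulrBr normrM gtr0_norm ?invr_gt0// ler_pdivrMl//.
have := fg x; have := fg (x + e *: delta i).
have -> : e * (2 * c / e) = 2 * c by field; rewrite gt_eqF.
by rewrite !ler_norml => /andP[h1 h2] /andP[h3 h4]; apply/andP; split; lra.
Qed.

Fixpoint steklovs s f : 'cV[R]_n -> R :=
  if s is i :: s' then steklov i (steklovs s' f) else f.

Lemma steklovs_lip K s f : lip K f -> lip K (steklovs s f).
Proof. by move=> hf; elim: s => [//|i s IH] /=; exact: steklov_lip. Qed.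

Lemma steklovs_shift s f x z :
  steklovs s (fun y => f (y + z)) x = steklovs s f (x + z).
Proof.
elim: s x => [//|i s IH] x /=; rewrite -steklov_shift.
by congr (steklov i _ x); apply/funext => y; exact: IH.
Qed.

Lemma steklovs_lin K L a b s f g x : lip K f -> lip L g ->
  steklovs s (fun y => a * f y + b * g y) x =
  a * steklovs s f x + b * steklovs s g x.
Proof.
move=> hf hg; elim: s x => [//|i s IH] x /=.
rewrite -(steklov_lin _ _ _ _ (steklovs_lip s hf) (steklovs_lip s hg)).
by congr (steklov i _ x); apply/funext => y; exact: IH.
Qed.

Lemma steklovs_val K s f x : lip K f ->
  exists2 z, enorm z <= (size s)%:R * e & steklovs s f x = f (x + z).
Proof.
move=> hf; elim: s x => [|i s IH] x /=.
  by exists 0; rewrite ?addr0 // enorm0 mul0r.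
have [r /andP[r0 re] ->] := steklov_val i x (steklovs_lip s hf).
have [z zs ->] := IH (x + r *: delta i).
exists (r *: delta i + z); last by rewrite addrA.
apply: (le_trans (ler_enormD _ _)).
rewrite enormZ enorm_delta mulr1 ger0_norm// -natr1 mulrDl mul1r addrC.
exact: lerD.
Qed.

Lemma steklovs_near K s f x : lip K f ->
  `|steklovs s f x - f x| <= K * ((size s)%:R * e).
Proof.
case: s => [|i s] hf; first by rewrite subrr normr0 mul0r mulr0.
have [z zs ->] := steklovs_val (i :: s) x hf.
apply: (le_trans (hf _ _)); rewrite addrAC subrr add0r.
by apply: ler_wpM2l => //; exact: (lip_ge0 i hf).
Qed.

Lemma steklovs_dist K L c s f g x : lip K f -> lip L g ->
  (forall y, `|f y - g y| <= c) -> `|steklovs s f x - steklovs s g x| <= c.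
Proof.
move=> hf hg fg; have := steklovs_lin 1 (-1) s x hf hg.
rewrite mul1r mulN1r => <-.
have [z _ ->] := steklovs_val s x (lipD (lipZ 1 hf) (lipZ (-1) hg)).
by rewrite mul1r mulN1r.
Qed.

Lemma steklovs_bound K c s f x : lip K f ->
  (forall y, `|f y| <= c) -> `|steklovs s f x| <= c.
Proof. by move=> hf fc; have [z _ ->] := steklovs_val s x hf. Qed.

Lemma steklovs_rem K i s f : lip K f -> i \in s ->
  steklovs s f = steklov i (steklovs (rem i s) f).
Proof.
move=> hf; elim: s => [//|j s IH]; rewrite inE /= eq_sym.
have [->//|_/= /IH e'] := eqVneq j i; rewrite e'.
by apply/funext => x; rewrite (steklov_comm _ _ _ (steklovs_lip (rem i s) hf)).
Qed.

Lemma difference_steklovs K i s f : lip K f ->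
  difference i (steklovs s f) = steklovs s (difference i f).
Proof.
move=> hf; apply/funext => x; rewrite /difference.
have := steklovs_lin e^-1 (- e^-1) s x (lip_shift (e *: delta i) hf) hf.
rewrite steklovs_shift mulrBr -mulNr => <-.
by congr (steklovs s _ x); apply/funext => y; rewrite mulrBr mulNr.
Qed.

(** Averaging in direction [i] turns the derivative in that direction into a
    difference quotient; the remaining averages commute with it. *)
Lemma steklovs_derive K i s f x : lip K f -> i \in s ->
  is_derive x (delta i) (steklovs s f) (steklovs (rem i s) (difference i f) x).
Proof.
move=> hf si; rewrite (steklovs_rem hf si) -(difference_steklovs _ _ hf).
exact: (steklov_derive _ _ (steklovs_lip (rem i s) hf)).
Qed.

End Steklov.

(** * Second-order expansions *)

Section Taylor.
Context {R : realType} {n : nat}.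
Implicit Types (v : 'cV[R]_n -> R) (p : 'I_n -> 'cV[R]_n -> R) (x h z : 'cV[R]_n).

Local Notation delta i := (delta_mx i 0 : 'cV[R]_n).

Lemma line_is_derive v x z (r a : R) :
  is_derive (x + r *: z) z v a -> is_derive r 1 (fun t : R => v (x + t *: z)) a.
Proof.
move=> d; have E : (fun t : R => t^-1 *: ((v \o shift (x + r *: z)) (t *: z) - v (x + r *: z))) =
    (fun t : R => t^-1 *: (((fun t => v (x + t *: z)) \o shift r) (t *: 1) - v (x + r *: z))).
  apply/funext => t /=; rewrite [t *: 1](mulr1 t) scalerDl.
  by rewrite addrCA.
by case: d => d1 d2; split; [rewrite /derivable -E|rewrite /derive -E].
Qed.

Lemma is_derive_quadratic (g : R -> R) (s a C : R) :
  (forall r, `|g (s + r) - g s - r * a| <= C * r ^+ 2) -> is_derive s 1 g a.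
Proof.
move=> hC; have C0 : 0 <= C.
  by have := hC 1; rewrite expr1n mulr1; exact: le_trans.
have cv : (fun t : R => t^-1 *: ((g \o shift s) (t *: 1) - g s)) @ 0^' --> a.
  apply/cvgrPdist_le => d d0; near=> t.
  have tN0 : t != 0 by near: t; exact: nbhs_dnbhs_neq.
  rewrite /= [t *: 1](mulr1 t) (addrC t s) distrC.
  have -> : t^-1 *: (g (s + t) - g s) - a = t^-1 * (g (s + t) - g s - t * a).
    rewrite [_ *: _](_ : _ = t^-1 * (g (s + t) - g s))//.
    by field.
  rewrite normrM normfV ler_pdivrMl ?normr_gt0//.
  apply: (le_trans (hC t)); rewrite -real_normK ?num_real// expr2 mulrCA.
  rewrite ler_wpM2l//; have td : `|t| <= d / (C + 1).
    near: t; apply: dnbhs0_le; rewrite divr_gt0//; lra.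
  apply: (@le_trans _ _ ((C + 1) * `|t|)).
    by rewrite ler_wpM2r// lerDl.
  by rewrite mulrC -ler_pdivlMr//; lra.
by split; [apply/cvg_ex; exists a|apply/cvg_lim].
Unshelve. all: by end_near. Qed.

Lemma coordinate_mvt v p i x (r : R) :
  (forall y, is_derive y (delta i) v (p i y)) ->
  exists2 c : R, `|c| <= `|r| &
    v (x + r *: delta i) - v x = r * p i (x + c *: delta i).
Proof.
move=> dv; pose g t := v (x + t *: delta i).
have dg (t : R) : is_derive t 1 g (p i (x + t *: delta i)) by exact: line_is_derive.
have g0 : v x = g 0 by rewrite /g scale0r addr0.
rewrite g0 -/(g r); have [r0|r0] := leP 0 r.
- have [c [c0 cr ->]] := antiderivative_mvt (a := -1) (fun (z : R) _ => dg z) (ltrN10 _) r0.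
  by exists c; [rewrite !ger0_norm|rewrite subr0 mulrC].
- have r1 : r - 1 < r by rewrite ltrBlDr ltrDl.
  have [c [rc c0 e]] := antiderivative_mvt (fun (z : R) _ => dg z) r1 (ltW r0).
  exists c; first by rewrite (ler0_norm c0) (ltr0_norm r0) lerN2.
  by rewrite -opprB e; ring.
Qed.

(** Only partial derivatives are at hand; as they are Lipschitz, moving one
    coordinate at a time gives a uniform first-order expansion. *)
Lemma first_order_expansion v p L x h :
  (forall i y, is_derive y (delta i) v (p i y)) -> (forall i, lip L (p i)) ->
  `|v (x + h) - v x - \sum_i h i 0 * p i x| <= L * (\sum_i `|h i 0|) ^+ 2.
Proof.
move=> dv pL.
have main (s : seq 'I_n) y :
    `|v (y + \sum_(i <- s) h i 0 *: delta i) - v y - \sum_(i <- s) h i 0 * p i y|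
    <= L * (\sum_(i <- s) `|h i 0|) ^+ 2.
  elim: s y => [|i s IH] y.
    by rewrite !big_nil addr0 subrr subr0 normr0 expr0n mulr0.
  rewrite !big_cons addrA; set y' := y + _; pose S : R := \sum_(j <- s) `|h j 0|.
  have L0 : 0 <= L := lip_ge0 i (pL i).
  have S0 : 0 <= S by apply: sumr_ge0.
  have e1 := IH y'.
  have [c cr e2] := coordinate_mvt y (h i 0) (dv i).
  have e3 : `|\sum_(j <- s) h j 0 * p j y' - \sum_(j <- s) h j 0 * p j y| <= S * (L * `|h i 0|).
    rewrite -sumrB mulr_suml; apply: (le_trans (ler_norm_sum _ _ _)).
    apply: ler_sum => j _; rewrite -mulrBr normrM ler_wpM2l//.
    apply: (le_trans (pL j _ _)); rewrite /y' addrAC subrr add0r.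
    by rewrite enormZ enorm_delta mulr1.
  have e4 : `|v y' - v y - h i 0 * p i y| <= `|h i 0| * (L * `|h i 0|).
    rewrite e2 -mulrBr normrM ler_wpM2l//; apply: (le_trans (pL i _ _)).
    rewrite addrAC subrr add0r enormZ enorm_delta mulr1.
    by rewrite ler_wpM2l.
  rewrite (_ : _ - _ - _ = (v (y' + \sum_(i <- s) h i 0 *: delta i) - v y' - \sum_(j <- s) h j 0 * p j y')
    + ((\sum_(j <- s) h j 0 * p j y' - \sum_(j <- s) h j 0 * p j y)
    + (v y' - v y - h i 0 * p i y))); last by ring.
  apply: (le_trans (ler_normD _ _)); apply: (le_trans (lerD e1 (ler_normD _ _))).
  apply: (le_trans (lerD (lexx _) (lerD e3 e4))).
  have : 0 <= L * (S * `|h i 0|) by rewrite !mulr_ge0.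
  rewrite -/S; move: `|h i 0| => a; lra.
have hE : h = \sum_i h i 0 *: delta i.
  apply/colP => k; rewrite summxE (bigD1 k)//= big1 ?addr0 => [|j jk].
    by rewrite !mxE !eqxx mulr1.
  by rewrite !mxE eq_sym (negbTE jk) mulr0.
by have := main (index_enum _) x; rewrite -hE.
Qed.

(** Applied to ever shorter pieces of a segment, the uniform expansion turns
    partial derivatives into the derivative along the segment. *)
Lemma segment_is_derive v p L x h (s : R) :
  (forall i y, is_derive y (delta i) v (p i y)) -> (forall i, lip L (p i)) ->
  is_derive s 1 (fun r : R => v (x + r *: h)) (\sum_i h i 0 * p i (x + s *: h)).
Proof.
move=> dv pL; apply: (@is_derive_quadratic _ _ _ (L * (\sum_i `|h i 0|) ^+ 2)) => r.
have := first_order_expansion (x + s *: h) (r *: h) dv pL.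
rewrite -[x + _ + _]addrA -scalerDl mulr_sumr.
under eq_bigr do rewrite mxE -mulrA.
under [in X in _ <= X]eq_bigr do rewrite mxE normrM.
rewrite -[in X in _ <= X]mulr_sumr exprMn real_normK ?num_real//.
by rewrite mulrA [_ * r ^+ 2]mulrAC.
Qed.

Lemma taylor1D (g g1 g2 : R -> R) D :
  (forall s : R, is_derive s 1 g (g1 s)) ->
  (forall s : R, is_derive s 1 g1 (g2 s)) ->
  (forall s, 0 <= s <= 1 -> g2 s <= D) -> g 1 <= g 0 + g1 0 + D / 2.
Proof.
move=> dg dg1 g2D.
pose psi s := g s - s * g1 0 - s ^+ 2 * (D / 2).
have dpsi (s : R) : is_derive s 1 psi (g1 s - g1 0 - s * D).
  rewrite /psi; apply: is_derive_eq; rewrite /GRing.scale/=.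
  by field.
have [c [c0 c1 e]] := antiderivative_mvt (a := -1) (fun (z : R) _ => dpsi z) (ltrN10 _) ler01.
have [d [d0 dc e']] := antiderivative_mvt (a := -1) (fun (z : R) _ => dg1 z) (ltrN10 _) c0.
have : g2 d <= D by apply: g2D; rewrite d0 (le_trans dc).
rewrite e' subr0 in e.
have : psi 1 - psi 0 <= 0.
  rewrite e subr0 mulr1 mulrC -mulrBr mulr_ge0_le0// subr_le0.
  by apply: g2D; rewrite d0 (le_trans dc).
by rewrite /psi expr0n expr1n /=; lra.
Qed.

Lemma second_order_expansion v p (q : 'I_n -> 'I_n -> 'cV[R]_n -> R) L L2 x h :
  (forall i y, is_derive y (delta i) v (p i y)) -> (forall i, lip L (p i)) ->
  (forall i j y, is_derive y (delta i) (p j) (q i j y)) ->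
  (forall i j, lip L2 (q i j)) ->
  v (x + h) <= v x + \sum_i h i 0 * p i x +
    (\sum_i \sum_j h i 0 * h j 0 * q i j x + L2 * (\sum_i `|h i 0|) ^+ 3) / 2.
Proof.
move=> dv pL dp qL.
pose g (s : R) := v (x + s *: h).
pose g1 (s : R) := \sum_j h j 0 * p j (x + s *: h).
pose g2 (s : R) := \sum_j h j 0 * \sum_i h i 0 * q i j (x + s *: h).
have dg (s : R) : is_derive s 1 g (g1 s) := segment_is_derive x h s dv pL.
have dg1 (s : R) : is_derive s 1 g1 (g2 s).
  have -> : g1 = \sum_j (fun r : R => h j 0 * p j (x + r *: h)).
    by apply/funext => r; rewrite fct_sumE.
  apply: is_derive_sum => j; apply: is_deriveZ.
  by apply: segment_is_derive => // i y; exact: dp.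
have := taylor1D dg dg1 (D := g2 0 + L2 * (\sum_i `|h i 0|) ^+ 3).
rewrite /g /g1 /g2 !scale0r !addr0 scale1r.
set A := \sum_j _ * \sum_i _; set B := \sum_i \sum_j _ in |- *.
have -> : B = A.
  rewrite /A /B exchange_big/=; apply: eq_bigr => j _; rewrite mulr_sumr.
  by apply: eq_bigr => i _; ring.
apply=> s /andP[s0 s1]; rewrite -lerBlDl.
rewrite -sumrB exprS expr2 mulrCA mulr_suml; apply: ler_sum => j _.
rewrite -mulrBr; apply: (le_trans (ler_norm _)); rewrite normrM ler_wpM2l//.
rewrite -sumrB mulrCA mulr_suml; apply: (le_trans (ler_norm_sum _ _ _)).
apply: ler_sum => i _; rewrite -mulrBr normrM ler_wpM2l//.
apply: (le_trans (qL i j _ _)); rewrite addrAC subrr add0r enormZ ger0_norm//.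
rewrite ler_wpM2l//; first exact: (lip_ge0 i (qL i j)).
by rewrite (le_trans _ (enorm_le_sum h))// ler_piMl// enorm_ge0.
Qed.

End Taylor.

Section Mollifier.
Context {R : realType} {n : nat}.
Variable e : R.
Hypothesis e_gt0 : 0 < e.
Implicit Types (f g : 'cV[R]_n -> R) (x y z : 'cV[R]_n) (K L : R) (i j : 'I_n).

Local Notation delta i := (delta_mx i 0 : 'cV[R]_n).

(** Every direction occurs twice, since each of two derivatives consumes one
    average in its direction. *)
Definition directions := enum 'I_n ++ enum 'I_n.

Definition moll f := steklovs e directions f.

(** The first and second partial derivatives of [moll f]: difference quotients
    averaged in the remaining directions, hence bounded and Lipschitz as soon as
    [f] is Lipschitz. *)
Definition moll1 i f := steklovs e (rem i directions) (difference e i f).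

Definition moll2 i j f :=
  steklovs e (rem i (rem j directions)) (difference e i (difference e j f)).

Lemma count_directions i : count_mem i directions = 2%N.
Proof. by rewrite count_cat count_uniq_mem ?enum_uniq// mem_enum. Qed.

Lemma mem_directions i : i \in directions.
Proof. by rewrite -has_pred1 has_count count_directions. Qed.

Lemma mem_rem_directions i j : i \in rem j directions.
Proof.
have := count_directions i.
rewrite (permP (perm_to_rem (mem_directions j)))/= -has_pred1 has_count.
by case: (j == i) => /=; rewrite ?add1n ?add0n; [case=> ->|move=> ->].
Qed.

Lemma size_directions : size directions = (n + n)%N.
Proof. by rewrite size_cat size_enum_ord. Qed.

Lemma moll_derive K f i x : lip K f ->
  is_derive x (delta i) (moll f) (moll1 i f x).
Proof. by move=> hf; exact: (steklovs_derive e_gt0 x hf (mem_directions i)). Qed.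

Lemma moll1_derive K f i j x : lip K f ->
  is_derive x (delta i) (moll1 j f) (moll2 i j f x).
Proof.
move=> hf.
exact: (steklovs_derive e_gt0 x (difference_lip e_gt0 j hf) (mem_rem_directions i j)).
Qed.

Lemma moll_lip K f : lip K f -> lip K (moll f).
Proof. exact: steklovs_lip. Qed.

Lemma moll1_lip K f i : lip K f -> lip (2 * K / e) (moll1 i f).
Proof. by move=> hf; apply/steklovs_lip/difference_lip. Qed.

Lemma moll2_lip K f i j : lip K f -> lip (2 * (2 * K / e) / e) (moll2 i j f).
Proof. by move=> hf; apply/steklovs_lip/difference_lip/difference_lip. Qed.

Lemma moll_near K f x : lip K f -> `|moll f x - f x| <= K * ((n + n)%:R * e).
Proof. by move=> hf; rewrite -size_directions; exact: steklovs_near. Qed.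

Lemma moll1_bound K f i x : lip K f -> `|moll1 i f x| <= K.
Proof.
move=> hf; apply: steklovs_bound => //; first exact: (difference_lip e_gt0 i hf).
by move=> y; exact: difference_bound.
Qed.

Lemma moll2_bound K f i j x : lip K f -> `|moll2 i j f x| <= 2 * K / e.
Proof.
move=> hf; have h := difference_lip e_gt0 j hf.
apply: steklovs_bound => //; first exact: (difference_lip e_gt0 i h).
by move=> y; exact: difference_bound.
Qed.

Lemma moll1_dist K L c f g i x : lip K f -> lip L g ->
  (forall y, `|f y - g y| <= c) -> `|moll1 i f x - moll1 i g x| <= 2 * c / e.
Proof.
move=> hf hg fg; apply: (steklovs_dist e_gt0 _ _ (difference_lip e_gt0 i hf) (difference_lip e_gt0 i hg)).
by move=> y; exact: difference_dist.
Qed.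

Lemma moll2_dist K L c f g i j x : lip K f -> lip L g ->
  (forall y, `|f y - g y| <= c) ->
  `|moll2 i j f x - moll2 i j g x| <= 2 * (2 * c / e) / e.
Proof.
move=> hf hg fg; apply: (steklovs_dist e_gt0 _ _
  (difference_lip e_gt0 i (difference_lip e_gt0 j hf))
  (difference_lip e_gt0 i (difference_lip e_gt0 j hg))) => y.
by apply: difference_dist => // z; exact: difference_dist.
Qed.

Lemma difference_lin a b i f g :
  difference e i (fun y => a * f y + b * g y) =
  (fun y => a * difference e i f y + b * difference e i g y).
Proof. by apply/funext => y; rewrite /difference; ring. Qed.

Lemma moll_lin K L a b f g x : lip K f -> lip L g ->
  moll (fun y => a * f y + b * g y) x = a * moll f x + b * moll g x.
Proof. exact: steklovs_lin. Qed.

Lemma moll1_lin K L a b i f g x : lip K f -> lip L g ->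
  moll1 i (fun y => a * f y + b * g y) x = a * moll1 i f x + b * moll1 i g x.
Proof.
move=> hf hg; rewrite /moll1 difference_lin.
exact: (steklovs_lin e_gt0 _ _ _ _ (difference_lip e_gt0 i hf) (difference_lip e_gt0 i hg)).
Qed.

Lemma moll2_lin K L a b i j f g x : lip K f -> lip L g ->
  moll2 i j (fun y => a * f y + b * g y) x = a * moll2 i j f x + b * moll2 i j g x.
Proof.
move=> hf hg; rewrite /moll2 !difference_lin.
exact: (steklovs_lin e_gt0 _ _ _ _ (difference_lip e_gt0 i (difference_lip e_gt0 j hf))
   (difference_lip e_gt0 i (difference_lip e_gt0 j hg))).
Qed.

Lemma moll_taylor K f x h : lip K f ->
  moll f (x + h) <= moll f x + \sum_i h i 0 * moll1 i f x +
    (\sum_i \sum_j h i 0 * h j 0 * moll2 i j f x +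
     2 * (2 * K / e) / e * (\sum_i `|h i 0|) ^+ 3) / 2.
Proof.
move=> hf; apply: (@second_order_expansion _ _ _ (fun i => moll1 i f)
  (fun i j => moll2 i j f) (2 * K / e)).
- by move=> i y; exact: (moll_derive i y hf).
- by move=> i; exact: (moll1_lip i hf).
- by move=> i j y; exact: (moll1_derive i j y hf).
- by move=> i j; exact: (moll2_lip i j hf).
Qed.

End Mollifier.

(** * Gaussian moments *)

Section RealIntegrable.
Context d (T : measurableType d) (R : realType) (mu : {measure set T -> \bar R}).
Implicit Types (f g : T -> R).

Definition rintegrable f := mu.-integrable setT (EFin \o f).

Lemma rintegrableD f g :
  rintegrable f -> rintegrable g -> rintegrable (fun x => f x + g x).
Proof. by move=> hf hg; exact: (integrableD measurableT hf hg). Qed.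

Lemma rintegrableZ a f : rintegrable f -> rintegrable (fun x => a * f x).
Proof. by move=> hf; exact: (integrableZl measurableT a hf). Qed.

Lemma rintegrable_sum (I : Type) (r : seq I) (F : I -> T -> R) :
  (forall i, rintegrable (F i)) -> rintegrable (fun x => \sum_(i <- r) F i x).
Proof.
move=> h; elim: r => [|i r IH].
  have -> : (fun x => \sum_(i <- [::]) F i x) = (fun _ => 0).
    by apply/funext => x; rewrite big_nil.
  exact: integrable0.
have -> : (fun x => \sum_(j <- i :: r) F j x) =
    (fun x => F i x + \sum_(j <- r) F j x).
  by apply/funext => x; rewrite big_cons.
exact: rintegrableD.
Qed.

Lemma rintegral_sum (I : Type) (r : seq I) (F : I -> T -> R) :
  (forall i, rintegrable (F i)) ->
  \int[mu]_x (\sum_(i <- r) F i x) = \sum_(i <- r) \int[mu]_x F i x.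
Proof.
move=> h; elim: r => [|i r IH].
  rewrite big_nil; transitivity (\int[mu]_x (0 : R)).
    by apply: eq_Rintegral => x _; rewrite big_nil.
  by rewrite /Rintegral integral0.
rewrite big_cons -IH -RintegralD//; [|exact: h|exact: (rintegrable_sum _ h)].
by apply: eq_Rintegral => x _; rewrite big_cons.
Qed.

End RealIntegrable.

Lemma rintegrable_cst d (T : measurableType d) (R : realType)
  (mu : {finite_measure set T -> \bar R}) c : rintegrable mu (fun=> c).
Proof. exact: finite_measure_integrable_cst. Qed.

Section GaussianMoments.
Context {R : realType}.
Local Notation mu := (@lebesgue_measure R).
Implicit Types (s m r x : R).

(** Integrals against the Gaussian law are integrals of the density: its
    Radon-Nikodym derivative agrees with the density almost everywhere. *)
Lemma ge0_integral_normal s (f : R -> R) : measurable_fun setT f ->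
  (forall x, 0 <= f x) ->
  (\int[normal_prob 0 s]_x (f x)%:E = \int[mu]_x (f x * normal_pdf 0 s x)%:E)%E.
Proof.
move=> mf f0; have dom := @normal_prob_dominates R 0 s.
have mE : measurable_fun setT (fun x : measurableTypeR R => (f x)%:E).
  exact/measurable_EFinP.
have fE0 x : (0 <= (f x)%:E)%E by rewrite lee_fin.
rewrite -(Radon_Nikodym_SigmaFinite.change_of_variables dom fE0 measurableT mE).
under [RHS]eq_integral do rewrite EFinM.
have intRN := Radon_Nikodym_SigmaFinite.f_integrable dom.
apply: ge0_ae_eq_integral => //.
- by apply: emeasurable_funM => //; exact: measurable_int intRN.
- by apply: emeasurable_funM => //; apply/measurable_EFinP; exact: measurable_normal_pdf.
- by move=> x _; rewrite mule_ge0 ?lee_fin// Radon_Nikodym_SigmaFinite.f_ge0.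
- by move=> x _; rewrite mule_ge0 ?lee_fin// normal_pdf_ge0.
- apply: ae_eqe_mul2l; apply: integral_ae_eq => //.
  + by apply/measurable_EFinP; exact: measurable_normal_pdf.
  + by move=> E _ mEE; rewrite -Radon_Nikodym_SigmaFinite.f_integral.
Qed.

(** The exponential moments of a Gaussian come without computation: they express
    that every other Gaussian density has total mass one.  The tangent line
    inequality for the exponential turns them into exact values of the first two
    moments, by letting the other density tend to the given one. *)
Lemma normal_density_change s m r : 0 < s -> 0 < r ->
  (\int[normal_prob 0 s]_x
    (expR (x ^+ 2 / (s ^+ 2 *+ 2) - (x - m) ^+ 2 / ((s * r) ^+ 2 *+ 2)))%:E = r%:E)%E.
Proof.
move=> s0 r0; have sN0 : s != 0 by rewrite gt_eqF.
have srN0 : s * r != 0 by rewrite mulf_neq0 ?gt_eqF.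
rewrite ge0_integral_normal; last 2 first.
- apply: measurableT_comp => //; apply: measurable_funB.
    by apply: measurable_funM => //; exact: measurable_funX.
  apply: measurable_funM => //; apply: measurable_funX.
  exact: measurable_funB.
- by move=> x; exact: expR_ge0.
have -> : (fun x => (expR (x ^+ 2 / (s ^+ 2 *+ 2) -
    (x - m) ^+ 2 / ((s * r) ^+ 2 *+ 2)) * normal_pdf 0 s x)%:E) =
  (fun x => r%:E * (normal_pdf m (s * r) x)%:E)%E.
  apply/funext => x; rewrite -EFinM; congr (_%:E).
  rewrite !normal_pdfE// /normal_fun subr0.
  have -> : normal_peak s = r * normal_peak (s * r).
    rewrite /normal_peak exprMn.
    have -> : s ^+ 2 * r ^+ 2 * pi *+ 2 = r ^+ 2 * (s ^+ 2 * pi *+ 2).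
      by ring.
    by rewrite sqrtrM ?sqr_ge0// sqrtr_sqr gtr0_norm// invfM mulrA divff ?gt_eqF// mul1r.
  rewrite mulrC -!mulrA; congr (_ * (_ * _)); rewrite -expRD; congr expR.
  by rewrite !mulNr; ring.
by rewrite integralZl//= ?integral_normal_pdf ?mule1//; exact: integrable_normal_pdf.
Qed.

Lemma normal_density_change_integrable s m r : 0 < s -> 0 < r ->
  (normal_prob 0 s).-integrable setT (EFin \o (fun x =>
    expR (x ^+ 2 / (s ^+ 2 *+ 2) - (x - m) ^+ 2 / ((s * r) ^+ 2 *+ 2)))).
Proof.
move=> s0 r0; apply/integrableP; split.
  apply/measurable_EFinP.
  apply: measurableT_comp => //; apply: measurable_funB.
    by apply: measurable_funM => //; exact: measurable_funX.
  apply: measurable_funM => //; apply: measurable_funX.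
  exact: measurable_funB.
under eq_integral do rewrite /= ger0_norm ?expR_ge0//.
by rewrite normal_density_change// ltry.
Qed.

(** The ratio of the Gaussian densities of deviations [2 s] and [s] grows like an
    exponential of [x ^ 2], whose quadratic term already dominates [x ^ 4]. *)
Lemma normal_fourth_moment_bound s x : 0 < s ->
  x ^+ 4 <= 16 * s ^+ 4 *
    expR (x ^+ 2 / (s ^+ 2 *+ 2) - (x - 0) ^+ 2 / ((s * 2) ^+ 2 *+ 2)).
Proof.
move=> s0; rewrite subr0 exprMn.
set E := _ - _; have E0 : E = 3 / 8 * (x ^+ 2 / s ^+ 2).
  by rewrite /E; field; rewrite gt_eqF.
have := @expR_ge1Dxn R E 1; rewrite E0 mulr_ge0 ?divr_ge0 ?sqr_ge0// => /(_ isT).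
have -> : 2`!%:R = 2 :> R by [].
move=> h.
apply: (@le_trans _ _ (16 * s ^+ 4 * ((3 / 8 * (x ^+ 2 / s ^+ 2)) ^+ 2 / 2))).
  rewrite exprMn [(_ / s ^+ 2) ^+ 2]exprMn exprVn -!exprM.
  have -> : 16 * s ^+ 4 * ((3 / 8) ^+ 2 * (x ^+ 4 / s ^+ 4) / 2) = (9 / 8) * x ^+ 4.
    by field; rewrite gt_eqF.
  have : 0 <= x ^+ 4 by rewrite exprn_even_ge0.
  lra.
rewrite ler_wpM2l ?mulr_ge0 ?exprn_ge0 ?(ltW s0)//.
by apply: le_trans h; rewrite lerDr.
Qed.

Lemma normal_fourth_moment_integrable s : 0 < s ->
  (normal_prob 0 s).-integrable setT (EFin \o (fun x => x ^+ 4)).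
Proof.
move=> s0; have := normal_density_change_integrable 0 s0 (ltr0n R 2 : 0 < 2%:R :> R).
move/(integrableZl (measurableT) (16 * s ^+ 4)) => h.
apply: le_integrable h => //.
  by apply/measurable_EFinP; exact: measurable_funX.
move=> x _ /=; rewrite lee_fin ger0_norm ?exprn_even_ge0//.
by rewrite ger0_norm ?normal_fourth_moment_bound// mulr_ge0 ?expR_ge0// mulr_ge0// exprn_ge0// ltW.
Qed.

Lemma normal_moment_integrable s k : 0 < s -> (k <= 4)%N ->
  (normal_prob 0 s).-integrable setT (EFin \o (fun x => x ^+ k)).
Proof.
move=> s0 k4.
have h1 : rintegrable (normal_prob 0 s) (fun x => 1 + x ^+ 4).
  by apply: rintegrableD; [exact: rintegrable_cst|exact: normal_fourth_moment_integrable].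
apply: le_integrable h1 => //.
  by apply/measurable_EFinP; exact: measurable_funX.
move=> x _ /=; rewrite lee_fin [leRHS]ger0_norm ?addr_ge0 ?exprn_even_ge0//.
rewrite normrX -[x ^+ 4](ger0_norm (exprn_even_ge0 _ _))// normrX.
have [x1|x1] := leP `|x| 1.
  by apply: (@le_trans _ _ 1); [exact: exprn_ile1|rewrite lerDl exprn_ge0].
by rewrite (le_trans (ler_weXn2l _ k4)) ?ltW// ltrDr.
Qed.

Definition normal_moment s k : R := \int[normal_prob 0 s]_x (x ^+ k).

Lemma normal_moment_poly s a b c : 0 < s ->
  \int[normal_prob 0 s]_x (a + (b * x ^+ 1 + c * x ^+ 2)) =
  a + (b * normal_moment s 1 + c * normal_moment s 2).
Proof.
move=> s0; have i1 := normal_moment_integrable s0 (isT : 1 <= 4)%N.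
have i2 := normal_moment_integrable s0 (isT : 2 <= 4)%N.
have i0 : (normal_prob 0 s).-integrable setT (EFin \o cst a).
  exact: finite_measure_integrable_cst.
have j1 := rintegrableZ b i1.
have j2 := rintegrableZ c i2.
rewrite RintegralD//; last exact: (rintegrableD j1 j2).
rewrite RintegralD// !RintegralZl// Rintegral_cst//.
rewrite [X in a * fine X](_ : _ = 1%E) ?mulr1//.
exact: (probability_setT (normal_prob 0 s)).
Qed.

(** The tangent line of the exponential, integrated. Both [m] and [r] are free:
    [m] gives the first moment, and [r] near [1] the second. *)
Lemma normal_moment_tangent s m r : 0 < s -> 0 < r ->
  (1 - m ^+ 2 / (2 * s ^+ 2 * r ^+ 2)) + (m / (s ^+ 2 * r ^+ 2) * normal_moment s 1 +
    (1 - r ^- 2) / (2 * s ^+ 2) * normal_moment s 2) <= r.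
Proof.
move=> s0 r0; rewrite -normal_moment_poly//.
have h := normal_density_change m s0 r0.
have hr : \int[normal_prob 0 s]_x (expR (x ^+ 2 / (s ^+ 2 *+ 2)
    - (x - m) ^+ 2 / ((s * r) ^+ 2 *+ 2))) = r by rewrite /Rintegral h.
rewrite -[leRHS]hr.
apply: le_Rintegral => //.
- have i1 := normal_moment_integrable s0 (isT : 1 <= 4)%N.
  have i2 := normal_moment_integrable s0 (isT : 2 <= 4)%N.
  apply: rintegrableD; first exact: rintegrable_cst.
  by apply: rintegrableD; exact: rintegrableZ.
- exact: normal_density_change_integrable.
- move=> /= x _; apply: le_trans (expR_ge1Dx _); rewrite expr1; move: (x : R) => {}x.
  rewrite le_eqVlt; apply/orP; left; apply/eqP; field.
  by rewrite !gt_eqF.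
Qed.

Lemma normal_moment1 s : 0 < s -> normal_moment s 1 = 0.
Proof.
(* shifting by the mean itself is the optimal choice *)
move=> s0; have := normal_moment_tangent (normal_moment s 1) s0 ltr01.
move: (normal_moment s 1) => M1.
rewrite expr1n invr1 subrr !mul0r addr0 !mulr1 => h.
have s2 : 0 < s ^+ 2 by rewrite exprn_gt0.
have : M1 ^+ 2 <= 0.
  have : 1 - M1 ^+ 2 / (2 * s ^+ 2) + M1 / s ^+ 2 * M1 =
    1 + M1 ^+ 2 / (2 * s ^+ 2) by field; rewrite gt_eqF.
  move=> e; move: h; rewrite e gerDl pmulr_lle0//.
  by rewrite invr_gt0 mulr_gt0.
by rewrite real_exprn_even_le0 ?num_real// => /eqP.
Qed.

Lemma normal_moment2 s : 0 < s -> normal_moment s 2 = s ^+ 2.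
Proof.
move=> s0; have s2 : 0 < s ^+ 2 by rewrite exprn_gt0.
have key r : 0 < r -> (r ^+ 2 - 1) * normal_moment s 2 <= 2 * s ^+ 2 * r ^+ 2 * (r - 1).
  move=> r0; have := normal_moment_tangent 0 s0 r0; have r2 : 0 < r ^+ 2 by rewrite exprn_gt0.
  rewrite expr0n !mul0r subr0 add0r -lerBrDl.
  rewrite -(ler_pM2l (_ : 0 < 2 * s ^+ 2 * r ^+ 2)); last by rewrite !mulr_gt0.
  congr (_ <= _); field; by rewrite !gt_eqF.
move: (normal_moment s 2) key => M key.
(* divide by [r - 1] and let [r] tend to [1] from either side *)
apply/eqP; rewrite eq_le; apply/andP; split; rewrite -subr_le0.
- apply: (@le_of_inv_succ _ _ (3 * s ^+ 2)); first by rewrite mulr_ge0// ltW.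
  move=> m; have h0 : 0 < m.+1%:R^-1 :> R by rewrite invr_gt0.
  have h1 : m.+1%:R^-1 <= 1 :> R by rewrite invf_le1// ler1n.
  have := key (1 + m.+1%:R^-1); move: m.+1%:R^-1 h0 h1 => h h0 h1.
  move=> /(_ (ltr_wpDl ler01 h0)).
  have -> : ((1 + h) ^+ 2 - 1) * M = h * ((2 + h) * M) by ring.
  have -> : 2 * s ^+ 2 * (1 + h) ^+ 2 * (1 + h - 1) = h * (2 * s ^+ 2 * (1 + h) ^+ 2) by ring.
  rewrite ler_pM2l// => k; rewrite -(ler_pM2l (_ : 0 < 2 + h)); last lra.
  nra.
- apply: (@le_of_inv_succ _ _ (3 * s ^+ 2)); first by rewrite mulr_ge0// ltW.
  move=> m; have h0 : 0 < m.+2%:R^-1 :> R by rewrite invr_gt0.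
  have h1 : m.+2%:R^-1 < 1 :> R by rewrite invf_lt1// ltr1n.
  have h2 : m.+2%:R^-1 <= m.+1%:R^-1 :> R by rewrite lef_pV2 ?posrE// ler_nat.
  have := key (1 - m.+2%:R^-1); move: m.+2%:R^-1 h0 h1 h2 => h h0 h1 h2.
  rewrite subr_gt0 => /(_ h1).
  have -> : ((1 - h) ^+ 2 - 1) * M = - (h * ((2 - h) * M)) by ring.
  have -> : 2 * s ^+ 2 * (1 - h) ^+ 2 * (1 - h - 1) = - (h * (2 * s ^+ 2 * (1 - h) ^+ 2)) by ring.
  rewrite lerN2 ler_pM2l// => k.
  apply: (@le_trans _ _ (3 * s ^+ 2 * h)); last by rewrite ler_wpM2l// mulr_ge0// ltW.
  rewrite -(ler_pM2l (_ : 0 < 2 - h)); last lra.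
  nra.
Qed.

Lemma normal_moment4 s : 0 < s -> normal_moment s 4 <= 32 * s ^+ 4.
Proof.
move=> s0; have := normal_density_change 0 s0 (ltr0n R 2).
move=> h; have h2 : \int[normal_prob 0 s]_x (expR (x ^+ 2 / (s ^+ 2 *+ 2)
    - (x - 0) ^+ 2 / ((s * 2) ^+ 2 *+ 2))) = 2 by rewrite /Rintegral h.
have i := normal_density_change_integrable 0 s0 (ltr0n R 2).
have -> : 32 * s ^+ 4 = 16 * s ^+ 4 * 2 by ring.
rewrite -[X in _ <= _ * X]h2 -RintegralZl//.
apply: le_Rintegral => //; first exact: normal_fourth_moment_integrable.
  exact: (integrableZl measurableT _ i).
by move=> x _; exact: normal_fourth_moment_bound.
Qed.

End GaussianMoments.

(** * Averages over Brownian increments *)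

Section LawTransfer.
Context d d' (T : measurableType d) (Y : measurableType d') (R : realType).
Variables (P : {measure set T -> \bar R}) (X : T -> Y) (nu : {measure set Y -> \bar R}).
Hypothesis mX : measurable_fun setT X.
Hypothesis law : forall A, measurable A -> P (X @^-1` A) = nu A.
Variable g : Y -> R.
Hypothesis mg : measurable_fun setT g.

Let ge0_transfer (h : Y -> \bar R) : measurable_fun setT h -> (forall y, 0 <= h y)%E ->
  (\int[P]_w h (X w) = \int[nu]_y h y)%E.
Proof.
move=> mh h0; transitivity (\int[pushforward P X]_y h y)%E.
  by rewrite ge0_integral_pushforward.
pose mX_mixin := isMeasurableFun.Build _ _ _ _ _ mX.
pose X' : {mfun T >-> Y} := HB.pack X mX_mixin.
by apply: (@eq_measure_integral _ _ _ setT nu (pushforward P X')) => A mA _; exact: law.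
Qed.

Lemma transfer_rintegrable : rintegrable nu g <-> rintegrable P (g \o X).
Proof.
have mEg : measurable_fun setT (EFin \o g) by exact/measurable_EFinP.
have e : (\int[P]_w `|(EFin \o (g \o X)) w| = \int[nu]_y `|(EFin \o g) y|)%E.
  rewrite -ge0_transfer//; exact: measurableT_comp.
split=> /integrableP[_ fin]; apply/integrableP; split => //.
- by apply/measurable_EFinP; exact: measurableT_comp.
- by rewrite e.
- by rewrite -e.
Qed.

Lemma transfer_Rintegral : rintegrable nu g ->
  \int[P]_w g (X w) = \int[nu]_y g y.
Proof.
move=> ig; have iX := transfer_rintegrable.1 ig.
have mEg : measurable_fun setT (EFin \o g) by exact/measurable_EFinP.
congr fine; transitivity (\int[pushforward P X]_y (EFin \o g) y)%E.
  by rewrite integral_pushforward.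
pose mX_mixin := isMeasurableFun.Build _ _ _ _ _ mX.
pose X' : {mfun T >-> Y} := HB.pack X mX_mixin.
by apply: (@eq_measure_integral _ _ _ setT nu (pushforward P X')) => A mA _; exact: law.
Qed.

End LawTransfer.

Section CountableOpenCover.
Context {R : realType} {n : nat}.

(** Boxes with rational data: countably many, so that measurability of the
    coordinates of a random vector extends to preimages of open sets. *)
Definition box (q : {ffun 'I_n -> rat}) (k : nat) : set 'cV[R]_n :=
  [set x | forall i, `|x i 0 - ratr (q i)| < k.+1%:R^-1].

Lemma open_box_cover (U : set 'cV[R]_n) x : open U -> U x ->
  exists q k, box q k `<=` U /\ box q k x.
Proof.
move=> oU Ux; have := oU; rewrite openE => /(_ x Ux)/(@nbhs_ballP _ 'cV[R]_n x)[r /= r0 rU].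
pose k := Num.truncn (2 / r).
have kr : 2 * k.+1%:R^-1 < r.
  by rewrite ltr_pdivrMr ?ltr0n// mulrC -ltr_pdivrMr// truncnS_gt.
have k0 : 0 < k.+1%:R^-1 :> R by rewrite invr_gt0.
have /choice[q qx] : forall i, exists q : rat, `|x i 0 - ratr q| < k.+1%:R^-1.
  move=> i.
  have : x i 0 - k.+1%:R^-1 < x i 0 + k.+1%:R^-1 by rewrite ltrD2l gtrN.
  move=> /rat_in_itvoo[q]; rewrite in_itv/= => /andP[q1 q2]; exists q => //.
  by rewrite distrC ltr_distl q1 q2.
exists [ffun i => q i], k; split=> [y yq|i]; last by rewrite ffunE.
apply: rU; split=> // i j; rewrite (ord1 j) /ball/=.
have := qx i; have := yq i; rewrite ffunE.
move: (y i 0) (x i 0) (ratr (q i)) (k.+1%:R^-1) kr => Y X Q h kr.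
by rewrite !ltr_norml => /andP[? ?] /andP[? ?]; apply/andP; split; lra.
Qed.

End CountableOpenCover.

Section GaussianVector.
Context d (Omega : measurableType d) (R : realType) (P : probability Omega R).
Context (n : nat) (xi : Omega -> 'cV[R]_n) (D : R).
Implicit Types (f g : 'cV[R]_n -> R) (z : 'cV[R]_n) (i j : 'I_n).

Definition gaussian_vector := [/\ 0 < D,
  forall i, measurable_fun setT (fun w => xi w i 0) &
  forall B : 'I_n -> set R, (forall i, measurable (B i)) ->
    P [set w | forall i, B i (xi w i 0)] =
    (\prod_i normal_prob 0 (Num.sqrt D) (B i))%E].

Hypothesis gauss : gaussian_vector.

Let D_gt0 : 0 < D. Proof. by case: gauss. Qed.
Let s_gt0 : 0 < Num.sqrt D. Proof. by rewrite sqrtr_gt0. Qed.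
Let mxi i : measurable_fun setT (fun w => xi w i 0). Proof. by case: gauss. Qed.

Lemma measurable_preimage_open (U : set 'cV[R]_n) : open U -> measurable (xi @^-1` U).
Proof.
move=> oU.
have -> : xi @^-1` U = \bigcup_(k in setT)
    (if unpickle k is Some qm then
       if `[< box qm.1 qm.2 `<=` U >] then xi @^-1` (box qm.1 qm.2) else set0
     else set0).
  apply/seteqP; split => [w Uw|w [k _]].
    have [q [m [qmU qmw]]] := open_box_cover oU Uw.
    by exists (pickle (q, m)) => //; rewrite pickleK; case: asboolP.
  by case: (unpickle k) => // -[q m]; case: asboolP => // qmU /qmU.
apply: bigcupT_measurable => k; case: (unpickle k) => [[q m]|]; last exact: measurable0.
case: asboolP => _ /=; last exact: measurable0.
have -> : xi @^-1` box q m = \bigcap_(i in [set: 'I_n])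
    ((fun w => xi w i 0) @^-1` [set r : R | `|r - ratr (q i)| < m.+1%:R^-1]).
  by apply/seteqP; split => w h i; [move=> _|]; exact: h.
apply: fin_bigcap_measurable => // i _.
rewrite -[X in measurable X]setTI; apply: mxi => //.
have -> : [set r : R | `|r - ratr (q i)| < m.+1%:R^-1] = ball (ratr (q i) : R) m.+1%:R^-1.
  by apply/seteqP; split => r; rewrite /ball/= distrC.
exact: measurable_ball.
Qed.

Lemma measurable_continuous_comp f : continuous f ->
  measurable_fun setT (fun w => f (xi w)).
Proof.
move=> cf mT; apply: (measurability _ (RGenOInfty.measurableE R)) => //.
move=> /= _ [_ [a ->] <-]; rewrite setTI.
have := measurable_preimage_open (open_comp (fun x _ => cf x) (@open_gt R a)).
by congr measurable; apply/seteqP; split => w /=; rewrite in_itv/= andbT.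
Qed.

Lemma coordinate_law i A : measurable A ->
  P ((fun w => xi w i 0) @^-1` A) = normal_prob 0 (Num.sqrt D) A.
Proof.
move=> mA; case: gauss => _ _ law.
pose B j := if j == i then A else setT.
have -> : normal_prob 0 (Num.sqrt D) A =
    (\prod_j normal_prob 0 (Num.sqrt D) (B j))%E.
  rewrite (bigD1 i)//= big1 ?mule1 /B ?eqxx// => j ji.
  by rewrite (negbTE ji); exact: probability_setT.
rewrite -law => [|j]; last by rewrite /B; case: ifP.
rewrite /B; congr (P _); apply/seteqP; split => w h => [j|]; first by case: eqP => [->|].
by have := h i; rewrite eqxx.
Qed.

Lemma pair_law i j A B : i != j -> measurable A -> measurable B ->
  P ((fun w => (xi w i 0, xi w j 0)) @^-1` (A `*` B)) =
  (normal_prob 0 (Num.sqrt D) A * normal_prob 0 (Num.sqrt D) B)%E.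
Proof.
move=> ij mA mB; case: gauss => _ _ law.
have ji : (j == i) = false by rewrite eq_sym; exact/negbTE.
pose C k := if k == i then A else if k == j then B else setT.
have -> : (normal_prob 0 (Num.sqrt D) A * normal_prob 0 (Num.sqrt D) B =
    \prod_k normal_prob 0 (Num.sqrt D) (C k))%E.
  rewrite (bigD1 i)//= (bigD1 j)/= ?ji//.
  rewrite big1 ?mule1 /C ?ji ?eqxx// => k /andP[/negbTE -> /negbTE ->].
  exact: probability_setT.
rewrite -law => [|k]; last by rewrite /C; do 2 case: ifP => // _.
rewrite /C; congr (P _); apply/seteqP; split => w /=.
  by move=> [h1 h2] k; case: eqP => [->//|_]; case: eqP => [->|].
move=> h; split; first by have := h i; rewrite eqxx.
by have := h j; rewrite ji eqxx.
Qed.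

Lemma coordinate_power_rintegrable i k : (k <= 4)%N ->
  rintegrable P (fun w => xi w i 0 ^+ k).
Proof.
move=> k4; have mk : measurable_fun setT (fun x : R => x ^+ k) by exact: measurable_funX.
apply: (transfer_rintegrable (nu := normal_prob 0 (Num.sqrt D)) (mxi i) (coordinate_law i) mk).1.
exact: normal_moment_integrable.
Qed.

Lemma coordinate_power_mean i k : (k <= 4)%N ->
  \int[P]_w (xi w i 0 ^+ k) = normal_moment (Num.sqrt D) k.
Proof.
move=> k4; have mk : measurable_fun setT (fun x : R => x ^+ k) by exact: measurable_funX.
apply: (transfer_Rintegral (nu := normal_prob 0 (Num.sqrt D)) (mxi i) (coordinate_law i) mk).
exact: normal_moment_integrable.
Qed.

Lemma product_rintegrable i j : rintegrable P (fun w => xi w i 0 * xi w j 0).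
Proof.
have h := rintegrableD (coordinate_power_rintegrable i (isT : 2 <= 4)%N)
  (coordinate_power_rintegrable j (isT : 2 <= 4)%N).
apply: le_integrable h => //.
  by apply/measurable_EFinP; apply: measurable_funM; exact: mxi.
move=> w _ /=; rewrite lee_fin [leRHS]ger0_norm ?addr_ge0 ?sqr_ge0//.
move: (xi w i 0) (xi w j 0) => a b.
by rewrite ler_norml; apply/andP; split; nra.
Qed.

(** Off the diagonal the pair of coordinates has a product law, by uniqueness of
    product measures, and the mean factorises by Fubini's theorem. *)
Lemma product_mean i j : \int[P]_w (xi w i 0 * xi w j 0) = D *+ (i == j).
Proof.
have [<-|ij] := eqVneq i j.
  by rewrite mulr1n -[RHS](sqr_sqrtr (ltW D_gt0)) -(normal_moment2 s_gt0) -(coordinate_power_mean i).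
pose N : probability (measurableTypeR R) R := normal_prob 0 (Num.sqrt D).
pose X w : measurableTypeR R * measurableTypeR R := (xi w i 0, xi w j 0).
have mX : measurable_fun setT X.
  apply: (@measurable_fun_pair _ _ _ Omega (measurableTypeR R) (measurableTypeR R)); exact: mxi.
pose mX_mixin := isMeasurableFun.Build _ _ _ _ _ mX.
pose X' : {mfun Omega >-> (measurableTypeR R * measurableTypeR R)%type} := HB.pack X mX_mixin.
have lawX A : measurable A -> P (X @^-1` A) = (N \x N)%E A.
  move=> mA; apply/esym.
  have U := @product_measure_unique _ _ _ _ R N N (pushforward P X').
  apply: U => //.
  by move=> B C mB mC; exact: pair_law.
pose g (z : measurableTypeR R * measurableTypeR R) : R := z.1 * z.2.
have mg : measurable_fun setT g by exact: measurable_funM.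
have iX : rintegrable P (g \o X) := product_rintegrable i j.
have ig : rintegrable (N \x N)%E g by apply/(transfer_rintegrable mX lawX mg).
rewrite [LHS](transfer_Rintegral mX lawX mg ig) /Rintegral.
rewrite -(integral12_prod_meas1 ig)/=.
under eq_integral => x _.
  rewrite /fubini_F/=; under eq_integral do rewrite EFinM.
  rewrite integralZl//; last first.
    exact: (normal_moment_integrable s_gt0 (isT : 1 <= 4)%N).
  have -> : (\int[N]_y y%:E = (normal_moment (Num.sqrt D) 1)%:E)%E.
    rewrite /normal_moment /Rintegral fineK//.
    by apply: integrable_fin_num => //; exact: (normal_moment_integrable s_gt0 (isT : 1 <= 4)%N).
  rewrite normal_moment1// mule0.
  over.
by rewrite integral0.
Qed.

Definition average f : R := \int[P]_w f (xi w).

Definition bounded_cont f := continuous f /\ exists c, forall x, `|f x| <= c.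

Lemma average_rintegrable f : bounded_cont f -> rintegrable P (f \o xi).
Proof.
move=> [cf [c fc]]; apply: le_integrable (rintegrable_cst P c) => //.
  by apply/measurable_EFinP; exact: measurable_continuous_comp.
by move=> w _ /=; rewrite lee_fin (le_trans (fc _))// ler_norm.
Qed.

Lemma average_lin a b f g : bounded_cont f -> bounded_cont g ->
  average (fun x => a * f x + b * g x) = a * average f + b * average g.
Proof.
move=> /average_rintegrable hf /average_rintegrable hg; rewrite /average.
by rewrite RintegralD ?RintegralZl//; exact: rintegrableZ.
Qed.

(** Odd moments cancel and second moments are exact, which is the source of the
    second-order term of the equation; of fourth moments a bound is enough, as they
    only enter remainders. *)
Lemma average_le_quartic f a (b : 'I_n -> R) (c : 'I_n -> 'I_n -> R) e :
  bounded_cont f -> 0 <= e ->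
  (forall z, f z <= a + \sum_i b i * z i 0 +
    \sum_i \sum_j c i j * (z i 0 * z j 0) + e * \sum_i z i 0 ^+ 4) ->
  average f <= a + D * \sum_i c i i + e * (n%:R * (32 * D ^+ 2)).
Proof.
move=> hf e0 fle.
pose F1 w := \sum_i b i * xi w i 0.
pose F2 w := \sum_i \sum_j c i j * (xi w i 0 * xi w j 0).
pose F4 w := \sum_i xi w i 0 ^+ 4.
have i1 i : rintegrable P (fun w => b i * xi w i 0).
  exact: (rintegrableZ _ (coordinate_power_rintegrable i (isT : 1 <= 4)%N)).
have i2 i j : rintegrable P (fun w => c i j * (xi w i 0 * xi w j 0)).
  exact: (rintegrableZ _ (product_rintegrable i j)).
have i2' i : rintegrable P (fun w => \sum_j c i j * (xi w i 0 * xi w j 0)).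
  by apply: rintegrable_sum => j.
have i4 i : rintegrable P (fun w => xi w i 0 ^+ 4).
  exact: (coordinate_power_rintegrable i (isT : 4 <= 4)%N).
have iF1 : rintegrable P F1 by exact: rintegrable_sum.
have iF2 : rintegrable P F2 by exact: rintegrable_sum.
have iF4 : rintegrable P F4 by exact: rintegrable_sum.
have m1 : \int[P]_w F1 w = 0.
  rewrite rintegral_sum// big1// => i _.
  rewrite RintegralZl//; last exact: (coordinate_power_rintegrable i (isT : 1 <= 4)%N).
  have -> : \int[P]_w (xi w i 0) = 0.
    by rewrite -(normal_moment1 s_gt0) -(coordinate_power_mean i).
  by rewrite mulr0.
have m2 : \int[P]_w F2 w = D * \sum_i c i i.
  rewrite rintegral_sum// mulr_sumr; apply: eq_bigr => i _.
  rewrite rintegral_sum// (bigD1 i)//= big1 => [|j ji].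
    by rewrite addr0 RintegralZl ?product_mean ?eqxx ?mulr1n 1?mulrC//; exact: product_rintegrable.
  rewrite RintegralZl ?product_mean; last exact: product_rintegrable.
  - by rewrite eq_sym (negbTE ji) mulr0n mulr0.
  - by [].
have m4 : \int[P]_w F4 w <= n%:R * (32 * D ^+ 2).
  rewrite rintegral_sum// mulr_natl -[n in _ *+ n]card_ord -sumr_const.
  apply: ler_sum => i _; rewrite coordinate_power_mean//.
  apply: (le_trans (normal_moment4 s_gt0)).
  by rewrite -[4%N]/(2 * 2)%N exprM sqr_sqrtr// ltW.
have h : average f <= \int[P]_w (a + F1 w + F2 w + e * F4 w).
  apply: le_Rintegral => //; first exact: average_rintegrable.
  apply: rintegrableD (rintegrableD (rintegrableD _ iF1) iF2) (rintegrableZ e iF4).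
  exact: rintegrable_cst.
apply: (le_trans h).
rewrite RintegralD//; [|by apply: rintegrableD (rintegrableD _ iF1) iF2; exact: rintegrable_cst
  |exact: rintegrableZ].
rewrite RintegralD//; last by apply: rintegrableD _ iF1; exact: rintegrable_cst.
rewrite RintegralD//; last exact: rintegrable_cst.
rewrite RintegralZl// Rintegral_cst// m1 m2 addr0.
rewrite [X in a * fine X](_ : _ = 1%E) ?mulr1; last exact: probability_setT.
by rewrite lerD2l ler_wpM2l.
Qed.

End GaussianVector.

(** * One-step estimates *)

Section GaussianMean.
Context {R : realType} {n : nat}.
Implicit Types (f g : 'cV[R]_n -> R) (x y z : 'cV[R]_n) (S : 'M[R]_n) (i j k l : 'I_n).

Lemma enorm_mulmx S z : enorm (S *m z) <= enorm S * enorm z.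
Proof.
rewrite le_enorm ?mulr_ge0 ?enorm_ge0// exprMn enorm_sqr_cV enorm_sqr mulr_suml.
apply: ler_sum => i _; pose r : 'cV[R]_n := \col_j S i j.
have -> : (S *m z) i 0 = dot r z.
  by rewrite mxE; apply: eq_bigr => j _; rewrite mxE.
have -> : \sum_j S i j ^+ 2 = enorm r ^+ 2.
  by rewrite enorm_sqr_cV; apply: eq_bigr => j _; rewrite mxE.
rewrite -exprMn -[leLHS]real_normK ?num_real// ler_sqr ?nnegrE ?mulr_ge0 ?enorm_ge0//.
exact: normr_dot_le.
Qed.

Lemma affine_continuous y S : continuous (fun z : 'cV[R]_n => y + S *m z).
Proof.
move=> z; apply/(@cvgrPdist_lt _ _ _ _ (nbhs_filter z)) => r r0.
pose c := enorm S * n%:R + 1.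
have c0 : 0 < c by rewrite ltr_wpDl ?mulr_ge0 ?enorm_ge0.
apply/(@nbhs_normP _ 'cV[R]_n z); exists (r / c); first exact: divr_gt0.
move=> z'; rewrite /= ltr_pdivlMr// => zz'.
rewrite opprD addrACA subrr add0r -mulmxBr.
apply: le_lt_trans zz'; apply: (le_trans (mx_norm_le_enorm _)).
apply: (le_trans (enorm_mulmx _ _)).
apply: (@le_trans _ _ (enorm S * (n%:R * `|z - z'|))).
  by rewrite ler_wpM2l ?enorm_ge0// enorm_le_mx_norm.
by rewrite /c mulrDr mulr1 mulrA [leRHS]addrC mulrC lerDr.
Qed.

Lemma bounded_cont_affine f y S :
  bounded_cont f -> bounded_cont (fun z => f (y + S *m z)).
Proof.
move=> [cf [c fc]]; split; last by exists c.
move=> z; apply: (@continuous_comp _ _ _ (fun z => y + S *m z) f).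
  exact: affine_continuous.
exact: cf.
Qed.

Lemma bounded_cont_lin a b f g : bounded_cont f -> bounded_cont g ->
  bounded_cont (fun z => a * f z + b * g z).
Proof.
move=> [cf [c fc]] [cg [d gd]]; split.
  move=> z; have Fz := nbhs_filter z.
  by apply: (@cvgD R R^o _ (nbhs z) Fz (fun z => a * f z) (fun z => b * g z));
    [apply: (@cvgM R _ (nbhs z) Fz (cst a) f)|apply: (@cvgM R _ (nbhs z) Fz (cst b) g)];
    rewrite ?[_ @ _]/(nbhs z) //; try exact: cst_continuous; [exact: cf|exact: cg].
exists (`|a| * c + `|b| * d) => z; rewrite (le_trans (ler_normD _ _))// !normrM.
by apply: lerD; rewrite ler_wpM2l.
Qed.

Lemma bounded_cont_cst c : bounded_cont (fun _ : 'cV[R]_n => c).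
Proof. by split; [move=> z; exact: cst_continuous|exists `|c|]. Qed.

Lemma lip_bounded_cont K c f : lip K f -> (forall x, `|f x| <= c) -> bounded_cont f.
Proof. by move=> hf fc; split; [exact: lip_continuous hf|exists c]. Qed.

Lemma bounded_cont_sum m (F : 'I_m -> 'cV[R]_n -> R) :
  (forall k : 'I_m, bounded_cont (F k)) -> bounded_cont (fun z => \sum_k F k z).
Proof.
elim: m F => [|m IH] F hF.
  have -> : (fun z => \sum_k F k z) = fun=> 0 by apply/funext => z; rewrite big_ord0.
  exact: bounded_cont_cst.
have -> : (fun z => \sum_k F k z) =
    (fun z => 1 * F ord0 z + 1 * \sum_k F (lift ord0 k) z).
  by apply/funext => z; rewrite big_ord_recl !mul1r.
by apply: bounded_cont_lin => //; exact: IH.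
Qed.

(** The law of a Brownian increment over a time step [D] acts as a linear mean that
    respects quartic majorants; constants, order and moments are special cases. *)
Record gaussian_mean (D : R) (E : ('cV[R]_n -> R) -> R) : Prop := {
  gm_time : 0 < D;
  gm_lin : forall a b f g, bounded_cont f -> bounded_cont g ->
    E (fun z => a * f z + b * g z) = a * E f + b * E g;
  gm_quartic : forall f a (b : 'I_n -> R) (c : 'I_n -> 'I_n -> R) d,
    bounded_cont f -> 0 <= d ->
    (forall z, f z <= a + \sum_i b i * z i 0 +
      \sum_i \sum_j c i j * (z i 0 * z j 0) + d * \sum_i z i 0 ^+ 4) ->
    E f <= a + D * \sum_i c i i + d * (n%:R * (32 * D ^+ 2)) }.

Lemma gaussian_vector_mean d (Omega : measurableType d) (P : probability Omega R)
  (xi : Omega -> 'cV[R]_n) D :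
  gaussian_vector P xi D -> gaussian_mean D (average P xi).
Proof.
move=> gauss; split.
- by case: gauss.
- by move=> a b f g; exact: (average_lin gauss).
- by move=> f a b c e; exact: (average_le_quartic gauss).
Qed.

Variables (D : R) (E : ('cV[R]_n -> R) -> R).
Hypothesis gm : gaussian_mean D E.

Let D_gt0 : 0 < D := gm_time gm.

Lemma gm_le_cst f c : bounded_cont f -> (forall z, f z <= c) -> E f <= c.
Proof.
move=> hf fc.
have := gm_quartic gm (a := c) (b := fun=> 0) (c := fun _ _ => 0) hf (lexx 0).
rewrite big1// mulr0 mul0r !addr0; apply=> z.
rewrite mul0r addr0 big1 => [|i _]; last by rewrite mul0r.
rewrite big1 ?addr0// => i _; by rewrite big1// => j _; rewrite mul0r.
Qed.

Lemma gm_scale a f : bounded_cont f -> E (fun z => a * f z) = a * E f.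
Proof.
move=> hf; have := gm_lin gm a 0 hf hf; rewrite mul0r addr0 => <-.
by congr E; apply/funext => z; rewrite mul0r addr0.
Qed.

Lemma gm_add f g : bounded_cont f -> bounded_cont g ->
  E (fun z => f z + g z) = E f + E g.
Proof.
move=> hf hg; have := gm_lin gm 1 1 hf hg; rewrite !mul1r => <-.
by congr E; apply/funext => z; rewrite !mul1r.
Qed.

Lemma gm_ge_cst f c : bounded_cont f -> (forall z, c <= f z) -> c <= E f.
Proof.
move=> hf fc; rewrite -lerN2 -mulN1r -(gm_scale (-1) hf).
apply: gm_le_cst => [|z]; last by rewrite mulN1r lerN2.
have := bounded_cont_lin (-1) 0 hf hf.
by congr bounded_cont; apply/funext => z; rewrite mul0r addr0.
Qed.

Lemma gm_le f g c : bounded_cont f -> bounded_cont g ->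
  (forall z, f z <= g z + c) -> E f <= E g + c.
Proof.
move=> hf hg fg; have := gm_lin gm 1 (-1) hf hg; rewrite mul1r mulN1r => e.
rewrite -lerBlDl -e; apply: gm_le_cst => [|z]; first exact: bounded_cont_lin.
by rewrite mul1r mulN1r lerBlDl.
Qed.

Lemma gm_sum m (F : 'I_m -> 'cV[R]_n -> R) : (forall k : 'I_m, bounded_cont (F k)) ->
  E (fun z => \sum_k F k z) = \sum_k E (F k).
Proof.
elim: m F => [|m IH] F hF.
  rewrite big_ord0; have -> : (fun z => \sum_k F k z) = fun=> 0.
    by apply/funext => z; rewrite big_ord0.
  apply/eqP; rewrite eq_le gm_le_cst ?gm_ge_cst//; exact: bounded_cont_cst.
rewrite big_ord_recl -IH// -gm_add//; last exact: bounded_cont_sum.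
by congr E; apply/funext => z; rewrite big_ord_recl.
Qed.

Lemma affine_norm_quadratic (c z : 'cV[R]_n) S :
  enorm (c + S *m z) ^+ 2 = enorm c ^+ 2 +
    \sum_i (2 * \sum_k c k 0 * S k i) * z i 0 +
    \sum_i \sum_j (\sum_k S k i * S k j) * (z i 0 * z j 0).
Proof.
rewrite enorm_sqrD enorm_sqr_cV; congr (_ + _ + _).
  rewrite /dot mulr_sumr; under eq_bigr => k _ do rewrite mxE mulr_sumr mulr_sumr.
  rewrite exchange_big/=; apply: eq_bigr => i _; rewrite mulr_sumr mulr_suml.
  by apply: eq_bigr => k _; ring.
rewrite enorm_sqr_cV.
under eq_bigr => k _ do rewrite mxE expr2 mulr_suml.
rewrite exchange_big/=; apply: eq_bigr => i _.
under eq_bigr => k _ do rewrite mulr_sumr.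
rewrite exchange_big/=; apply: eq_bigr => j _; rewrite mulr_suml.
by apply: eq_bigr => k _; ring.
Qed.

(** Driving two controlled points by the same increment. The square root of the
    mean square is reached without Jensen's inequality: [sqrt q <= (q / s + s) / 2]
    bounds the integrand by a quadratic polynomial. *)
Lemma gm_coupling f g (a K r s : R) c c' S S' : bounded_cont f -> bounded_cont g ->
  0 <= K -> 0 < s ->
  (forall x y, f x - g y <= a + K * Num.sqrt (enorm (x - y) ^+ 2 + r ^+ 2)) ->
  enorm (c - c') ^+ 2 + D * enorm (S - S') ^+ 2 + r ^+ 2 <= s ^+ 2 ->
  E (fun z => f (c + S *m z)) - E (fun z => g (c' + S' *m z)) <= a + K * s.
Proof.
move=> hf hg K0 s0 fg cs.
have hf' := bounded_cont_affine c S hf; have hg' := bounded_cont_affine c' S' hg.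
have := gm_lin gm 1 (-1) hf' hg'; rewrite mul1r mulN1r => <-.
set B := S - S' in cs; set e := c - c' in cs.
have k0 : 0 <= K / (2 * s) by rewrite divr_ge0// mulr_ge0// ltW.
have := gm_quartic gm (a := a + K / (2 * s) * (enorm e ^+ 2 + r ^+ 2 + s ^+ 2))
  (b := fun i => K / (2 * s) * (2 * \sum_k e k 0 * B k i))
  (c := fun i j => K / (2 * s) * (\sum_k B k i * B k j))
  (bounded_cont_lin 1 (-1) hf' hg') (lexx 0).
rewrite mul0r addr0 => h; apply: (le_trans (h _)) => [z|].
  rewrite mul1r mulN1r mul0r addr0; apply: (le_trans (fg _ _)).
  have -> : c + S *m z - (c' + S' *m z) = e + B *m z.
    by rewrite opprD addrACA -mulmxBl.
  have -> : \sum_i K / (2 * s) * (2 * \sum_k e k 0 * B k i) * z i 0 =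
      K / (2 * s) * \sum_i (2 * \sum_k e k 0 * B k i) * z i 0.
    by rewrite mulr_sumr; apply: eq_bigr => i _; rewrite -[LHS]mulrA.
  have -> : \sum_i \sum_j K / (2 * s) * (\sum_k B k i * B k j) * (z i 0 * z j 0) =
      K / (2 * s) * \sum_i \sum_j (\sum_k B k i * B k j) * (z i 0 * z j 0).
    rewrite mulr_sumr; apply: eq_bigr => i _; rewrite mulr_sumr.
    by apply: eq_bigr => j _; rewrite -[LHS]mulrA.
  rewrite -[leRHS]addrA -[leRHS]addrA lerD2l.
  set q := enorm (e + B *m z) ^+ 2 + r ^+ 2; have q0 : 0 <= q by rewrite addr_ge0 ?sqr_ge0.
  apply: (@le_trans _ _ (K / (2 * s) * (q + s ^+ 2))).
    have := sqr_ge0 (Num.sqrt q - s); rewrite sqrrB sqr_sqrtr// => h1.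
    have -> : K * Num.sqrt q = K / (2 * s) * (2 * s * Num.sqrt q).
      by field; rewrite gt_eqF.
    by rewrite ler_wpM2l//; lra.
  rewrite /q affine_norm_quadratic le_eqVlt; apply/orP; left; apply/eqP; ring.
rewrite -mulr_sumr.
have -> : \sum_i \sum_k B k i * B k i = enorm B ^+ 2.
  rewrite enorm_sqr exchange_big/=; apply: eq_bigr => i _; apply: eq_bigr => j _.
  by rewrite expr2.
rewrite -addrA lerD2l mulrCA -mulrDr.
apply: (@le_trans _ _ (K / (2 * s) * (2 * s ^+ 2))).
  by rewrite ler_wpM2l//; lra.
by rewrite le_eqVlt; apply/orP; left; apply/eqP; field; rewrite gt_eqF.
Qed.

(** Inequalities between a function and the mean of another one survive
    averaging over translations. *)
Lemma gm_steklovs (e K K' b c r : R) (s : seq 'I_n) f g x y S : 0 < e -> lip K f -> lip K' g ->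
  (forall z, `|g z| <= b) -> (size s)%:R * e <= r ->
  (forall v, enorm v <= r ->
    f (x + v) <= c + E (fun z => g (y + v + S *m z))) ->
  steklovs e s f x <= c + E (fun z => steklovs e s g (y + S *m z)).
Proof.
move=> e0 hf hg gb sr fg.
have main : forall v, enorm v + (size s)%:R * e <= r ->
    steklovs e s f (x + v) <= c + E (fun z => steklovs e s g (y + v + S *m z)).
  elim: s {sr} => [|i s IH] v vr /=.
    by apply: fg; apply: le_trans vr; rewrite mul0r addr0.
  have hfs := steklovs_lip e0 s hf; have hgs := steklovs_lip e0 s hg.
  have bc h z : lip K' h -> (forall z, `|h z| <= b) ->
      bounded_cont (fun w => h (z + S *m w)).
    by move=> hh hb; apply: bounded_cont_affine; exact: lip_bounded_cont hh hb.
  have gsb z : `|steklovs e s g z| <= b by exact: (steklovs_bound e0 s z hg gb).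
  have gib z : `|steklov e i (steklovs e s g) z| <= b.
    exact: (steklovs_bound e0 (i :: s) z hg gb).
  have K0 := lip_ge0 i hf; have K0' := lip_ge0 i hg.
  rewrite -subr_le0; apply: (@le_of_inv_succ _ _ ((K + K') * e)).
    by rewrite mulr_ge0 ?addr_ge0// ltW.
  move=> m; pose d (k : nat) := (k%:R * (e / m.+1%:R)) *: (delta_mx i 0 : 'cV[R]_n).
  have dle (k : 'I_m.+1) : enorm (d k) <= e.
    rewrite enormZ enorm_delta mulr1 ger0_norm ?mulr_ge0 ?divr_ge0 ?(ltW e0)//.
    by rewrite mulrCA ler_piMr ?(ltW e0)// ler_pdivrMr// mul1r ler_nat ltnW.
  have h1 := steklov_mean e0 m i (x + v) hfs.
  have h2 : mean e m i (steklovs e s f) (x + v) <=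
      c + E (fun z => mean e m i (steklovs e s g) (y + v + S *m z)).
    have bck (k : 'I_m.+1) :
        bounded_cont (fun z => steklovs e s g (y + v + S *m z + d k)).
      have := bc _ (y + v + d k) hgs gsb.
      by congr bounded_cont; apply/funext => z; rewrite addrAC.
    rewrite /mean gm_scale; last exact: bounded_cont_sum.
    rewrite gm_sum// -[c in leRHS](mulKf (_ : m.+1%:R != 0)) ?pnatr_eq0//.
    rewrite -mulrDr ler_wpM2l ?invr_ge0//.
    rewrite mulr_natl -[m.+1 in X in _ <= X + _]card_ord -sumr_const -big_split/=.
    apply: ler_sum => k _; rewrite -addrA.
    apply: (le_trans (IH (v + d k) _)).
      apply: (le_trans _ vr); rewrite /= -natr1 mulrDl mul1r addrA [leRHS]addrAC lerD2r.
      by rewrite (le_trans (ler_enormD _ _))// lerD2l.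
    rewrite lerD2l le_eqVlt; apply/orP; left; apply/eqP; congr E.
    apply/funext => z; congr (steklovs _ _ _ _).
    by rewrite addrA [LHS]addrAC.
  have h3 : E (fun z => mean e m i (steklovs e s g) (y + v + S *m z)) <=
      E (fun z => steklov e i (steklovs e s g) (y + v + S *m z)) + K' * e / m.+1%:R.
    apply: gm_le => [||z].
    - have : bounded_cont (fun z => m.+1%:R^-1 * (\sum_(k < m.+1) steklovs e s g (y + v + S *m z + d k)) + 0 * 0).
        apply: bounded_cont_lin; last exact: bounded_cont_cst.
        apply: bounded_cont_sum => k; have := bc _ (y + v + d k) hgs gsb.
        by congr bounded_cont; apply/funext => z; rewrite addrAC.
      by congr bounded_cont; apply/funext => z; rewrite mul0r addr0.
    - by apply: bc => //; exact: steklov_lip.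
    - have := steklov_mean e0 m i (y + v + S *m z) hgs.
      by rewrite ler_norml lerBrDr [X in X <= _]addrC lerBlDr => /andP[].
  have -> : (K + K') * e / m.+1%:R = K * e / m.+1%:R + K' * e / m.+1%:R by ring.
  move: h1; rewrite ler_norml => /andP[_].
  move: h2 h3; move: (K * e / _) (K' * e / _) (E _) (E _) (mean _ _ _ _ _) (steklov _ _ _ _).
  move=> {}k {}l A B C G; lra.
have := main 0; rewrite !addr0 enorm0 add0r; exact.
Qed.

End GaussianMean.

Section OneStep.
Context {R : realType} {n : nat}.
Implicit Types (f g : 'cV[R]_n -> R) (x y z : 'cV[R]_n) (S : 'M[R]_n).
Variables (D : R) (E : ('cV[R]_n -> R) -> R).
Hypothesis gm : gaussian_mean D E.

Let D_gt0 : 0 < D := gm_time gm.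

Lemma gm_cst c : E (fun=> c) = c.
Proof.
have h := @bounded_cont_cst R n c.
by apply/eqP; rewrite eq_le (gm_le_cst gm h)// (gm_ge_cst gm h).
Qed.

(** Coupling the motion with the motionless state. *)
Lemma gm_displacement (K bf a Tm M : R) f x c S : 0 <= K -> lip K f ->
  (forall z, `|f z| <= bf) -> 0 <= a -> 0 < M -> D <= Tm ->
  enorm c <= a + D * M -> enorm S <= M ->
  `|E (fun z => f (x + c + S *m z)) - f x| <=
    K * (a + Num.sqrt D * (M * (Num.sqrt Tm + 1))).
Proof.
move=> K0 hf fb a0 M0 DT cle Sle.
have bf' := lip_bounded_cont hf fb.
have Tm0 : 0 < Tm by exact: lt_le_trans DT.
pose t := Num.sqrt D; have t0 : 0 < t by rewrite sqrtr_gt0.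
have tD : t ^+ 2 = D by rewrite sqr_sqrtr// ltW.
pose v := Num.sqrt Tm; have v0 : 0 < v by rewrite sqrtr_gt0.
have tv : t <= v by rewrite ler_wsqrtr.
rewrite -/t -/v; set s := a + t * (M * (v + 1)).
have s0 : 0 < s by rewrite ltr_wpDl// mulr_gt0// mulr_gt0// addr_gt0.
have fE : E (fun z => f (x + (0 : 'M[R]_n) *m z)) = f x.
  rewrite -[RHS]gm_cst; congr E; apply/funext => z; by rewrite mul0mx addr0.
have fg y y' : f y - f y' <= 0 + K * Num.sqrt (enorm (y - y') ^+ 2 + 0 ^+ 2).
  rewrite add0r expr0n addr0 sqrtr_sqr ger0_norm ?enorm_ge0//.
  exact: le_trans (ler_norm _) (hf _ _).
have q : enorm c ^+ 2 + D * enorm S ^+ 2 + 0 ^+ 2 <= s ^+ 2.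
  rewrite expr0n addr0; apply: (@le_trans _ _ ((a + D * M) ^+ 2 + D * M ^+ 2)).
    apply: lerD; first by rewrite ler_sqr ?nnegrE ?enorm_ge0// addr_ge0// mulr_ge0// ltW.
    rewrite ler_wpM2l ?(ltW D_gt0)// ler_sqr ?nnegrE ?enorm_ge0//; exact: ltW.
  have h1 : a + D * M <= a + t * v * M.
    by rewrite lerD2l ler_wpM2r ?(ltW M0)// -tD expr2 ler_wpM2l// ltW.
  apply: (@le_trans _ _ ((a + t * v * M) ^+ 2 + D * M ^+ 2)).
    rewrite lerD2r ler_sqr// ?nnegrE; first by rewrite addr_ge0// mulr_ge0// ltW.
    by rewrite addr_ge0// !mulr_ge0// ltW.
  rewrite -tD -exprMn; have -> : s = (a + t * v * M) + t * M by rewrite /s; ring.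
  rewrite [leRHS]sqrrD lerD2r lerDl mulrn_wge0//.
  have p0 : 0 <= t * M by rewrite mulr_ge0// ltW.
  apply: mulr_ge0 => //; apply: addr_ge0 => //.
  by apply: mulr_ge0; [apply: mulr_ge0|]; exact: ltW.
rewrite ler_norml; apply/andP; split.
  rewrite lerNl opprB -fE.
  have := gm_coupling gm bf' bf' K0 s0 fg (c := x) (c' := x + c) (S := 0) (S' := S).
  rewrite [0 + K * s]add0r; apply.
  by rewrite opprD addrA subrr !sub0r !enormN.
rewrite -fE; have := gm_coupling gm bf' bf' K0 s0 fg (c := x + c) (c' := x) (S := S) (S' := 0).
rewrite [0 + K * s]add0r; apply.
by rewrite (addrAC x) subrr (add0r c) subr0.
Qed.

End OneStep.

Section ExpectedTaylor.
Context {R : realType} {n : nat}.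
Implicit Types (f g : 'cV[R]_n -> R) (x y z c : 'cV[R]_n) (S : 'M[R]_n) (i j k l : 'I_n).

Local Notation N := (n%:R : R).

Lemma linear_affine (m : 'I_n -> R) c S z :
  \sum_i (c + S *m z) i 0 * m i =
  \sum_i c i 0 * m i + \sum_k (\sum_i S i k * m i) * z k 0.
Proof.
under [X in _ = _ + X]eq_bigr do rewrite mulr_suml.
rewrite exchange_big -big_split/=; apply: eq_bigr => i _.
rewrite !mxE mulrDl mulr_suml; congr (_ + _); apply: eq_bigr => k _; ring.
Qed.

Lemma bilinear_affine (m : 'I_n -> 'I_n -> R) c S z :
  \sum_i \sum_j (c + S *m z) i 0 * (c + S *m z) j 0 * m i j =
  \sum_i \sum_j c i 0 * c j 0 * m i j +
  \sum_k (\sum_i \sum_j (c i 0 * S j k + S i k * c j 0) * m i j) * z k 0 +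
  \sum_k \sum_l (\sum_i \sum_j S i k * S j l * m i j) * (z k 0 * z l 0).
Proof.
have -> : \sum_k (\sum_i \sum_j (c i 0 * S j k + S i k * c j 0) * m i j) * z k 0 =
    \sum_i \sum_j \sum_k (c i 0 * S j k + S i k * c j 0) * m i j * z k 0.
  under eq_bigr do rewrite mulr_suml.
  rewrite exchange_big/=; apply: eq_bigr => i _.
  under eq_bigr do rewrite mulr_suml.
  by rewrite exchange_big.
have -> : \sum_k \sum_l (\sum_i \sum_j S i k * S j l * m i j) * (z k 0 * z l 0) =
    \sum_i \sum_j \sum_k \sum_l S i k * S j l * m i j * (z k 0 * z l 0).
  under eq_bigr => k _.
    under eq_bigr do rewrite mulr_suml.
    rewrite exchange_big/=.
    under eq_bigr => i _.
      under eq_bigr do rewrite mulr_suml.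
      rewrite exchange_big/=.
      over.
    over.
  rewrite exchange_big/=; apply: eq_bigr => i _.
  by rewrite exchange_big.
rewrite -!big_split/=; apply: eq_bigr => i _.
rewrite -!big_split/=; apply: eq_bigr => j _.
rewrite !mxE.
have e1 : \sum_k (c i 0 * S j k + S i k * c j 0) * m i j * z k 0 =
    c i 0 * (\sum_k S j k * z k 0) * m i j + (\sum_k S i k * z k 0) * c j 0 * m i j.
  rewrite mulr_sumr !mulr_suml -big_split/=.
  by apply: eq_bigr => k _; ring.
have e2 : \sum_k \sum_l S i k * S j l * m i j * (z k 0 * z l 0) =
    (\sum_k S i k * z k 0) * (\sum_k S j k * z k 0) * m i j.
  rewrite !mulr_suml; apply: eq_bigr => k _; rewrite mulr_sumr mulr_suml.
  by apply: eq_bigr => l _; ring.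
rewrite e1 e2; ring.
Qed.

Lemma sqr_sum_norm_le z : (\sum_i `|z i 0|) ^+ 2 <= N ^+ 2 * \sum_i z i 0 ^+ 2.
Proof.
rewrite -enorm_sqr_cV -exprMn ler_sqr ?nnegrE ?sumr_ge0 ?mulr_ge0 ?enorm_ge0//.
exact: sum_le_enorm.
Qed.

Lemma quartic_sum_norm_le z : (\sum_i `|z i 0|) ^+ 4 <= N ^+ 6 * \sum_i z i 0 ^+ 4.
Proof.
pose w : 'cV[R]_n := \col_i z i 0 ^+ 2.
have h := sqr_sum_norm_le w.
have -> : \sum_i z i 0 ^+ 4 = \sum_i w i 0 ^+ 2.
  by apply: eq_bigr => i _; rewrite mxE -exprM.
have e : \sum_i `|w i 0| = \sum_i z i 0 ^+ 2.
  by apply: eq_bigr => i _; rewrite mxE ger0_norm ?sqr_ge0.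
rewrite e in h.
have -> : N ^+ 6 = N ^+ 4 * N ^+ 2 by rewrite -exprD.
rewrite -mulrA; apply: (@le_trans _ _ (N ^+ 4 * (\sum_i z i 0 ^+ 2) ^+ 2)).
  rewrite -[4%N]/(2 * 2)%N !exprM -exprMn ler_sqr ?nnegrE ?sqr_ge0//.
    exact: sqr_sum_norm_le.
  by rewrite mulr_ge0 ?sqr_ge0 ?sumr_ge0// => i _; exact: sqr_ge0.
by rewrite ler_wpM2l ?exprn_ge0.
Qed.

(** Only even moments are available, and this trades the cubic Taylor remainder
    for a quadratic and a quartic one, balanced by [t = sqrt D]. *)
Lemma cube_le (H A B Z t : R) : 0 < t -> 0 <= H -> H <= A + B * Z ->
  2 * H ^+ 3 <= t * (2 * A ^+ 2 + 2 * B ^+ 2 * Z ^+ 2) +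
    (8 * A ^+ 4 + 8 * B ^+ 4 * Z ^+ 4) / t.
Proof.
move=> t0 H0 HAB; set Y := B * Z in HAB.
have -> : 2 * B ^+ 2 * Z ^+ 2 = 2 * Y ^+ 2 by rewrite /Y; ring.
have -> : 8 * B ^+ 4 * Z ^+ 4 = 8 * Y ^+ 4 by rewrite /Y; ring.
have h2 : H ^+ 2 <= 2 * A ^+ 2 + 2 * Y ^+ 2.
  have : H ^+ 2 <= (A + Y) ^+ 2 by rewrite ler_sqr ?nnegrE// (le_trans H0).
  have := sqr_ge0 (A - Y); nra.
have h4 : H ^+ 4 <= 8 * A ^+ 4 + 8 * Y ^+ 4.
  have : H ^+ 4 <= (2 * A ^+ 2 + 2 * Y ^+ 2) ^+ 2.
    rewrite -[4%N]/(2 * 2)%N exprM ler_sqr ?nnegrE ?sqr_ge0//.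
    by rewrite addr_ge0// mulr_ge0// sqr_ge0.
  have -> : 8 * A ^+ 4 + 8 * Y ^+ 4 = (2 * A ^+ 2 + 2 * Y ^+ 2) ^+ 2 + (2 * A ^+ 2 - 2 * Y ^+ 2) ^+ 2 by ring.
  by move=> h; rewrite (le_trans h)// lerDl sqr_ge0.
apply: (@le_trans _ _ (t * H ^+ 2 + H ^+ 4 / t)).
  rewrite -subr_ge0.
  have -> : t * H ^+ 2 + H ^+ 4 / t - 2 * H ^+ 3 = t^-1 * (H * (t - H)) ^+ 2.
    by field; rewrite gt_eqF.
  by rewrite mulr_ge0 ?sqr_ge0// invr_ge0 ltW.
by apply: lerD; rewrite ?ler_wpM2l ?ler_wpM2r ?invr_ge0// ltW.
Qed.

Definition taylor_const (K beta M Tm em : R) : R :=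
  K * (N ^+ 2 * beta ^+ 2 * (Tm + em ^+ 2) / 2 + 2 * N ^+ 2 * beta ^+ 2 * Tm +
    2 * N ^+ 5 * M ^+ 2 + 8 * N ^+ 4 * beta ^+ 4 * Tm ^+ 2 + 256 * N ^+ 11 * M ^+ 4).

Variables (D : R) (E : ('cV[R]_n -> R) -> R).
Hypothesis gm : gaussian_mean D E.

Let D_gt0 : 0 < D := gm_time gm.

(** The third derivatives of the smoothed function are [O(1 / e ^ 2)] and the third
    absolute moment of the displacement is [O(D ^ (3/2))]. *)
Lemma gm_taylor (e K beta M Tm em b : R) f x c S : 0 < e -> e <= em -> D <= Tm ->
  0 <= K -> 0 <= beta -> 0 <= M ->
  lip K f -> (forall z, `|f z| <= b) ->
  (forall i, `|c i 0| <= D * beta) -> (forall i j, `|S i j| <= M) ->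
  E (fun z => moll e f (x + c + S *m z)) <=
  moll e f x + \sum_i c i 0 * moll1 e i f x +
  D / 2 * (\sum_i \sum_j (\sum_k S i k * S j k) * moll2 e i j f x) +
  taylor_const K beta M Tm em * (D * Num.sqrt D / e ^+ 2).
Proof.
move=> e0 eem DT K0 be0 M0 hf fb cb SM.
pose t := Num.sqrt D; have t0 : 0 < t by rewrite sqrtr_gt0.
have tD : t ^+ 2 = D by rewrite sqr_sqrtr// ltW.
pose A := N * (D * beta); pose B := N * M; pose kap := K / e ^+ 2.
have kap0 : 0 <= kap by rewrite divr_ge0// exprn_ge0// ltW.
pose m1 i := moll1 e i f x; pose m2 i j := moll2 e i j f x.
have bc : bounded_cont (fun z => moll e f (x + c + S *m z)).
  apply/bounded_cont_affine/(lip_bounded_cont (moll_lip e0 hf)) => y.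
  exact: (steklovs_bound e0 _ y hf fb).
pose a0 := moll e f x + \sum_i c i 0 * m1 i +
  (\sum_i \sum_j c i 0 * c j 0 * m2 i j) / 2 + kap * (t * (2 * A ^+ 2) + 8 * A ^+ 4 / t).
pose b0 k := \sum_i S i k * m1 i +
  (\sum_i \sum_j (c i 0 * S j k + S i k * c j 0) * m2 i j) / 2.
pose c0 k l := (\sum_i \sum_j S i k * S j l * m2 i j) / 2 +
  (kap * t * (2 * B ^+ 2 * N ^+ 2)) *+ (k == l).
pose d0 := kap * (8 * B ^+ 4 * N ^+ 6) / t.
have d00 : 0 <= d0.
  by rewrite /d0 !mulr_ge0 ?invr_ge0 ?exprn_ge0 ?mulr_ge0// ltW.
have := gm_quartic gm (a := a0) (b := b0) (c := c0) bc d00.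
move=> h; apply: (le_trans (h _)) => [z|].
- rewrite -addrA; apply: (le_trans (moll_taylor e0 x (c + S *m z) hf)).
  set H := \sum_i `|_|; pose Z := \sum_i `|z i 0|.
  have Z0 : 0 <= Z by exact: sumr_ge0.
  have H0 : 0 <= H by exact: sumr_ge0.
  have HAB : H <= A + B * Z.
    have -> : A + B * Z = \sum_(i < n) (D * beta + M * Z).
      by rewrite sumr_const card_ord -mulr_natl /A /B; ring.
    apply: ler_sum => i _; rewrite !mxE (le_trans (ler_normD _ _))// lerD//.
    apply: (le_trans (ler_norm_sum _ _ _)); rewrite mulr_sumr; apply: ler_sum => k _.
    by rewrite normrM ler_wpM2r.
  have h3 := cube_le t0 H0 HAB.
  have Z2 := sqr_sum_norm_le z; have Z4 := quartic_sum_norm_le z.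
  rewrite -/Z in Z2 Z4.
  have -> : 2 * (2 * K / e) / e * H ^+ 3 = 2 * (kap * (2 * H ^+ 3)) * 2^-1 * 2.
    rewrite /kap; field; by rewrite gt_eqF.
  rewrite (linear_affine m1) (bilinear_affine m2).
  rewrite -[X in _ <= X]addrA.
  have -> : \sum_k b0 k * z k 0 = \sum_k (\sum_i S i k * m1 i) * z k 0 +
      (\sum_k (\sum_i \sum_j (c i 0 * S j k + S i k * c j 0) * m2 i j) * z k 0) / 2.
    rewrite mulr_suml -big_split/=; apply: eq_bigr => k _; rewrite /b0; ring.
  have -> : \sum_k \sum_l c0 k l * (z k 0 * z l 0) =
      (\sum_k \sum_l (\sum_i \sum_j S i k * S j l * m2 i j) * (z k 0 * z l 0)) / 2 +
      kap * t * (2 * B ^+ 2 * N ^+ 2) * \sum_k z k 0 ^+ 2.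
    rewrite mulr_suml mulr_sumr -big_split/=; apply: eq_bigr => k _.
    rewrite [X in _ = _ + X](_ : _ = \sum_l (kap * t * (2 * B ^+ 2 * N ^+ 2)) *+ (k == l) * (z k 0 * z l 0)).
      rewrite mulr_suml -big_split/=; apply: eq_bigr => l _; rewrite /c0; ring.
    rewrite (bigD1 k)//= eqxx mulr1n big1 ?addr0 ?expr2// => l lk.
    by rewrite eq_sym (negbTE lk) mulr0n mul0r.
  have h5 : kap * (2 * H ^+ 3) <= kap * (t * (2 * A ^+ 2) + 8 * A ^+ 4 / t) +
      (kap * t * (2 * B ^+ 2 * N ^+ 2) * \sum_k z k 0 ^+ 2 + d0 * \sum_i z i 0 ^+ 4).
    have -> : kap * (t * (2 * A ^+ 2) + 8 * A ^+ 4 / t) +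
      (kap * t * (2 * B ^+ 2 * N ^+ 2) * \sum_k z k 0 ^+ 2 + d0 * \sum_i z i 0 ^+ 4) =
      kap * (t * (2 * A ^+ 2 + 2 * B ^+ 2 * (N ^+ 2 * \sum_k z k 0 ^+ 2)) +
       (8 * A ^+ 4 + 8 * B ^+ 4 * (N ^+ 6 * \sum_i z i 0 ^+ 4)) / t).
      by rewrite /d0; ring.
    rewrite ler_wpM2l//; apply: (le_trans h3); apply: lerD.
      by rewrite ler_wpM2l ?(ltW t0)// lerD2l ler_wpM2l ?mulr_ge0 ?sqr_ge0.
    rewrite ler_wpM2r ?invr_ge0 ?(ltW t0)// lerD2l ler_wpM2l// mulr_ge0//.
    by rewrite exprn_ge0// mulr_ge0.
  move: h5; rewrite /a0.
  move: (kap * (2 * H ^+ 3)) (kap * (_ + _)) (kap * t * _ * _) (d0 * _) => u1 u2 u3 u4.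
  move: (moll e f x) (\sum_i c i 0 * m1 i) (\sum_k (\sum_i S i k * m1 i) * z k 0) => v1 v2 v3.
  move: (\sum_i \sum_j c i 0 * c j 0 * m2 i j) => v4.
  move: (\sum_k (\sum_i \sum_j (c i 0 * S j k + S i k * c j 0) * m2 i j) * z k 0) => v5.
  move: (\sum_k \sum_l _ * _) => v6; lra.
- have -> : \sum_k c0 k k = (\sum_i \sum_j (\sum_k S i k * S j k) * m2 i j) / 2 +
      N * (kap * t * (2 * B ^+ 2 * N ^+ 2)).
    rewrite /c0; under eq_bigr do rewrite eqxx mulr1n.
    rewrite big_split/= sumr_const card_ord -[X in _ + X = _]mulr_natl; congr (_ + _).
    rewrite -[LHS]mulr_suml; congr (_ * _); rewrite exchange_big/=; apply: eq_bigr => i _.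
    rewrite exchange_big/=; apply: eq_bigr => j _; by rewrite mulr_suml.
  have h6 : (\sum_i \sum_j c i 0 * c j 0 * m2 i j) / 2 <= kap * e * A ^+ 2.
    rewrite ler_pdivrMr//.
    have -> : kap * e * A ^+ 2 * 2 = \sum_(i < n) \sum_(j < n) (D * beta) * (D * beta) * (2 * K / e).
      rewrite !sumr_const card_ord -[RHS]mulr_natl -[X in _ = _ * X]mulr_natl /kap /A; field; by rewrite gt_eqF.
    apply: ler_sum => i _; apply: ler_sum => j _; apply: (le_trans (ler_norm _)).
    rewrite !normrM; apply: ler_pM => //; first by apply: ler_pM.
    exact: moll2_bound.
  have h7 : kap * e * A ^+ 2 <= kap * (D * t) * (N ^+ 2 * beta ^+ 2 * (Tm + em ^+ 2) / 2).
    have -> : kap * e * A ^+ 2 = kap * (D * t) * (N ^+ 2 * beta ^+ 2) * (e * t).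
      by rewrite /A -{1 2}tD; ring.
    have -> : kap * (D * t) * (N ^+ 2 * beta ^+ 2 * (Tm + em ^+ 2) / 2) =
      kap * (D * t) * (N ^+ 2 * beta ^+ 2) * ((Tm + em ^+ 2) / 2) by ring.
    rewrite ler_wpM2l//.
      by apply: mulr_ge0; [apply: mulr_ge0 => //; apply: mulr_ge0; exact: ltW|apply: mulr_ge0; exact: exprn_ge0].
    rewrite ler_pdivlMr//.
    have := sqr_ge0 (e - t); rewrite sqrrB tD.
    have : e ^+ 2 <= em ^+ 2 by rewrite ler_sqr ?nnegrE ?(ltW e0) ?(le_trans (ltW e0)).
    lra.
  have A2 : A ^+ 2 * t <= D * t * (N ^+ 2 * beta ^+ 2 * Tm).
    have -> : A ^+ 2 * t = D * t * (N ^+ 2 * beta ^+ 2 * D) by rewrite /A; ring.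
    by rewrite !ler_wpM2l ?mulr_ge0 ?exprn_ge0 ?(ltW D_gt0) ?(ltW t0).
  have A4 : A ^+ 4 / t <= D * t * (N ^+ 4 * beta ^+ 4 * Tm ^+ 2).
    have -> : A ^+ 4 / t = D * t * (N ^+ 4 * beta ^+ 4 * D ^+ 2).
      by rewrite /A -tD; field; rewrite gt_eqF.
    rewrite !ler_wpM2l ?mulr_ge0 ?exprn_ge0 ?(ltW D_gt0) ?(ltW t0)//.
    by rewrite ler_sqr ?nnegrE ?(ltW D_gt0)// (le_trans (ltW D_gt0)).
  have -> : taylor_const K beta M Tm em * (D * Num.sqrt D / e ^+ 2) =
     kap * (D * t) * (N ^+ 2 * beta ^+ 2 * (Tm + em ^+ 2) / 2) +
     kap * (2 * (D * t * (N ^+ 2 * beta ^+ 2 * Tm)) + 8 * (D * t * (N ^+ 4 * beta ^+ 4 * Tm ^+ 2))) +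
     kap * (D * t) * (2 * N ^+ 5 * M ^+ 2 + 256 * N ^+ 11 * M ^+ 4).
    by rewrite /taylor_const /kap -/t; ring.
  have h8 : kap * (t * (2 * A ^+ 2) + 8 * A ^+ 4 / t) <=
      kap * (2 * (D * t * (N ^+ 2 * beta ^+ 2 * Tm)) + 8 * (D * t * (N ^+ 4 * beta ^+ 4 * Tm ^+ 2))).
    rewrite ler_wpM2l//; apply: lerD.
      by rewrite mulrCA ler_wpM2l// mulrC.
    by rewrite -mulrA ler_wpM2l.
  have h9 : D * (N * (kap * t * (2 * B ^+ 2 * N ^+ 2))) + d0 * (N * (32 * D ^+ 2)) =
      kap * (D * t) * (2 * N ^+ 5 * M ^+ 2 + 256 * N ^+ 11 * M ^+ 4).
    rewrite /d0 /B -tD; field; by rewrite gt_eqF.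
  rewrite -h9 /a0; move: (le_trans h6 h7) h8.
  move: (\sum_i \sum_j c i 0 * c j 0 * m2 i j) (kap * (t * _ + _)) => v1 v2.
  move: (kap * (D * t) * _) (kap * (2 * _ + _)) => v3 v4.
  move: (N * (kap * t * _)) (d0 * _) => v5 v6.
  move: (moll e f x) (\sum_i c i 0 * m1 i) (\sum_i \sum_j _) => w1 w2 w3 k1 k2.
  rewrite mulrDr mulrA [D * w3 / 2]mulrAC; lra.
Qed.

End ExpectedTaylor.

(** * Convex Hamiltonians and their Legendre transforms *)

Section Compactness.
Context {R : realType} {n : nat}.
Implicit Types (p q x y : 'cV[R]_n).

Lemma trmx_continuous m : continuous (@trmx R m n).
Proof.
move=> x A /(@nbhs_ballP _ 'M[R]_(n, m))[e e0 eA].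
apply/(@nbhs_ballP _ 'M[R]_(m, n)); exists e => // y [_ xy]; apply: eA.
by split=> // i j; rewrite !mxE; exact: xy.
Qed.

Definition cube x (r : R) : set 'cV[R]_n := [set y | forall i, `|y i 0 - x i 0| <= r].

Lemma cube_compact x r : compact (cube x r).
Proof.
pose A i := `[x i 0 - r, x i 0 + r]%classic : set R.
have cA : compact [set v : 'rV[R]_n | forall i, A i (v ord0 i)].
  by apply: rV_compact => i; exact: segment_compact.
have -> : cube x r = (@trmx R 1 n) @` [set v : 'rV[R]_n | forall i, A i (v ord0 i)].
  apply/seteqP; split => [y yr|_ [v vA <-] i].
    exists y^T; last by rewrite trmxK.
    by move=> i; rewrite /A/= in_itv/= mxE -ler_distl.
  by have := vA i; rewrite /A/= in_itv/= -ler_distl mxE.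
apply: continuous_compact => //.
exact/continuous_subspaceT/trmx_continuous.
Qed.

Lemma cube_self x r : 0 <= r -> cube x r x.
Proof. by move=> r0 i; rewrite subrr normr0. Qed.

Lemma locally_bounded_on_balls (g : 'cV[R]_n -> R) :
  (forall p, exists K : R, \forall p' \near nbhs p, `|g p'| <= K) ->
  forall r, exists2 B : R, 0 <= B & forall p, enorm p <= r -> `|g p| <= B.
Proof.
move=> gl r; have := @cube_compact 0 r; rewrite compact_near_coveringP => cov.
have := cov R (pinfty_nbhs R) (fun B p => `|g p| <= B) _.
case=> [p _|B [_ hB]].
  have [K gK] := gl p; exists ([set p' | `|g p'| <= K], [set B | K <= B]) => /=.
    split => //; exists K; split; first exact: num_real.
    by move=> B /ltW.
  by move=> [p' B]/= [h1 h2]; exact: le_trans h2.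
exists (`|B| + 1); first by rewrite addr_ge0.
move=> p pr; apply: (hB (`|B| + 1)) => [|i].
  by rewrite (le_lt_trans (ler_norm _))// ltrDl.
by rewrite mxE subr0 (le_trans (coord_le_enorm p i 0)).
Qed.

End Compactness.

Section ConvexHamiltonian.
Context {R : realType} {n : nat}.
Implicit Types (p q : 'cV[R]_n) (h : 'cV[R]_n -> R) (r B : R).

Definition convex_along h := forall (s : R) p q, 0 <= s <= 1 ->
  h (p + s *: (q - p)) <= h p + s * (h q - h p).

(** Beyond [q], on the ray from [p], a point at distance one from [q] still obeys
    the bound, and slopes of a convex function increase along the ray. *)
Lemma convex_lipschitz h B r : convex_along h ->
  (forall p, enorm p <= r + 1 -> `|h p| <= B) ->
  forall p q, enorm p <= r -> enorm q <= r -> `|h p - h q| <= 2 * B * enorm (p - q).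
Proof.
move=> ch hB.
have main p q : enorm p <= r -> enorm q <= r -> h q - h p <= 2 * B * enorm (q - p).
  move=> pr qr; have [->|pq] := eqVneq q p; first by rewrite !subrr enorm0 mulr0.
  set d := enorm (q - p); have d0 : 0 < d.
    rewrite lt_def enorm_ge0 andbT; apply: contra pq => /eqP/enorm_eq0/eqP.
    by rewrite subr_eq0.
  pose q' := q + d^-1 *: (q - p); pose s := d / (1 + d).
  have q'r : enorm q' <= r + 1.
    rewrite (le_trans (ler_enormD _ _))// lerD// enormZ -/d gtr0_norm ?invr_gt0//.
    by rewrite mulVf// gt_eqF.
  have s01 : 0 <= s <= 1.
    apply/andP; split; first by rewrite divr_ge0 ?addr_ge0 ?(ltW d0).
    by rewrite ler_pdivrMr ?addr_gt0// mul1r lerDr.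
  have qE : q = p + s *: (q' - p).
    have -> : q' - p = (1 + d^-1) *: (q - p).
      by rewrite scalerDl scale1r /q' addrAC.
    rewrite scalerA (_ : s * _ = 1) ?scale1r ?subrKC//.
    by rewrite /s; field; rewrite !gt_eqF// addr_gt0.
  rewrite {1}qE; have := ch s p q' s01; rewrite -lerBlDl => /le_trans; apply.
  have := hB _ q'r; have pr1 : enorm p <= r + 1 by rewrite (le_trans pr)// lerDl.
  have := hB _ pr1; rewrite !ler_norml => /andP[a1 a2] /andP[a3 a4].
  have B0 : 0 <= B by lra.
  have sd : s <= d.
    by rewrite /s ler_pdivrMr ?addr_gt0// mulrDr mulr1 lerDl mulr_ge0 ?(ltW d0).
  have /andP[s0 _] := s01.
  apply: (@le_trans _ _ (s * (2 * B))); first by rewrite ler_wpM2l//; lra.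
  by rewrite mulrC ler_wpM2l// mulr_ge0.
move=> p q pr qr; rewrite ler_norml; apply/andP; split; last first.
  exact: main.
by rewrite lerNl opprB -enormN opprB main.
Qed.

(** The part of the assumption on the Hamiltonian that involves only its
    envelopes, hence yields constants common to all admissible Hamiltonians. *)
Record admissible_envelopes (lo hi : 'cV[R]_n -> R) : Prop := {
  env_coercive : forall K, exists2 rho, 0 < rho &
    forall p, rho <= enorm p -> K * enorm p <= lo p ;
  env_bounded : forall r, exists2 B, 0 <= B &
    forall p, enorm p <= r -> `|lo p| <= B /\ `|hi p| <= B }.

Variables lo hi : 'cV[R]_n -> R.
Hypothesis env : admissible_envelopes lo hi.

Lemma env_lower_bound : exists2 C, 0 <= C & forall p, - C <= lo p.
Proof.
have [rho rho0 hrho] := env_coercive env 0; have [B B0 hB] := env_bounded env rho.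
exists B => // p; have [/hrho|/ltW/hB[+ _]] := leP rho (enorm p).
  by rewrite mul0r; apply: le_trans; rewrite oppr_le0.
by rewrite ler_norml => /andP[].
Qed.

Definition between h := forall p, lo p <= h p <= hi p.

Lemma between_bound h r B : between h ->
  (forall p, enorm p <= r -> `|lo p| <= B /\ `|hi p| <= B) ->
  forall p, enorm p <= r -> `|h p| <= B.
Proof.
move=> bh hB p /hB[]; have /andP[h1 h2] := bh p.
by rewrite !ler_norml => /andP[h3 h4] /andP[h5 h6]; apply/andP; split; lra.
Qed.

(** For [h = H t x] this is [legendre H t x], by conversion. *)
Definition conjugate h q : R := sup [set dot p q - h p | p in [set: 'cV[R]_n]].

Lemma conjugate_has_sup h q : between h ->
  has_sup [set dot p q - h p | p in [set: 'cV[R]_n]].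
Proof.
move=> bh; split; first by exists (dot 0 q - h 0), 0.
have [rho rho0 hrho] := env_coercive env (enorm q).
have [B B0 hB] := env_bounded env rho.
exists (rho * enorm q + B) => _ [p _ <-].
have /andP[h1 _] := bh p; have := dot_le_enorm p q.
have q0 := enorm_ge0 q.
have [pr|/ltW pr] := leP rho (enorm p).
  have := hrho p pr; rewrite mulrC => h2.
  have : 0 <= rho * enorm q by rewrite mulr_ge0// ltW.
  lra.
have [+ _] := hB p pr; rewrite ler_norml => /andP[h2 _].
have : enorm p * enorm q <= rho * enorm q by rewrite ler_wpM2r.
lra.
Qed.

Lemma conjugate_ge h p q : between h -> dot p q - h p <= conjugate h q.
Proof.
by move=> bh; apply: sup_upper_bound; [exact: conjugate_has_sup|exists p].
Qed.

Lemma conjugate_le h q c : (forall p, dot p q - h p <= c) -> conjugate h q <= c.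
Proof.
move=> hc; apply: ge_sup => [|_ [p _ <-]]; last exact: hc.
by exists (dot 0 q - h 0), 0.
Qed.

Lemma conjugate_shift h h' q c : between h -> (forall p, h p <= h' p + c) ->
  conjugate h' q <= conjugate h q + c.
Proof.
move=> bh hh'; apply: conjugate_le => p.
by have := conjugate_ge p q bh; have := hh' p; lra.
Qed.

Lemma conjugate_growth h K B q : between h -> 0 <= K ->
  (forall p, enorm p <= K -> `|hi p| <= B) -> K * enorm q - B <= conjugate h q.
Proof.
move=> bh K0 hB; have [->|q0] := eqVneq q 0.
  rewrite enorm0 mulr0 sub0r; apply: le_trans (conjugate_ge 0 0 bh).
  rewrite dot0l sub0r lerN2; have /andP[_ h1] := bh 0; apply: (le_trans h1).
  by rewrite (le_trans (ler_norm _))// hB// enorm0.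
have q1 : enorm q != 0 by apply: contra q0 => /eqP/enorm_eq0 ->.
apply: le_trans (conjugate_ge ((K / enorm q) *: q) q bh).
rewrite dotZl -enorm_sqr_dot expr2 mulrA divfK// lerD2l lerN2.
have /andP[_ h1] := bh ((K / enorm q) *: q); apply: (le_trans h1).
rewrite (le_trans (ler_norm _))// hB// enormZ ger0_norm ?divr_ge0 ?enorm_ge0//.
by rewrite divfK.
Qed.

Lemma convex_continuous h : convex_along h -> between h -> continuous h.
Proof.
move=> ch bh p.
have [B B0 hB] := env_bounded env (enorm p + n%:R + 1).
have hlip := convex_lipschitz ch (between_bound bh hB).
apply/(@cvgrPdist_lt _ _ _ _ (nbhs_filter p)) => e e0.
pose c := 2 * B * n%:R + 1.
have c0 : 0 < c by rewrite ltr_wpDl ?mulr_ge0.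
apply/(@nbhs_normP _ 'cV[R]_n p); exists (Num.min 1 (e / c)).
  by rewrite /= lt_min ltr01 divr_gt0.
move=> q; rewrite /= lt_min => /andP[pq1]; rewrite ltr_pdivlMr// => pq.
have pqn : enorm (p - q) <= n%:R * `|p - q| by exact: enorm_le_mx_norm.
have pqn1 : enorm (p - q) <= n%:R.
  by rewrite (le_trans pqn)// ler_piMr// ltW.
apply: le_lt_trans (hlip p q _ _) _.
- by rewrite lerDl.
- by rewrite -(subKr p q) (le_trans (ler_enormB _ _))// lerD2l.
apply: le_lt_trans pq; rewrite /c mulrDr mulr1.
apply: (@le_trans _ _ (2 * B * (n%:R * `|p - q|))).
  by rewrite ler_wpM2l// mulr_ge0.
by rewrite mulrA [leRHS]addrC mulrC lerDr.
Qed.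

(** Existence of approximate subgradients, with a bound: the displacement from
    [p] to a minimiser of [h] plus a stiff quadratic penalty is, suitably scaled,
    a subgradient at the minimiser, which is close to [p]. *)
Lemma approximate_duality h r B eta : convex_along h -> between h ->
  (forall p, enorm p <= r + n%:R + 1 -> `|lo p| <= B /\ `|hi p| <= B) -> 0 < eta ->
  forall p, enorm p <= r -> exists2 q,
    enorm q <= 4 * B & conjugate h q <= dot p q - h p + eta.
Proof.
move=> ch bh hB eta0 p pr.
have hlip := convex_lipschitz ch (between_bound bh hB).
have B0 : 0 <= B.
  have p1 : enorm p <= r + n%:R + 1 by rewrite (le_trans pr)// -addrA lerDl addr_ge0.
  by have [h1 _] := hB p p1; exact: le_trans h1.
pose L := 2 * B; have L0 : 0 <= L by rewrite mulr_ge0.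
pose la := Num.min (4 * (L + 1))^-1 (eta / (6 * L ^+ 2 + 1)).
have la0 : 0 < la.
  rewrite lt_min invr_gt0 divr_gt0 ?mulr_gt0 ?ltr_wpDl//.
  by rewrite mulr_ge0 ?sqr_ge0.
have la1 : la * (4 * (L + 1)) <= 1.
  have h1 : 0 < 4 * (L + 1) by rewrite mulr_gt0// ltr_wpDl.
  by rewrite -ler_pdivlMr// mul1r ge_min lexx.
have la2 : la * (6 * L ^+ 2) <= eta.
  have h1 : 0 < 6 * L ^+ 2 + 1 by rewrite ltr_wpDl// mulr_ge0 ?sqr_ge0.
  apply: (@le_trans _ _ (la * (6 * L ^+ 2 + 1))).
    by rewrite ler_wpM2l ?(ltW la0)// lerDl.
  by rewrite -ler_pdivlMr// ge_min lexx orbT.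
pose phi q := h q + (2 * la)^-1 * enorm (p - q) ^+ 2.
have la20 : 0 < (2 * la)^-1 by rewrite invr_gt0 mulr_gt0.
have cphi : continuous phi.
  move=> q; have F := nbhs_filter q.
  apply: (@cvgD R R^o _ (nbhs q) F h (fun q => (2 * la)^-1 * enorm (p - q) ^+ 2)).
    exact: convex_continuous.
  apply: (@cvgM R _ (nbhs q) F (cst _) (fun q => enorm (p - q) ^+ 2)).
    exact: cst_continuous.
  have ce : continuous (fun q => enorm (p - q)).
    apply: (@lip_continuous _ _ 1) => x y; have := @lip_enorm R n (p - x) (p - y).
    have -> : p - x - (p - y) = - (x - y) by rewrite opprD addrACA subrr add0r opprB opprK addrC.
    by rewrite enormN.
  apply: (@cvgM R _ (nbhs q) F (fun q => enorm (p - q)) (fun q => enorm (p - q))); exact: ce.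
have [||ph phQ phmin] := @compact_EVT_min _ _ phi _ _ (@cube_compact _ _ p 1).
- by exists p; exact: cube_self.
- exact: continuous_subspaceT.
have {}phmin q : cube p 1 q -> phi ph <= phi q by move=> Qq; apply: phmin; rewrite inE.
move: phQ; rewrite inE => phQ.
pose a := p - ph.
have an : enorm a <= n%:R.
  rewrite (le_trans (enorm_le_sum _))// -[leRHS]mulr1 -[n in leRHS]card_ord mulr_natl -sumr_const.
  by apply: ler_sum => i _; rewrite !mxE distrC.
have phr : enorm ph <= r + n%:R.
  by rewrite -(subKr p ph) (le_trans (ler_enormB _ _))// lerD.
have prn : enorm p <= r + n%:R by rewrite (le_trans pr)// lerDl.
have hpa : `|h p - h ph| <= L * enorm a by exact: hlip.
have aL : enorm a <= 2 * la * L.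
  have := phmin p (cube_self p ler01); rewrite /phi subrr enorm0 expr0n mulr0 addr0.
  rewrite -/a -lerBrDl => h1.
  have h2 : (2 * la)^-1 * enorm a ^+ 2 <= L * enorm a.
    by apply: (le_trans h1); exact: le_trans (ler_norm _) hpa.
  have [->|a0] := eqVneq (enorm a) 0; first by rewrite !mulr_ge0// ltW.
  have a1 : 0 < enorm a by rewrite lt_def a0 enorm_ge0.
  by move: h2; rewrite expr2 mulrA ler_pM2r// ler_pdivrMl ?mulr_gt0.
pose q := la^-1 *: a.
have qL : enorm q <= 2 * L.
  by rewrite enormZ gtr0_norm ?invr_gt0// ler_pdivrMl// mulrCA mulrA.
have sub p2 : h ph + dot (p2 - ph) q <= h p2.
  pose w := p2 - ph; rewrite -subr_le0.
  pose C := (2 * la)^-1 * enorm w ^+ 2.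
  have C0 : 0 <= C by rewrite mulr_ge0 ?sqr_ge0 ?(ltW la20).
  apply: (@le_of_inv_succ _ _ (C * (2 * (enorm w + 1)))).
    by do 2 (apply: mulr_ge0 => //); apply: addr_ge0 => //; exact: enorm_ge0.
  move=> m; pose s := (2 * (enorm w + 1) + m%:R)^-1.
  have w0 := enorm_ge0 w.
  have s0' : 0 < 2 * (enorm w + 1) + m%:R by rewrite ltr_pwDl// mulr_gt0// ltr_wpDl.
  have s0 : 0 < s by rewrite invr_gt0.
  have s1 : s <= 1 by rewrite invf_le1//; have := ler0n R m; lra.
  have sw : s * enorm w <= 2^-1.
    rewrite mulrC ler_pdivrMr//; have := ler0n R m; lra.
  have inQ : cube p 1 (ph + s *: w).
    move=> i; have -> : (ph + s *: w) i 0 - p i 0 = s * w i 0 - a i 0.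
      by rewrite !mxE; ring.
    rewrite (le_trans (ler_normB _ _))// normrM gtr0_norm//.
    have : s * `|w i 0| <= 2^-1.
      by apply: le_trans sw; rewrite ler_pM2l// coord_le_enorm.
    have : `|a i 0| <= 2^-1.
      apply: (le_trans (coord_le_enorm a i 0)); apply: (le_trans aL).
      move: la1; rewrite mulrCA -mulrA => la1.
      have : 0 < la by []. nra.
    lra.
  have := phmin _ inQ; rewrite /phi -/a.
  have -> : p - (ph + s *: w) = a + (- s) *: w by rewrite opprD addrA scaleNr.
  rewrite enorm_sqrD dotZr enormZ exprMn normrN (gtr0_norm s0).
  have := ch s ph p2; rewrite (ltW s0) s1 => /(_ isT); rewrite -/w => h1 h2.
  have dq : dot w q = 2 * (2 * la)^-1 * dot a w.
    rewrite /q dotZr dotC; field; by rewrite gt_eqF.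
  rewrite dq.
  have h3 : s * (h ph + 2 * (2 * la)^-1 * dot a w - h p2) <= s * (s * C).
    rewrite /C; move: h1 h2; move: (h (ph + _)) => u; rewrite mulrDr mulrDr.
    set v := (2 * la)^-1; move: (enorm a ^+ 2) (enorm w ^+ 2) (dot a w) => x y z h1 h2.
    have -> : s * (s * (v * y)) = v * (s ^+ 2 * y) by ring.
    have -> : s * (h ph + 2 * v * z - h p2) = s * h ph - s * h p2 - v * (2 * (- s * z)) by ring.
    lra.
  rewrite ler_pM2l// in h3; apply: (le_trans h3).
  rewrite mulrC -[leRHS]mulrA ler_wpM2l//.
  rewrite /s ler_pdivlMr ?ltr0n// mulrC ler_pdivrMr//.
  have m0 := ler0n R m; rewrite -natr1; move: (m%:R : R) m0 => y y0; nra.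
exists q; first by apply: (le_trans qL); rewrite /L; lra.
apply: (@le_trans _ _ (dot ph q - h ph)).
  by apply: conjugate_le => p2; have := sub p2; rewrite dotDl dotNl; lra.
have -> : dot ph q = dot p q - dot a q by rewrite /a dotDl dotNl; ring.
have h1 : - dot a q <= enorm a * enorm q.
  by rewrite -dotNl -(enormN a) dot_le_enorm.
have h2 : enorm a * enorm q <= (2 * la * L) * (2 * L).
  by apply: ler_pM => //; exact: enorm_ge0.
have h3 : L * enorm a <= L * (2 * la * L) by rewrite ler_wpM2l.
move: hpa; rewrite ler_norml => /andP[_ h4].
have : (2 * la * L) * (2 * L) + L * (2 * la * L) = la * (6 * L ^+ 2) by ring.
lra.
Qed.

End ConvexHamiltonian.

(** * Comparison on a time slab *)

Section TestFunctions.
Context {R : realType} {n : nat}.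
Implicit Types (F G : 'cV[R]_n -> R) (h : R -> R) (x : 'cV[R]_n) (i j : 'I_n).
Implicit Types (e K L c t : R).

Definition mgrad e F x : 'cV[R]_n := \col_i moll1 e i F x.

Definition mhess e F x : 'M[R]_n := \matrix_(i, j) moll2 e i j F x.

(** Affine in time between two smooth functions of space, up to a weight [h]. *)
Definition test_fun e F G c h : R -> 'cV[R]_n -> R :=
  fun t x => moll e F x + (c - t) * moll e G x + h t.

Lemma cont_on_affine_time F G c h : continuous F -> continuous G -> continuous h ->
  cont_on setT (fun t x => F x + (c - t) * G x + h t).
Proof.
move=> cF cG ch; apply: continuous_subspaceT => z.
pose k1 (z : R * 'cV[R]_n) : R := F z.2; pose k2 (z : R * 'cV[R]_n) : R := c - z.1.
pose k3 (z : R * 'cV[R]_n) : R := G z.2; pose k4 (z : R * 'cV[R]_n) : R := h z.1.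
have Fz := nbhs_filter z.
have c1 : (fun z' : R * 'cV[R]_n => z'.1) @ z --> z.1 by exact: cvg_fst.
have c2 : (fun z' : R * 'cV[R]_n => z'.2) @ z --> z.2 by exact: cvg_snd.
have h1 : k1 @ z --> k1 z.
  by apply: (@continuous_comp _ _ _ (fun z : R * 'cV[R]_n => z.2) F) => //; exact: cF.
have h3 : k3 @ z --> k3 z.
  by apply: (@continuous_comp _ _ _ (fun z : R * 'cV[R]_n => z.2) G) => //; exact: cG.
have h4 : k4 @ z --> k4 z.
  by apply: (@continuous_comp _ _ _ (fun z : R * 'cV[R]_n => z.1) h) => //; exact: ch.
have h2 : k2 @ z --> k2 z.
  by apply: (@cvgB R R^o _ (nbhs z) Fz (cst c) (fun z => z.1)) => //; exact: cvg_cst.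
have h5 : k2 \* k3 @ z --> k2 z * k3 z.
  by apply: (@cvgM R _ (nbhs z) Fz k2 k3); [exact: h2|exact: h3].
have h6 : k1 \+ (k2 \* k3) @ z --> k1 z + (k2 z * k3 z).
  by apply: (@cvgD R R^o _ (nbhs z) Fz k1 (k2 \* k3)); [exact: h1|exact: h5].
by apply: (@cvgD R R^o _ (nbhs z) Fz (k1 \+ (k2 \* k3)) k4); [exact: h6|exact: h4].
Qed.

Lemma cont_on_eps (I : set R) (f : R -> 'cV[R]_n -> R) t x eta : cont_on I f -> I t -> 0 < eta ->
  exists2 d : R, 0 < d & forall t' x', I t' -> `|t - t'| < d -> `|x - x'| < d ->
    `|f t x - f t' x'| < eta.
Proof.
move=> cf It eta0.
have /subspace_continuousP/(_ (t, x) It) := cf.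
move=> /(@cvgrPdist_lt _ _ _ _ _ _)/(_ _ eta0)/nbhs_ballP[d /= d0 hd].
exists d => // t' x' It' tt' xx'.
by apply: (hd (t', x')) => //; split; rewrite -ball_normE.
Qed.

Variables (e : R) (K L : R) (F G : 'cV[R]_n -> R) (c : R) (h h' : R -> R).
Hypotheses (e_gt0 : 0 < e) (F_lip : lip K F) (G_lip : lip L G).
Hypotheses (h_derive : forall t : R, is_derive t 1 h (h' t)) (h'_cont : continuous h').

Let phi := test_fun e F G c h.

Lemma test_fun_dt t x : is_derive t 1 (phi^~ x) (- moll e G x + h' t).
Proof.
rewrite /phi /test_fun.
have -> : (fun t => moll e F x + (c - t) * moll e G x + h t) =
    (fun t : R => (moll e F x + c * moll e G x) + (- moll e G x) * t) + h.
  by apply/funext => s; rewrite fctE; ring.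
apply: is_deriveD.
have hid := @is_derive_id R R^o t 1.
have := is_deriveD (is_derive_cst (moll e F x + c * moll e G x : R^o) t 1)
  (is_deriveZ (- moll e G x) hid).
by rewrite add0r /GRing.scale/= mulr1.
Qed.

Let lin_derive (p q : 'cV[R]_n -> R) v x (a b k m : R) : is_derive x v p a -> is_derive x v q b ->
  is_derive x v (fun y => p y + k * q y + m) (a + k * b).
Proof.
move=> hp hq.
have := is_deriveD (is_deriveD hp (is_deriveZ k hq)) (is_derive_cst (m : R^o) x v).
by rewrite addr0.
Qed.

Lemma test_fun_di i t x : is_derive x (delta_mx i 0) (phi t)
  (moll1 e i F x + (c - t) * moll1 e i G x).
Proof. exact: lin_derive (moll_derive e_gt0 i x F_lip) (moll_derive e_gt0 i x G_lip). Qed.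

Lemma test_fun_d_t t x : d_t phi t x = - moll e G x + h' t.
Proof. by have [_ <-] := test_fun_dt t x. Qed.

Lemma test_fun_d_i i : d_i i phi = fun t x => moll1 e i F x + (c - t) * moll1 e i G x + 0.
Proof.
apply/funext => t; apply/funext => x; rewrite addr0.
by have [_ <-] := test_fun_di i t x.
Qed.

Lemma test_fun_dii i j t x : is_derive x (delta_mx i 0) (d_i j phi t)
  (moll2 e i j F x + (c - t) * moll2 e i j G x).
Proof.
rewrite test_fun_d_i.
exact: lin_derive (moll1_derive e_gt0 i j x F_lip) (moll1_derive e_gt0 i j x G_lip).
Qed.

Lemma test_fun_d_ii i j : d_i i (d_i j phi) =
  fun t x => moll2 e i j F x + (c - t) * moll2 e i j G x + 0.
Proof.
apply/funext => t; apply/funext => x; rewrite addr0.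
by have [_ <-] := test_fun_dii i j t x.
Qed.

Lemma test_fun_grad t x : grad phi t x = mgrad e F x + (c - t) *: mgrad e G x.
Proof. by apply/colP => i; rewrite !mxE test_fun_d_i addr0. Qed.

Lemma test_fun_hess t x : hess phi t x = mhess e F x + (c - t) *: mhess e G x.
Proof. by apply/matrixP => i j; rewrite !mxE test_fun_d_ii addr0. Qed.

Let h_cont : continuous h.
Proof.
move=> t; have [dh _] := h_derive t.
by apply: differentiable_continuous; exact/derivable1_diffP.
Qed.

Lemma test_fun_cont : cont_on setT phi.
Proof.
apply: cont_on_affine_time => //.
- exact: (lip_continuous (moll_lip e_gt0 F_lip)).
- exact: (lip_continuous (moll_lip e_gt0 G_lip)).
Qed.

Lemma test_fun_C12 : C12 phi.
Proof.
have c0 : continuous (fun _ : R => 0 : R) by move=> ?; exact: cst_continuous.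
split.
- exact: test_fun_cont.
- by move=> t x; have [] := test_fun_dt t x.
- have -> : d_t phi = fun t x => - moll e G x + (c - t) * 0 + h' t.
    apply/funext => t; apply/funext => x.
    by rewrite test_fun_d_t mulr0 addr0.
  apply: cont_on_affine_time => //; last by move=> ?; exact: cst_continuous.
  move=> x; apply: (@cvgN R R^o _ (nbhs x) (nbhs_filter x)).
  exact: (lip_continuous (moll_lip e_gt0 G_lip)).
- by move=> i t x; have [] := test_fun_di i t x.
- move=> i; rewrite test_fun_d_i; apply: cont_on_affine_time => //.
  + exact: (lip_continuous (moll1_lip e_gt0 i F_lip)).
  + exact: (lip_continuous (moll1_lip e_gt0 i G_lip)).
- by move=> i j t x; have [] := test_fun_dii i j t x.
- move=> i j; rewrite test_fun_d_ii; apply: cont_on_affine_time => //.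
  + exact: (lip_continuous (moll2_lip e_gt0 i j F_lip)).
  + exact: (lip_continuous (moll2_lip e_gt0 i j G_lip)).
Qed.

End TestFunctions.

Section Barrier.
Context {R : realType}.
Implicit Types (k A s c t : R).

(** A weight in time with two purposes: its slope [k] makes the test function a
    strict subsolution, and the quadratic part keeps the contact point away from
    the initial time of the slab, where a maximum over the slab need not be a local
    one. *)
Definition barrier k A s c t : R := - (k * (c - t)) - A * Num.max 0 (s - t) ^+ 2.

Definition barrier' k A s t : R := k + 2 * A * Num.max 0 (s - t).

Lemma barrier_derive k A s c t : 0 <= A ->
  is_derive t 1 (barrier k A s c) (barrier' k A s t).
Proof.
move=> A0; apply: (@is_derive_quadratic _ _ _ _ A) => r.
rewrite /barrier /barrier'.
have -> : - (k * (c - (t + r))) - A * Num.max 0 (s - (t + r)) ^+ 2 -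
    (- (k * (c - t)) - A * Num.max 0 (s - t) ^+ 2) - r * (k + 2 * A * Num.max 0 (s - t)) =
    - (A * (Num.max 0 (s - (t + r)) ^+ 2 - Num.max 0 (s - t) ^+ 2 + 2 * r * Num.max 0 (s - t))).
  by ring.
rewrite normrN normrM (ger0_norm A0) ler_wpM2l//.
have [a|a] := leP 0 (s - (t + r)); have [b|b] := leP 0 (s - t);
  rewrite ler_norml; apply/andP; split; nra.
Qed.

Lemma barrier'_continuous k A s : continuous (barrier' k A s).
Proof.
move=> t; apply: (@cvgD R R^o _ (nbhs t) _ (cst k) (fun t => 2 * A * Num.max 0 (s - t))).
  exact: cvg_cst.
apply: (@cvgM R _ (nbhs t) _ (cst (2 * A)) (fun t => Num.max 0 (s - t))); first exact: cvg_cst.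
apply: (@continuous_max _ _ (cst 0) (fun t => s - t)); first exact: cvg_cst.
by apply: (@cvgB R R^o _ (nbhs t) _ (cst s) id); [exact: cvg_cst|exact: cvg_id].
Qed.

End Barrier.

Section Comparison.
Context {R : realType} {n : nat}.
Variables (sigma : R -> 'cV[R]_n -> 'M[R]_n) (b : R -> 'cV[R]_n -> 'cV[R]_n).
Variable (H : R -> 'cV[R]_n -> 'cV[R]_n -> R).
Implicit Types (F G : 'cV[R]_n -> R) (x p : 'cV[R]_n) (X : 'M[R]_n).

(** The equation with the values of the derivatives as free arguments. *)
Definition pde_at t x (a : R) p X : R :=
  - a - 2^-1 * \tr (sigma t x *m (sigma t x)^T *m X) - dot (b t x) p + H t x p.

Lemma pde_at_convex t x (l a a' : R) p p' X X' : 0 <= l <= 1 -> convex_along (H t x) ->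
  pde_at t x ((1 - l) * a + l * a') ((1 - l) *: p + l *: p') ((1 - l) *: X + l *: X') <=
  (1 - l) * pde_at t x a p X + l * pde_at t x a' p' X'.
Proof.
move=> l01 cH; rewrite /pde_at.
rewrite mulmxDr -!scalemxAr mxtraceD !mxtraceZ dotDr !dotZr.
have := cH l p p' l01.
have -> : p + l *: (p' - p) = (1 - l) *: p + l *: p'.
  by rewrite scalerBr scalerBl scale1r addrAC addrA.
lra.
Qed.

Variables (T : R) (u : R -> 'cV[R]_n -> R).
Hypothesis H_convex : forall t x, times_Q T t -> convex_along (H t x).
Hypothesis u_cont : cont_on (times_Qbar T) u.
Hypothesis u_super : viscosity_supersolution T sigma b H u.

Variables (e : R) (Cp Bu : R).
Hypothesis e_gt0 : 0 < e.
Hypothesis u_bound : forall t x, times_Qbar T t -> `|u t x| <= Bu.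

(** The smoothed norm is a penalty at infinity whose derivatives are bounded;
    convexity of the equation lets it enter through a convex combination. *)
Hypothesis penalty : forall t x, times_Q T t ->
  pde_at t x 0 (- mgrad e enorm x) (- mhess e enorm x) <= Cp.

(** The smooth subsolution has the form [moll F + (c - t) * moll G]. Reducing it by
    a small multiple of the smoothed norm makes its difference with [u] attain a
    maximum on the slab; the terminal inequality and the barrier keep the maximum
    point inside, where the supersolution property is contradicted. *)
Lemma slab_comparison (a c K L Bf kap m : R) F G : 0 <= a -> a < c -> c <= T -> 0 <= kap ->
  lip K F -> lip L G -> (forall x, `|F x| <= Bf) -> (forall x, `|G x| <= Bf) ->
  (forall t x, a < t < c ->
    pde_at t x (- moll e G x) (mgrad e F x + (c - t) *: mgrad e G x)
      (mhess e F x + (c - t) *: mhess e G x) <= kap) ->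
  (forall x, moll e F x - u c x <= m) ->
  forall x, moll e F x + (c - a) * moll e G x - u a x <= m + kap * (c - a).
Proof.
move=> a0 ac cT kap0 hF hG FB GB hpde hterm x.
rewrite leNgt; apply/negP => hlt.
pose eta := (moll e F x + (c - a) * moll e G x - u a x - (m + kap * (c - a))) / 4.
have eta0 : 0 < eta by rewrite divr_gt0// subr_gt0.
have mF y : `|moll e F y| <= Bf by exact: (steklovs_bound e_gt0 _ y hF FB).
have mG y : `|moll e G y| <= Bf by exact: (steklovs_bound e_gt0 _ y hG GB).
have mE (y : 'cV[R]_n) : 0 <= moll e enorm y.
  by rewrite /moll; have [z _ ->] := steklovs_val e_gt0 directions y (@lip_enorm R n); exact: enorm_ge0.
have Bf0 : 0 <= Bf by exact: le_trans (normr_ge0 _) (FB 0).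
have Qa t : a <= t -> t <= c -> times_Qbar T t.
  by move=> h1 h2; rewrite /times_Qbar/= (le_trans a0 h1) (le_trans h2 cT).
have Bu0 : 0 <= Bu by exact: le_trans (normr_ge0 _) (u_bound 0 (Qa a (lexx a) (ltW ac))).
have ca0 : 0 < c - a by rewrite subr_gt0.
(* a time close to [a], where the barrier has not started *)
have [dl [dl0 dlc hdl]] : exists dl, [/\ 0 < dl, a + dl < c &
    m + kap * (c - a) + 3 * eta < moll e F x + (c - (a + dl)) * moll e G x - u (a + dl) x].
  have cphi : cont_on setT (fun t y => moll e F y + (c - t) * moll e G y + 0).
    apply: cont_on_affine_time.
    - exact: (lip_continuous (moll_lip e_gt0 hF)).
    - exact: (lip_continuous (moll_lip e_gt0 hG)).
    - by move=> ?; exact: cst_continuous.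
  have eta2 : 0 < eta / 2 by rewrite divr_gt0.
  have [d1 d10 h1] := cont_on_eps x u_cont (Qa a (lexx a) (ltW ac)) eta2.
  have [d2 d20 h2] := cont_on_eps x cphi (I : [set: R] a) eta2.
  pose dl := Num.min (Num.min d1 d2) (c - a) / 2.
  have dm0 : 0 < Num.min (Num.min d1 d2) (c - a) by rewrite !lt_min d10 d20.
  have dl0 : 0 < dl by rewrite divr_gt0.
  have dlm : dl < Num.min (Num.min d1 d2) (c - a) by rewrite /dl; lra.
  move: dlm; rewrite !lt_min => /andP[/andP[dl1 dl2] dl3].
  exists dl; split => //; first by lra.
  have ad : `|a - (a + dl)| = dl by rewrite opprD addrA subrr add0r normrN gtr0_norm.
  have := h1 (a + dl) x; rewrite ad subrr normr0 => /(_ (Qa _ _ _) dl1 d10).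
  rewrite lerDl (ltW dl0) => /(_ isT); rewrite -lerBrDl => /(_ (ltW dl3)).
  have := h2 (a + dl) x I; rewrite ad subrr normr0 => /(_ dl2 d20).
  rewrite !addr0 !ltr_norml => /andP[_ k1] /andP[k2 _].
  have e4 : 4 * eta = moll e F x + (c - a) * moll e G x - u a x - (m + kap * (c - a)).
    by rewrite /eta mulrC divfK.
  move: k1 k2 e4; clear; move: (_ * _) ((c - a) * _) => v1 v2; lra.
pose B1 := Bf + (c - a) * Bf.
have B10 : 0 <= B1 by rewrite addr_ge0// mulr_ge0// ltW.
have phiB t y : a <= t -> t <= c -> `|moll e F y + (c - t) * moll e G y| <= B1.
  move=> h1 h2; rewrite (le_trans (ler_normD _ _))// lerD// normrM.
  by apply: ler_pM => //; rewrite ger0_norm ?subr_ge0// lerD2l lerN2.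
pose Cl := B1 + moll e enorm x + (`|kap| + `|Cp| + 1) * (c - a).
have Cl0 : 0 <= Cl.
  apply: addr_ge0; first exact: addr_ge0.
  by apply: mulr_ge0; [rewrite !addr_ge0|exact: ltW].
pose l := Num.min (2^-1) (eta / (Cl + 1)).
have l0 : 0 < l by rewrite lt_min invr_gt0 ltr0n divr_gt0// ltr_wpDl.
have l1 : l < 1.
  by apply: (@le_lt_trans _ _ 2^-1); rewrite ?ge_min ?lexx// invf_lt1// ltr1n.
have shrink v : `|v| <= B1 -> (1 - l) * v <= B1.
  move=> /(le_trans (ler_norm _)) h; apply: (@le_trans _ _ ((1 - l) * B1)).
    by rewrite ler_wpM2l// subr_ge0 ltW.
  by rewrite ler_piMl// lerBlDr lerDl ltW.
have lC : l * Cl <= eta.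
  apply: (@le_trans _ _ (l * (Cl + 1))); first by rewrite ler_wpM2l ?(ltW l0)// lerDl.
  by rewrite -ler_pdivlMr ?ltr_wpDl// ge_min lexx orbT.
pose k := kap + l * (`|kap| + `|Cp| + 1).
have k0 : 0 <= k.
  by apply: addr_ge0 => //; apply: mulr_ge0; [exact: ltW|rewrite !addr_ge0].
pose A := (B1 + Bu + `|m| + 1) / dl ^+ 2.
have A0 : 0 <= A.
  by apply: divr_ge0; [do ?[apply: addr_ge0 => //]|exact: sqr_ge0].
pose h := barrier k A (a + dl) c.
pose F' := (fun y => (1 - l) * F y + (- l) * enorm y).
pose G' := (fun y => (1 - l) * G y).
have hF' : lip (`|1 - l| * K + `|- l| * 1) F' by apply: lipD; apply: lipZ => //; exact: lip_enorm.
have hG' : lip (`|1 - l| * L) G' by exact: lipZ.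
have mF' y : moll e F' y = (1 - l) * moll e F y - l * moll e enorm y.
  by rewrite (moll_lin e_gt0 _ _ _ hF (@lip_enorm R n)) mulNr.
have G'E : G' = fun y => (1 - l) * G y + 0 * G y by apply/funext => y; rewrite mul0r addr0.
have mG' y : moll e G' y = (1 - l) * moll e G y.
  by rewrite G'E (moll_lin e_gt0 _ _ _ hG hG) mul0r addr0.
pose Phi := test_fun e F' G' c h.
have PhiE t y : Phi t y = (1 - l) * (moll e F y + (c - t) * moll e G y) -
    l * moll e enorm y + h t.
  by rewrite /Phi /test_fun mF' mG'; ring.
have hd t := barrier_derive k (a + dl) c t A0.
have hc : continuous (barrier' k A (a + dl)) by exact: barrier'_continuous.
have hle t : a <= t -> t <= c -> h t <= 0.
  move=> h1 h2; rewrite /h /barrier -opprD oppr_le0 addr_ge0//.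
    by rewrite mulr_ge0// subr_ge0.
  by rewrite mulr_ge0// sqr_ge0.
pose V := Phi (a + dl) x - u (a + dl) x.
have V_gt : m + 2 * eta < V.
  rewrite /V PhiE /h /barrier subrr maxxx expr0n mulr0 subr0.
  have h1 : l * (moll e F x + (c - (a + dl)) * moll e G x) <= l * B1.
    rewrite ler_wpM2l ?(ltW l0)//; apply: (le_trans (ler_norm _)).
    by apply: phiB; rewrite ?lerDl ltW.
  have h2 : k * (c - (a + dl)) <= kap * (c - a) + l * ((`|kap| + `|Cp| + 1) * (c - a)).
    have -> : kap * (c - a) + l * ((`|kap| + `|Cp| + 1) * (c - a)) = k * (c - a).
      by rewrite /k; ring.
    by rewrite ler_wpM2l// lerD2l lerN2 lerDl ltW.
  have lC' := lC; move: lC'; rewrite /Cl.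
  have -> : l * (B1 + moll e enorm x + (`|kap| + `|Cp| + 1) * (c - a)) =
    l * B1 + l * moll e enorm x + l * ((`|kap| + `|Cp| + 1) * (c - a)) by ring.
  move: hdl h1 h2; set P := moll e F x + _ * moll e G x.
  have -> : (1 - l) * P = P - l * P by ring.
  move: (l * P) (l * B1) (l * moll e enorm x) (l * (_ * _)) (k * _) (kap * _).
  move=> v1 v2 v3 v4 v5 v6; clear; lra.
pose r := (B1 + Bu + `|V| + 1) / l + (n + n)%:R * e + enorm x.
have outside t y : a <= t -> t <= c -> ~ cube 0 r y -> Phi t y - u t y < V.
  move=> h1 h2 /existsNP[i /negP]; rewrite mxE subr0 -ltNge => yr.
  have yr' : r < enorm y by rewrite (lt_le_trans yr)// coord_le_enorm.
  have := moll_near e_gt0 y (@lip_enorm R n); rewrite mul1r ler_norml => /andP[h3 _].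
  have h4 : (B1 + Bu + `|V| + 1) / l <= moll e enorm y.
    have := enorm_ge0 x; move: yr' h3; rewrite /r; move: (_ / l) ((n + n)%:R * e) => v1 v2.
    lra.
  rewrite ler_pdivrMr// mulrC in h4.
  have := shrink _ (phiB t y h1 h2); have := hle t h1 h2.
  have := u_bound y (Qa t h1 h2); rewrite PhiE ler_norml => /andP[+ _].
  have := ler_norm (- V); rewrite normrN; move: h4; clear.
  move: (l * _) ((1 - l) * _) `|V| => v1 v2 v3; lra.
have [[t0 x0] tx0 vmax] : exists2 z : R * 'cV[R]_n, [set z | `[a, c]%classic z.1 /\ cube 0 r z.2] z &
    forall t y, a <= t <= c -> cube 0 r y -> Phi t y - u t y <= Phi z.1 z.2 - u z.1 z.2.
  pose Kset := `[a, c]%classic `*` cube (0 : 'cV[R]_n) r.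
  have Kc : compact Kset by apply: compact_setX; [exact: segment_compact|exact: cube_compact].
  have c1 : {within Kset, continuous (fun z : R * 'cV[R]_n => Phi z.1 z.2)}.
    have := test_fun_cont e_gt0 hF' hG' hd (c := c).
    by rewrite /cont_on; apply: continuous_subspaceW.
  have c2 : {within Kset, continuous (fun z : R * 'cV[R]_n => u z.1 z.2)}.
    move: u_cont; rewrite /cont_on; apply: continuous_subspaceW => -[t y] [/= ht _].
    by move: ht; rewrite in_itv/= => /andP[]; exact: Qa.
  have cPhi : {within Kset, continuous ((fun z : R * 'cV[R]_n => Phi z.1 z.2) - (fun z => u z.1 z.2))}.
    by move=> z; apply: (@continuousB R R^o); [exact: c1|exact: c2].
  have K0 : Kset !=set0.
    exists (a, 0); split => /=; first by rewrite in_itv/= lexx ltW.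
    apply: cube_self; apply: addr_ge0; last exact: enorm_ge0.
    apply: addr_ge0; last by rewrite mulr_ge0// ltW.
    by apply: divr_ge0; [do ?[apply: addr_ge0 => //]|exact: ltW].
  have [z /set_mem zK zmax] := compact_EVT_max K0 Kc cPhi.
  exists z => // t y tac yr; apply: (zmax (t, y)); apply/mem_set; split => //=.
have {}vmax t y : a <= t <= c -> Phi t y - u t y <= Phi t0 x0 - u t0 x0.
  move=> tac; have [yr|yr] := pselect (cube 0 r y); first exact: vmax.
  have /andP[h1 h2] := tac; apply: (le_trans (ltW (outside t y h1 h2 yr))).
  have h3 : a <= a + dl <= c by rewrite lerDl !ltW.
  have [xr|xr] := pselect (cube 0 r x); first exact: vmax.
  have h4 : a <= a + dl by rewrite lerDl ltW.
  by have := outside _ _ h4 (ltW dlc) xr; rewrite ltxx.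
move: tx0 => [/= /itvP t0ac _].
have Vmax : V <= Phi t0 x0 - u t0 x0 by apply: vmax; rewrite lerDl !ltW.
have at0 : a <= t0 by rewrite t0ac.
have t0c : t0 <= c by rewrite t0ac.
have phi0 := phiB t0 x0 at0 t0c; have u0 := u_bound x0 (Qa t0 at0 t0c).
have phi0' := shrink _ phi0.
have lE : 0 <= l * moll e enorm x0 by rewrite mulr_ge0// ltW.
have [t0a|t0a] := eqVneq t0 a.
  have : Phi t0 x0 - u t0 x0 <= - `|m| - 1.
    have ad : a + dl - a = dl by rewrite addrAC subrr add0r.
    rewrite PhiE t0a /h /barrier ad (max_r (ltW dl0)).
    rewrite /A divfK ?gt_eqF ?exprn_gt0//.
    have : 0 <= k * (c - a) by rewrite mulr_ge0// ltW.
    move: u0; rewrite t0a ler_norml => /andP[+ _]; move: phi0' lE; rewrite t0a; clear.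
    move: ((1 - l) * _) (k * _) (l * _) => v1 v2 v3; lra.
  have := ler_norm (- m); rewrite normrN; move: V_gt Vmax eta0; clear; lra.
have [t0c'|t0c'] := eqVneq t0 c.
  have : Phi t0 x0 - u t0 x0 <= m + eta.
    have := hle t0 at0 t0c; have := hterm x0; rewrite PhiE t0c' subrr mul0r addr0.
    have : - (l * moll e F x0) <= l * B1.
      rewrite -mulrN ler_wpM2l ?(ltW l0)//; apply: (le_trans (ler_norm _)).
      by rewrite normrN (le_trans (mF _))// lerDl mulr_ge0// ltW.
    have : l * B1 <= eta.
      apply: le_trans lC; rewrite ler_wpM2l ?(ltW l0)// /Cl -addrA lerDl.
      by apply: addr_ge0 => //; apply: mulr_ge0; [rewrite !addr_ge0|exact: ltW].
    rewrite mulrBl mul1r; move: lE; clear; move: (l * _) (l * _) (l * _) => v1 v2 v3; lra.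
  move: V_gt Vmax eta0; clear; lra.
have t0_in : a < t0 < c by rewrite !lt_def t0a at0 eq_sym t0c' t0c.
have /andP[at0' t0c''] := t0_in.
have Qt0 : times_Q T t0 by rewrite /times_Q/= (le_trans a0 at0) (lt_le_trans t0c'' cT).
have C12Phi : C12 Phi by exact: (test_fun_C12 c e_gt0 hF' hG' hd hc).
have near_max : \forall z \near ((t0, x0) : R * 'cV[R]_n), times_Q T z.1 ->
    u t0 x0 - Phi t0 x0 <= u z.1 z.2 - Phi z.1 z.2.
  have : \forall z \near ((t0, x0) : R * 'cV[R]_n), z.1 \in `]a, c[.
    have h1 : \forall t \near t0, t \in `]a, c[ by apply: near_in_itvoo; rewrite in_itv/= t0_in.
    exact: (@cvg_fst _ _ (nbhs t0) (nbhs x0) _ _ h1).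
  apply: filterS => z; rewrite in_itv/= => /andP[h1 h2] _.
  by rewrite -lerN2 !opprB; apply: vmax; rewrite (ltW h1) (ltW h2).
have := u_super C12Phi Qt0 near_max; apply/negP; rewrite -ltNge.
have -> : pde_lhs sigma b H Phi t0 x0 =
    pde_at t0 x0 (- moll e G' x0 + barrier' k A (a + dl) t0)
      (mgrad e F' x0 + (c - t0) *: mgrad e G' x0) (mhess e F' x0 + (c - t0) *: mhess e G' x0).
  have e1 : d_t Phi t0 x0 = - moll e G' x0 + barrier' k A (a + dl) t0.
    by rewrite /Phi; apply: test_fun_d_t; exact: hd.
  have e2 : grad Phi t0 x0 = mgrad e F' x0 + (c - t0) *: mgrad e G' x0.
    by rewrite /Phi; apply: test_fun_grad; [exact: e_gt0|exact: hF'|exact: hG'].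
  have e3 : hess Phi t0 x0 = mhess e F' x0 + (c - t0) *: mhess e G' x0.
    by rewrite /Phi; apply: test_fun_hess; [exact: e_gt0|exact: hF'|exact: hG'].
  by rewrite /pde_lhs e1 e2 e3.
have l01 : 0 <= l <= 1 by rewrite !ltW.
have h1 := pde_at_convex (- moll e G x0) 0
  (mgrad e F x0 + (c - t0) *: mgrad e G x0) (- mgrad e enorm x0)
  (mhess e F x0 + (c - t0) *: mhess e G x0) (- mhess e enorm x0) l01 (H_convex x0 Qt0).
have h2 := hpde t0 x0 t0_in; have h3 := penalty x0 Qt0.
have e1 : mgrad e F' x0 + (c - t0) *: mgrad e G' x0 =
   (1 - l) *: (mgrad e F x0 + (c - t0) *: mgrad e G x0) + l *: (- mgrad e enorm x0).
  apply/colP => i; rewrite !mxE G'E (moll1_lin e_gt0 _ _ _ _ hF (@lip_enorm R n)).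
  by rewrite (moll1_lin e_gt0 _ _ _ _ hG hG); ring.
have e2 : mhess e F' x0 + (c - t0) *: mhess e G' x0 =
   (1 - l) *: (mhess e F x0 + (c - t0) *: mhess e G x0) + l *: (- mhess e enorm x0).
  apply/matrixP => i j; rewrite !mxE G'E (moll2_lin e_gt0 _ _ _ _ _ hF (@lip_enorm R n)).
  by rewrite (moll2_lin e_gt0 _ _ _ _ _ hG hG); ring.
rewrite e1 e2; move: h1; rewrite mulr0 addr0 mG' mulrN => h1.
have e3 a1 a2 p X : pde_at t0 x0 (a1 + a2) p X = pde_at t0 x0 a1 p X - a2.
  by rewrite /pde_at; ring.
rewrite e3.
have b0 : k <= barrier' k A (a + dl) t0.
  rewrite /barrier' lerDl; apply: mulr_ge0; first by apply: mulr_ge0.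
  by rewrite le_max lexx.
apply: (@le_lt_trans _ _ ((1 - l) * kap + l * Cp - k)).
  apply: lerB => //; apply: (le_trans h1); apply: lerD.
    by rewrite ler_wpM2l// subr_ge0 ltW.
  by rewrite ler_wpM2l// ltW.
rewrite /k; have := ler_norm Cp; have := normr_ge0 kap; move: l0 kap0; clear.
move: `|kap| `|Cp| => v1 v2; nra.
Qed.

End Comparison.

(** * Consequences of the standing assumption *)

Section Norms.
Context {R : realType} {n : nat} {V : normedModType R}.
Variables (N : V -> R) (I : set R).
Hypotheses (N_ge0 : forall v, 0 <= N v) (N0 : N 0 = 0) (n_gt0 : (0 < n)%N).
(** Nonempty index sets make the suprema defining the seminorms nonnegative. *)
Hypothesis I2 : exists t t', [/\ I t, I t' & t != t'].
Implicit Types (f : R -> 'cV[R]_n -> V) (M : R).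

Lemma semi_time_ge0 f : (0 <= semi_time I N f)%E.
Proof.
have [t [t' [It It' tt']]] := I2.
apply: (@le_trans _ _ (N (f t 0 - f t' 0) / Num.sqrt `|t - t'|)%:E).
  by rewrite lee_fin divr_ge0.
by apply: ereal_sup_ubound; exists t, t', 0; split.
Qed.

Lemma semi_space_ge0 f : (0 <= semi_space I N f)%E.
Proof.
have [t [t' [It _ _]]] := I2; pose e : 'cV[R]_n := delta_mx (Ordinal n_gt0) 0.
apply: (@le_trans _ _ (N (f t e - f t 0) / enorm (e - 0))%:E).
  by rewrite lee_fin divr_ge0 ?enorm_ge0.
apply: ereal_sup_ubound; exists t, e, 0; split => //.
apply/eqP => /colP/(_ (Ordinal n_gt0)); rewrite !mxE !eqxx.
by apply/eqP; rewrite oner_eq0.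
Qed.

Lemma norm0_ge0 f : (0 <= norm0 I N f)%E.
Proof.
have [t [t' [It _ _]]] := I2.
apply: (@le_trans _ _ (N (f t 0))%:E); first by rewrite lee_fin.
by apply: ereal_sup_ubound; exists (t, 0).
Qed.

Lemma semi1_le f M : (semi1 I N f <= M%:E)%E ->
  (forall t t' x, I t -> I t' -> N (f t x - f t' x) <= M * Num.sqrt `|t - t'|) /\
  (forall t x x', I t -> N (f t x - f t x') <= M * enorm (x - x')).
Proof.
move=> h; have M0 : 0 <= M.
  by rewrite -lee_fin (le_trans _ h)// adde_ge0 ?semi_time_ge0 ?semi_space_ge0.
split=> [t t' x It It'|t x x' It].
- have [->|tt'] := eqVneq t t'; first by rewrite subrr N0 mulr_ge0.
  rewrite -ler_pdivrMr ?sqrtr_gt0 ?normr_gt0 ?subr_eq0// -lee_fin.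
  apply: le_trans h; apply: le_trans (leeDl _ (semi_space_ge0 f)).
  by apply: ereal_sup_ubound; exists t, t', x.
- have [->|xx'] := eqVneq x x'; first by rewrite subrr N0 mulr_ge0 ?enorm_ge0.
  rewrite -ler_pdivrMr; last first.
    rewrite lt_def enorm_ge0 andbT; apply: contra xx' => /eqP/enorm_eq0/eqP.
    by rewrite subr_eq0.
  rewrite -lee_fin.
  apply: le_trans h; apply: le_trans (leeDr _ (semi_time_ge0 f)).
  by apply: ereal_sup_ubound; exists t, x, x'.
Qed.

Lemma norm1_le f M : (norm1 I N f <= M%:E)%E ->
  [/\ forall t x, I t -> N (f t x) <= M,
    forall t t' x, I t -> I t' -> N (f t x - f t' x) <= M * Num.sqrt `|t - t'| &
    forall t x x', I t -> N (f t x - f t x') <= M * enorm (x - x')].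
Proof.
move=> h.
have s0 : (0 <= semi1 I N f)%E by rewrite adde_ge0 ?semi_time_ge0 ?semi_space_ge0.
have /semi1_le[h1 h2] : (semi1 I N f <= M%:E)%E.
  by apply: le_trans h; exact: leeDr (norm0_ge0 f).
split=> // t x It; rewrite -lee_fin; apply: le_trans h.
apply: le_trans (leeDl _ s0).
by apply: ereal_sup_ubound; exists (t, x).
Qed.

End Norms.

Section SpaceNorms.
Context {R : realType} {n : nat}.
Hypothesis n_gt0 : (0 < n)%N.

Lemma norm1_space_le (g : 'cV[R]_n -> R) (M : R) : (norm1_space Num.norm g <= M%:E)%E ->
  (forall x, `|g x| <= M) /\ lip M g.
Proof.
move=> h.
have n0 : (0 <= norm0_space Num.norm g)%E.
  by apply: (@le_trans _ _ `|g 0|%:E); [rewrite lee_fin|apply: ereal_sup_ubound; exists 0].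
have s0 : (0 <= semi1_space Num.norm g)%E.
  pose e : 'cV[R]_n := delta_mx (Ordinal n_gt0) 0.
  apply: (@le_trans _ _ (`|g e - g 0| / enorm (e - 0))%:E).
    by rewrite lee_fin divr_ge0 ?enorm_ge0.
  apply: ereal_sup_ubound; exists e, 0; split => //.
  apply/eqP => /colP/(_ (Ordinal n_gt0)); rewrite !mxE !eqxx.
  by apply/eqP; rewrite oner_eq0.
have hM x : `|g x| <= M.
  rewrite -lee_fin; apply: le_trans h; apply: le_trans (leeDl _ s0).
  by apply: ereal_sup_ubound; exists x.
split=> // x y; have M0 : 0 <= M := le_trans (normr_ge0 _) (hM 0).
have [->|xy] := eqVneq x y; first by rewrite subrr normr0 mulr_ge0 ?enorm_ge0.
rewrite -ler_pdivrMr; last first.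
  rewrite lt_def enorm_ge0 andbT; apply: contra xy => /eqP/enorm_eq0/eqP.
  by rewrite subr_eq0.
rewrite -lee_fin; apply: le_trans h; apply: le_trans (leeDr _ n0).
by apply: ereal_sup_ubound; exists x, y.
Qed.

Lemma norm0_bounded (I : set R) (f : R -> 'cV[R]_n -> R) :
  (norm0 I Num.norm f < +oo)%E -> exists B, forall t x, I t -> `|f t x| <= B.
Proof.
move=> h; have ub t x : I t -> (`|f t x|%:E <= norm0 I Num.norm f)%E.
  by move=> It; apply: ereal_sup_ubound; exists (t, x).
case E : (norm0 I Num.norm f) h ub => [r| |] // _ ub.
- by exists r => t x It; rewrite -lee_fin; exact: ub.
- by exists 0 => t x It; have := ub t x It.
Qed.

End SpaceNorms.

Section Data.
Context {R : realType} {n : nat}.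
Implicit Types (T M : R) (lo hi : 'cV[R]_n -> R).

(** The pointwise content of the standing assumption. *)
Record admissible_data T M lo hi (sigma : R -> 'cV[R]_n -> 'M[R]_n)
    (b : R -> 'cV[R]_n -> 'cV[R]_n) (H : R -> 'cV[R]_n -> 'cV[R]_n -> R) : Prop := {
  ad_sigma : forall t x, times_Q T t -> enorm (sigma t x) <= M ;
  ad_sigma_t : forall t t' x, times_Q T t -> times_Q T t' ->
    enorm (sigma t x - sigma t' x) <= M * Num.sqrt `|t - t'| ;
  ad_sigma_x : forall t x x', times_Q T t ->
    enorm (sigma t x - sigma t x') <= M * enorm (x - x') ;
  ad_b : forall t x, times_Q T t -> enorm (b t x) <= M ;
  ad_b_t : forall t t' x, times_Q T t -> times_Q T t' ->
    enorm (b t x - b t' x) <= M * Num.sqrt `|t - t'| ;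
  ad_b_x : forall t x x', times_Q T t ->
    enorm (b t x - b t x') <= M * enorm (x - x') ;
  ad_H_t : forall t t' x p, times_Q T t -> times_Q T t' ->
    `|H t x p - H t' x p| <= M * Num.sqrt `|t - t'| ;
  ad_H_x : forall t x x' p, times_Q T t ->
    `|H t x p - H t x' p| <= M * enorm (x - x') ;
  ad_H_between : forall t x, times_Q T t -> between lo hi (H t x) ;
  ad_H_convex : forall t x, times_Q T t -> convex_along (H t x) }.

Variables (T M : R) (lo hi : 'cV[R]_n -> R).
Variables (sigma : R -> 'cV[R]_n -> 'M[R]_n) (b : R -> 'cV[R]_n -> 'cV[R]_n).
Variables (U : 'cV[R]_n -> R) (H : R -> 'cV[R]_n -> 'cV[R]_n -> R).
Hypotheses (n_gt0 : (0 < n)%N) (T_gt0 : 0 < T).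
Hypothesis sa : standing_assumption T M lo hi sigma b U H.

Let I2 : exists t t', [/\ times_Q T t, times_Q T t' & t != t'].
Proof.
have T2 : 0 < T / 2 < T by rewrite divr_gt0//= ltr_pdivrMr// ltr_pMr// ltr1n.
exists 0, (T / 2); rewrite /times_Q /= lexx T_gt0.
by have /andP[h1 h2] := T2; rewrite (ltW h1) h2 lt_eqF.
Qed.

Lemma sa_between t x : times_Q T t -> between lo hi (H t x).
Proof.
move=> Qt p; rewrite -!lee_fin -(sa_Hlo sa) -(sa_Hhi sa); apply/andP; split.
  by apply: ereal_inf_lbound; exists (t, x).
by apply: ereal_sup_ubound; exists (t, x).
Qed.

Lemma convex_function_along (h : 'cV[R]_n -> R) :
  @convex_function R 'cV[R]_n setT h -> convex_along h.
Proof.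
move=> ch s p q /andP[s0 s1].
have := ch (Itv01 s0 s1) q p (in_setT _) (in_setT _).
rewrite !convRE /= => hs.
have E : p + s *: (q - p) = conv (Itv01 s0 s1) (q : convex_lmodType _) p.
  rewrite /conv /= scalerBr scalerBl scale1r addrCA addrA.
  by rewrite -addrA.
move: hs; rewrite -E => hs; have {hs} : h (p + s *: (q - p)) <= s * h q + (1 - s) * h p := hs.
lra.
Qed.

Lemma standing_data : admissible_data T M lo hi sigma b H.
Proof.
have [s1 s2 s3] := norm1_le (@enorm_ge0 R n n) (@enorm0 R n n) n_gt0 I2 (sa_sigma_le sa).
have [b1 b2 b3] := norm1_le (@enorm_ge0 R n 1) (@enorm0 R n 1) n_gt0 I2 (sa_b_le sa).
have hH p := semi1_le (@normr_ge0 _ R) (@normr0 R R) n_gt0 I2 (sa_H_semi sa p).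
split => //.
- by move=> t t' x p Qt Qt'; have [h _] := hH p; exact: h.
- by move=> t x x' p Qt; have [_ h] := hH p; exact: h.
- exact: sa_between.
- by move=> t x Qt; apply: convex_function_along; exact: sa_H_convex sa t x Qt.
Qed.

Lemma standing_envelopes : admissible_envelopes lo hi.
Proof.
have Q0 : times_Q T 0 by rewrite /times_Q/= lexx.
split=> [K|r].
- have [rho [rho0 h]] := sa_H_superlinear sa K.
  exists rho => // p pr; rewrite -lee_fin -(sa_Hlo sa).
  apply: le_ereal_inf_tmp => _ [[t x] /= Qt <-]; rewrite lee_fin.
  have p0 : 0 < enorm p by exact: lt_le_trans pr.
  by rewrite -ler_pdivlMr//; exact: h.
- have [B1 B10 h1] := locally_bounded_on_balls (sa_Hlo_bounded sa) r.
  have [B2 B20 h2] := locally_bounded_on_balls (sa_Hhi_bounded sa) r.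
  exists (B1 + B2); first exact: addr_ge0.
  move=> p pr; split.
    by rewrite (le_trans (h1 p pr))// lerDl.
  by rewrite (le_trans (h2 p pr))// lerDr.
Qed.

Lemma standing_terminal : (forall x, `|U x| <= M) /\ lip M U.
Proof. exact: (norm1_space_le n_gt0 (sa_U_le sa)). Qed.

End Data.

(** * Coordinatewise estimates *)

Section Estimates.
Context {R : realType} {n : nat}.
Implicit Types (p q x y : 'cV[R]_n) (S X : 'M[R]_n) (f g : 'cV[R]_n -> R).

Local Notation N := (n%:R : R).

(** The second-order part of the equation in coordinates, as it comes out of the
    expectation of a quadratic form. *)
Definition trace_form S X : R := \sum_i \sum_j (\sum_k S i k * S j k) * X i j.

Lemma trace_formE S X : \tr (S *m S^T *m X) = trace_form S X.
Proof.
rewrite /mxtrace; under eq_bigr do rewrite mxE.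
rewrite exchange_big; apply: eq_bigr => i _; apply: eq_bigr => j _; rewrite mxE.
by congr (_ * _); apply: eq_bigr => k _; rewrite mxE mulrC.
Qed.

Lemma sum_norm_le (F : 'I_n -> R) (c : R) : (forall i, `|F i| <= c) -> `|\sum_i F i| <= N * c.
Proof.
move=> Fc; apply: (le_trans (ler_norm_sum _ _ _)).
apply: (le_trans (ler_sum _ (fun i _ => Fc i))).
by rewrite sumr_const card_ord mulr_natl.
Qed.

Lemma trace_form_bound S X (M m : R) : (forall i j, `|S i j| <= M) ->
  (forall i j, `|X i j| <= m) -> `|trace_form S X| <= N * (N * (N * (M * M) * m)).
Proof.
move=> SM Xm; apply: sum_norm_le => i; apply: sum_norm_le => j; rewrite normrM.
apply: ler_pM => //; apply: sum_norm_le => k; rewrite normrM.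
by apply: ler_pM.
Qed.

Lemma trace_form_dist S S' X X' (M m dS dX : R) : (forall i j, `|S i j| <= M) ->
  (forall i j, `|S' i j| <= M) -> (forall i j, `|S i j - S' i j| <= dS) ->
  (forall i j, `|X i j| <= m) -> (forall i j, `|X i j - X' i j| <= dX) ->
  `|trace_form S X - trace_form S' X'| <=
    N * (N * (N * (2 * M * dS) * m + N * (M * M) * dX)).
Proof.
move=> SM SM' SS Xm XX.
rewrite /trace_form -sumrB; apply: sum_norm_le => i; rewrite -sumrB.
apply: sum_norm_le => j; set a := \sum_k _; set a' := \sum_k _.
have -> : a * X i j - a' * X' i j = (a - a') * X i j + a' * (X i j - X' i j) by ring.
apply: (le_trans (ler_normD _ _)); rewrite !normrM; apply: lerD; apply: ler_pM => //.
  rewrite -sumrB; apply: sum_norm_le => k.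
  have -> : S i k * S j k - S' i k * S' j k =
    (S i k - S' i k) * S j k + S' i k * (S j k - S' j k) by ring.
  apply: (le_trans (ler_normD _ _)); rewrite !normrM.
  have -> : 2 * M * dS = dS * M + M * dS by ring.
  by apply: lerD; apply: ler_pM.
apply: sum_norm_le => k; rewrite normrM; by apply: ler_pM.
Qed.

Lemma enorm_le_coord p (c : R) : (forall i, `|p i 0| <= c) -> enorm p <= N * c.
Proof.
move=> pc; apply: (le_trans (enorm_le_sum p)).
apply: (le_trans (ler_sum _ (fun i _ => pc i))).
by rewrite sumr_const card_ord mulr_natl.
Qed.

Lemma interpolation_step (D l m m' d : R) : 0 < D -> 0 <= l <= D -> `|m' - m| <= d ->
  `|l * (D^-1 * m' + - D^-1 * m)| <= d.
Proof.
move=> D0 /andP[l0 lD] md; rewrite mulNr -mulrBr mulrA normrM.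
rewrite ger0_norm ?divr_ge0 ?(ltW D0)//; apply: le_trans md.
by rewrite ler_piMl// ler_pdivrMr// mul1r.
Qed.

Lemma dot_mgrad e f p x : dot p (mgrad e f x) = \sum_i p i 0 * moll1 e i f x.
Proof. by apply: eq_bigr => i _; rewrite mxE. Qed.

Lemma trace_form_mhess e f S x :
  trace_form S (mhess e f x) = \sum_i \sum_j (\sum_k S i k * S j k) * moll2 e i j f x.
Proof. by apply: eq_bigr => i _; apply: eq_bigr => j _; rewrite mxE. Qed.

End Estimates.

(** * The scheme with shaken coefficients *)

Section Scheme.
Context {R : realType} {n : nat}.
Implicit Types (f g : 'cV[R]_n -> R) (x y z q p dl : 'cV[R]_n) (S X : 'M[R]_n).

Local Notation N := (n%:R : R).

Variables (T M : R) (lo hi : 'cV[R]_n -> R).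

(** Chosen so that [(1 + growth * D) ^ 2] dominates the expected growth factor of
    squared distances in [cost_coupling]. *)
Definition growth : R := 2 * M + 2 * M ^+ 2.

Definition lip_const : R := expR (growth * T) * (M + 2 * M * T).

Hypotheses (M_gt0 : 0 < M) (n_gt0 : (0 < n)%N) (T_gt0 : 0 < T).
Hypothesis env : admissible_envelopes lo hi.

Variables (C0 B : R).
Hypotheses (C0_ge0 : 0 <= C0) (lo_ge : forall p, - C0 <= lo p).
Hypothesis B_ge0 : 0 <= B.
Hypothesis B_bound : forall p, enorm p <= 3 * (N * lip_const) + N + 1 ->
  `|lo p| <= B /\ `|hi p| <= B.

Variables (sigma : R -> 'cV[R]_n -> 'M[R]_n) (b : R -> 'cV[R]_n -> 'cV[R]_n).
Variables (U : 'cV[R]_n -> R) (H : R -> 'cV[R]_n -> 'cV[R]_n -> R).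
Hypothesis data : admissible_data T M lo hi sigma b H.
Hypotheses (U_bound : forall x, `|U x| <= M) (U_lip : lip M U).

Variables (D : R) (E : R -> ('cV[R]_n -> R) -> R).
Hypotheses (D_gt0 : 0 < D) (D_le : D <= T).
Hypothesis gm : forall s, times_Q T s -> gaussian_mean D (E s).

(** The radius of the shaking covers the total displacement by the averages. *)
Variables (e em rho : R).
Hypotheses (e_gt0 : 0 < e) (e_le : e <= em) (rhoE : rho = (n + n)%:R * e).

Let rho_gt0 : 0 < rho.
Proof. by rewrite rhoE mulr_gt0// ltr0n addn_gt0 n_gt0. Qed.

Let growth_ge0 : 0 <= growth.
Proof. by rewrite addr_ge0// mulr_ge0 ?exprn_ge0// ltW. Qed.

Let N_ge1 : 1 <= N. Proof. by rewrite ler1n. Qed.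

Let M_le_lip : M <= lip_const.
Proof.
have M0 := ltW M_gt0; rewrite /lip_const -[leLHS]mul1r ler_pM//.
  by rewrite -expR0 ler_expR mulr_ge0// ltW.
by rewrite lerDl !mulr_ge0// ltW.
Qed.

Let lip_const_ge0 : 0 <= lip_const.
Proof. exact: le_trans (ltW M_gt0) M_le_lip. Qed.

Let hi_bound r p : r <= 3 * (N * lip_const) + N + 1 -> enorm p <= r -> `|hi p| <= B.
Proof. by move=> hr pr; have [] := B_bound (le_trans pr hr). Qed.

Let NK_ge0 : 0 <= N * lip_const. Proof. exact: mulr_ge0. Qed.

Let hi0 : `|hi 0| <= B.
Proof. by apply: (@hi_bound 0); rewrite ?enorm0// !addr_ge0// mulr_ge0. Qed.

Definition increment_const : R :=
  Num.sqrt T * (C0 + B) + lip_const * (M * (Num.sqrt T + 1)).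

Let increment_ge0 : 0 <= increment_const.
Proof.
have s0 := sqrtr_ge0 T; have M0 := ltW M_gt0.
by apply: addr_ge0; apply: mulr_ge0 => //; rewrite ?addr_ge0// mulr_ge0// addr_ge0.
Qed.

(** The state [x] and the point [y] at which the coefficients are read are separate
    arguments: [cost s g x x q] is the cost of the control [q] in the scheme. *)
Definition cost s g x y q : R := D * conjugate (H s y) q +
  E s (fun z => g (x - D *: q + D *: b s (y - D *: q) + sigma s (y - D *: q) *m z)).

(** Moving the argument of the coefficients, but not the state, by a vector of
    length at most [rho] lets translates of the resulting functions obey one
    inequality with common coefficients, so that it survives averaging. *)
Definition shaken_step s g x : R :=
  inf [set cost s g x (x + v.1) v.2 | v in [set v : 'cV[R]_n * 'cV[R]_n | enorm v.1 <= rho]].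

Section FixedTime.
Variable s : R.
Hypothesis Qs : times_Q T s.

Let gms := gm Qs.

Lemma data_between y : between lo hi (H s y).
Proof. exact: (ad_H_between data y Qs). Qed.

Lemma conjugate_lower y q : - B <= conjugate (H s y) q.
Proof.
have := conjugate_growth env (K := 0) (B := B) q (data_between y) (lexx 0).
rewrite mul0r sub0r; apply => p p0.
by have /enorm_eq0 -> : enorm p = 0 by apply/eqP; rewrite eq_le p0 enorm_ge0.
Qed.

Lemma conjugate_zero y : conjugate (H s y) 0 <= C0.
Proof.
apply: conjugate_le => p; rewrite dot0r sub0r lerNl.
by have /andP[h _] := data_between y p; exact: le_trans (lo_ge p) h.
Qed.

Lemma conjugate_shift_space y y' q :
  conjugate (H s y) q <= conjugate (H s y') q + M * enorm (y - y').
Proof.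
apply: (conjugate_shift env (h := H s y')); first exact: data_between.
move=> p; rewrite -lerBlDl; apply: (le_trans (ler_norm _)).
by have := ad_H_x data y' y p Qs; rewrite -(enormN (y' - y)) opprB.
Qed.

Lemma cost_lower g x y q c : bounded_cont g -> (forall z, `|g z| <= c) ->
  - (D * B) - c <= cost s g x y q.
Proof.
move=> hg gc; apply: lerD.
  by rewrite -mulrN ler_wpM2l ?(ltW D_gt0)// conjugate_lower.
apply: (gm_ge_cst gms) => [|z]; first exact: bounded_cont_affine.
by have := gc (x - D *: q + D *: b s (y - D *: q) + sigma s (y - D *: q) *m z);
   rewrite ler_norml => /andP[].
Qed.

Lemma shaken_le g x dl q : bounded_cont g -> enorm dl <= rho ->
  shaken_step s g x <= cost s g x (x + dl) q.
Proof.
move=> hg er; have [_ [c gc]] := hg; apply: ge_inf.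
  by exists (- (D * B) - c) => _ [v _ <-]; exact: cost_lower.
by exists (dl, q).
Qed.

Lemma shaken_ge g x c :
  (forall dl q, enorm dl <= rho -> c <= cost s g x (x + dl) q) -> c <= shaken_step s g x.
Proof.
move=> h; apply: lb_le_inf; last by move=> _ [[dl q] /= er <-]; exact: h.
by exists (cost s g x (x + 0) 0), (0, 0) => //=; rewrite enorm0 ltW.
Qed.

Lemma drift_bound y : enorm (D *: b s y) <= 0 + D * M.
Proof.
rewrite add0r enormZ gtr0_norm// ler_wpM2l ?(ltW D_gt0)//.
exact: (ad_b data y Qs).
Qed.

Lemma cost_zero_le (K bf : R) g x : 0 <= K -> lip K g -> (forall z, `|g z| <= bf) ->
  cost s g x x 0 <= g x + Num.sqrt D * (Num.sqrt T * C0 + K * (M * (Num.sqrt T + 1))).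
Proof.
move=> K0 hg gb; rewrite /cost scaler0 !subr0.
have := gm_displacement gms x K0 hg gb (lexx 0) M_gt0 D_le (drift_bound x)
  (ad_sigma data x Qs).
rewrite add0r => /(le_trans (ler_norm _)); move: (E s _) => m h.
have : D * conjugate (H s x) 0 <= Num.sqrt D * (Num.sqrt T * C0).
  apply: (@le_trans _ _ (D * C0)); first by rewrite ler_wpM2l ?(ltW D_gt0)// conjugate_zero.
  rewrite mulrA ler_wpM2r// -{1}[D]sqr_sqrtr ?(ltW D_gt0)// expr2.
  by rewrite ler_wpM2l ?sqrtr_ge0// ler_wsqrtr.
lra.
Qed.

Lemma shaken_le_self (K bf : R) g x : 0 <= K -> lip K g -> (forall z, `|g z| <= bf) ->
  shaken_step s g x <= g x + Num.sqrt D * (Num.sqrt T * C0 + K * (M * (Num.sqrt T + 1))).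
Proof.
move=> K0 hg gb; have hb := lip_bounded_cont hg gb.
have e0 : enorm (0 : 'cV[R]_n) <= rho by rewrite enorm0 ltW.
apply: (le_trans (shaken_le x 0 hb e0)); rewrite addr0; exact: (cost_zero_le x K0 hg gb).
Qed.

(** Fast controls do not pay: the running cost grows at least like [K * enorm q],
    which is what a [K]-Lipschitz function can gain from the displacement. *)
Lemma shaken_ge_self (K BK bf : R) g x : 0 <= K -> lip K g -> (forall z, `|g z| <= bf) ->
  0 <= BK -> (forall p, enorm p <= K -> `|hi p| <= BK) ->
  g x - Num.sqrt D * (Num.sqrt T * BK + K * (M * (Num.sqrt T + 1))) <= shaken_step s g x.
Proof.
move=> K0 hg gb BK0 hK; apply: shaken_ge => dl q er; rewrite /cost.
have hc : enorm (- (D *: q) + D *: b s (x + dl - D *: q)) <= D * enorm q + D * M.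
  rewrite (le_trans (ler_enormD _ _))// enormN enormZ gtr0_norm// lerD2l.
  by have := drift_bound (x + dl - D *: q); rewrite add0r.
have Dq0 : 0 <= D * enorm q by rewrite mulr_ge0 ?enorm_ge0// ltW.
have := gm_displacement gms x K0 hg gb Dq0 M_gt0 D_le hc
  (ad_sigma data (x + dl - D *: q) Qs).
rewrite addrA ler_norml => /andP[+ _]; move: (E s _) => m h.
have := conjugate_growth env q (data_between (x + dl)) K0 hK.
move=> /(ler_wpM2l (ltW D_gt0)); rewrite mulrBr => h1.
have : D * BK <= Num.sqrt D * (Num.sqrt T * BK).
  rewrite mulrA ler_wpM2r// -{1}[D]sqr_sqrtr ?(ltW D_gt0)// expr2.
  by rewrite ler_wpM2l ?sqrtr_ge0// ler_wsqrtr.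
move: h h1; rewrite mulrDr (mulrCA D K); lra.
Qed.

(** The point [y] at which the coefficients are frozen on one side may be off by
    a quantity comparable to [m], the distance of the two states combined with
    the shaking radius; both the cost and the motion then differ by [O(D m)]. *)
Lemma cost_coupling f g (a K r m : R) x x' y y' q : bounded_cont f -> bounded_cont g ->
  0 <= K -> 0 < m -> enorm (x - x') ^+ 2 + r ^+ 2 <= m ^+ 2 ->
  enorm (y - y') <= 2 * m ->
  (forall z z', f z - g z' <= a + K * Num.sqrt (enorm (z - z') ^+ 2 + r ^+ 2)) ->
  cost s f x y q - cost s g x' y' q <= a + (K * (1 + growth * D) + 2 * M * D) * m.
Proof.
move=> hf hg K0 m0 xm ym fg; rewrite /cost.
set c := x - D *: q + _; set c' := x' - D *: q + _.
set S := sigma s _; set S' := sigma s _.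
have M0 := ltW M_gt0; have D0 := ltW D_gt0.
have xm' : enorm (x - x') <= m.
  rewrite -ler_sqr ?nnegrE ?enorm_ge0 ?(ltW m0)//; apply: le_trans xm.
  by rewrite lerDl sqr_ge0.
have yqE : y - D *: q - (y' - D *: q) = y - y' by rewrite opprB addrA subrK.
have s0 : 0 < m * (1 + growth * D).
  by rewrite mulr_gt0// ltr_pwDl// mulr_ge0// ltW.
have cS : enorm (c - c') ^+ 2 + D * enorm (S - S') ^+ 2 + r ^+ 2 <=
    (m * (1 + growth * D)) ^+ 2.
  have hc : enorm (c - c') <= enorm (x - x') + D * (M * (2 * m)).
    have -> : c - c' = (x - x') + D *: (b s (y - D *: q) - b s (y' - D *: q)).
      by rewrite /c /c' opprD addrACA -scalerBr opprB addrA subrK.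
    rewrite (le_trans (ler_enormD _ _))// lerD2l enormZ gtr0_norm// ler_wpM2l//.
    have := ad_b_x data (y - D *: q) (y' - D *: q) Qs; rewrite yqE => /le_trans; apply.
    by rewrite ler_wpM2l.
  have hS : enorm (S - S') <= M * (2 * m).
    have := ad_sigma_x data (y - D *: q) (y' - D *: q) Qs; rewrite yqE => /le_trans; apply.
    by rewrite ler_wpM2l.
  apply: (@le_trans _ _ ((enorm (x - x') + D * (M * (2 * m))) ^+ 2 +
      D * (M * (2 * m)) ^+ 2 + r ^+ 2)).
    rewrite lerD2r lerD//.
      by rewrite ler_sqr ?nnegrE ?enorm_ge0// addr_ge0 ?enorm_ge0// !mulr_ge0// ltW.
    by rewrite ler_wpM2l// ler_sqr ?nnegrE ?enorm_ge0// !mulr_ge0// ltW.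
  have h1 : enorm (x - x') * (D * (M * (2 * m))) <= m * (D * (M * (2 * m))).
    by rewrite ler_wpM2r// !mulr_ge0// ltW.
  have h2 : 0 <= (m * (D * M)) * (m * (D * M ^+ 2)).
    by rewrite !mulr_ge0 ?exprn_ge0// ltW.
  have h3 : 0 <= (m * (D * M ^+ 2)) ^+ 2 by rewrite sqr_ge0.
  move: xm h1 h2 h3; rewrite /growth; move: (enorm _) => d xm h1 h2 h3.
  have -> : (d + D * (M * (2 * m))) ^+ 2 + D * (M * (2 * m)) ^+ 2 + r ^+ 2 =
    (d ^+ 2 + r ^+ 2) + 2 * (d * (D * (M * (2 * m)))) +
      4 * D ^+ 2 * M ^+ 2 * m ^+ 2 + 4 * D * M ^+ 2 * m ^+ 2 by ring.
  have -> : (m * (1 + (2 * M + 2 * M ^+ 2) * D)) ^+ 2 =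
    m ^+ 2 + 2 * (m * (D * (M * (2 * m)))) +
      4 * D ^+ 2 * M ^+ 2 * m ^+ 2 + 4 * D * M ^+ 2 * m ^+ 2 +
      8 * ((m * (D * M)) * (m * (D * M ^+ 2))) + 4 * (m * (D * M ^+ 2)) ^+ 2 by ring.
  lra.
have h1 := gm_coupling gms hf hg K0 s0 fg cS.
have h2 : D * conjugate (H s y) q <= D * conjugate (H s y') q + D * (M * (2 * m)).
  rewrite -mulrDr ler_wpM2l// (le_trans (conjugate_shift_space y y' q))// lerD2l.
  by rewrite ler_wpM2l.
move: h1 h2; move: (E s _) (E s _) (conjugate _ _) (conjugate _ _) => A1 A2 A3 A4 h1 h2.
have -> : a + (K * (1 + growth * D) + 2 * M * D) * m =
  (a + K * (m * (1 + growth * D))) + D * (M * (2 * m)) by ring.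
lra.
Qed.

Lemma shaken_lip (K bf : R) g : 0 <= K -> lip K g -> (forall z, `|g z| <= bf) ->
  lip (K * (1 + growth * D) + 2 * M * D) (shaken_step s g).
Proof.
move=> K0 hg gb; have hb := lip_bounded_cont hg gb.
have main x x' : shaken_step s g x - shaken_step s g x' <=
    (K * (1 + growth * D) + 2 * M * D) * enorm (x - x').
  have [->|xx'] := eqVneq x x'; first by rewrite !subrr enorm0 mulr0.
  have m0 : 0 < enorm (x - x').
    rewrite lt_def enorm_ge0 andbT; apply: contra xx' => /eqP/enorm_eq0/eqP.
    by rewrite subr_eq0.
  rewrite lerBlDr -lerBlDl; apply: shaken_ge => dl q er.
  rewrite lerBlDl -lerBlDr.
  apply: (le_trans (lerB (shaken_le x q hb er) (lexx _))).
  rewrite -[leRHS]add0r; apply: (cost_coupling (r := 0) q hb hb K0 m0).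
  - by rewrite expr0n addr0.
  - rewrite opprD addrACA subrr addr0; have := enorm_ge0 (x - x'); lra.
  - move=> z z'; rewrite add0r expr0n addr0 sqrtr_sqr ger0_norm ?enorm_ge0//.
    exact: le_trans (ler_norm _) (hg _ _).
move=> x x'; rewrite ler_norml; apply/andP; split; last exact: main.
by rewrite lerNl opprB -enormN opprB main.
Qed.

Lemma shaken_bound (K bf : R) g : 0 <= K -> lip K g -> (forall z, `|g z| <= bf) ->
  exists bf' : R, forall z, `|shaken_step s g z| <= bf'.
Proof.
move=> K0 hg gb; have hb := lip_bounded_cont hg gb.
pose u := Num.sqrt D * (Num.sqrt T * C0 + K * (M * (Num.sqrt T + 1))).
exists (`|D * B + bf| + `|bf + u|) => z; rewrite ler_norml; apply/andP; split.
  apply: (@le_trans _ _ (- (D * B) - bf)).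
    have := ler_norm (D * B + bf); have := normr_ge0 (bf + u); lra.
  by apply: shaken_ge => dl q er; exact: cost_lower.
apply: (le_trans (shaken_le_self z K0 hg gb)); rewrite -/u.
have := ler_norm (bf + u); have := normr_ge0 (D * B + bf).
have := gb z; rewrite ler_norml => /andP[_]; lra.
Qed.

(** The comparison function may shake the coefficients adversarially; the error
    is absorbed in the distance, regularised at the scale of the shaking. *)
Lemma shaken_coupling f g (a K : R) (v : 'cV[R]_n -> R) : bounded_cont f -> bounded_cont g ->
  0 <= K ->
  (forall z z', f z - g z' <= a + K * Num.sqrt (enorm (z - z') ^+ 2 + rho ^+ 2)) ->
  (forall x q, v x <= cost s f x x q) ->
  forall x x', v x - shaken_step s g x' <= a +
    (K * (1 + growth * D) + 2 * M * D) * Num.sqrt (enorm (x - x') ^+ 2 + rho ^+ 2).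
Proof.
move=> hf hg K0 fg vle x x'; set m := Num.sqrt (enorm (x - x') ^+ 2 + rho ^+ 2).
have q0 : 0 < enorm (x - x') ^+ 2 + rho ^+ 2.
  by rewrite ltr_wpDl ?sqr_ge0// exprn_gt0.
have m0 : 0 < m by rewrite sqrtr_gt0.
have mE : m ^+ 2 = enorm (x - x') ^+ 2 + rho ^+ 2 by rewrite sqr_sqrtr// ltW.
rewrite lerBlDr -lerBlDl; apply: shaken_ge => dl q er; rewrite lerBlDl -lerBlDr.
apply: (le_trans (lerB (vle x q) (lexx _))).
apply: (cost_coupling q hf hg K0 m0 _ _ fg); first by rewrite mE.
rewrite opprD addrA (le_trans (ler_enormD _ _))// enormN mulrDl mul1r lerD//.
  rewrite -ler_sqr ?nnegrE ?enorm_ge0 ?(ltW m0)// mE.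
  by rewrite lerDl sqr_ge0.
apply: (le_trans er); rewrite -ler_sqr ?nnegrE ?(ltW m0) ?(ltW rho_gt0)// mE.
by rewrite lerDr sqr_ge0.
Qed.

(** Averaging the shaken dynamic programming inequalities: the coefficients are
    frozen at the unshaken point while the state is translated. *)
Lemma shaken_moll (K K' bf : R) g x q : 0 <= K ->
  lip K g -> (forall z, `|g z| <= bf) -> lip K' (shaken_step s g) ->
  moll e (shaken_step s g) x <= cost s (moll e g) x x q.
Proof.
move=> K0 hg gb hs; have hb := lip_bounded_cont hg gb.
have sr : (size (@directions n))%:R * e <= rho by rewrite size_directions rhoE.
rewrite /cost; apply: (gm_steklovs gms e_gt0 hs hg gb sr) => v vr.
apply: (le_trans (shaken_le (x + v) q hb (_ : enorm (- v) <= rho))); first by rewrite enormN.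
rewrite /cost addrK lerD2l le_eqVlt; apply/orP; left; apply/eqP.
congr E; apply/funext => z; congr g; congr (_ + _).
by rewrite (addrAC x v) (addrAC _ v).
Qed.

End FixedTime.

(** * Consistency of the smoothed scheme *)

Definition pde_const (r m : R) : R := 2^-1 * (N * (N * (N * (M * M) * m))) + M * r + B.

(** The terms bound, in this order: the defect in duality, the Taylor remainder,
    the displacement of the diffusion and of the second derivatives, of the drift,
    of the gradient against the drift, and of the Hamiltonian in time and in [p].
    Each is [O(sqrt D / e ^ 2)] for [e <= em]. *)
Definition slope_const : R :=
  em ^+ 2 + @taylor_const R n lip_const (4 * B + M) M T em +
  2^-1 * (N * (N * (N * (2 * M * (M * (Num.sqrt T * (4 * B) + 1))) * (2 * lip_const * em) +
                    N * (M * M) * (4 * increment_const)))) +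
  M * (Num.sqrt T * (4 * B) + 1) * (N * lip_const) * em ^+ 2 + M * (N * (2 * increment_const * em)) +
  M * em ^+ 2 + 2 * B * (N * (2 * increment_const * em)).

Lemma pde_at_bound t x p X (r m : R) : times_Q T t -> enorm p <= r ->
  r <= 3 * (N * lip_const) + N + 1 -> (forall i j, `|X i j| <= m) ->
  pde_at sigma b H t x 0 p X <= pde_const r m.
Proof.
move=> Qt pr hr Xm; rewrite /pde_at trace_formE oppr0 sub0r.
have SM i j : `|sigma t x i j| <= M.
  exact: le_trans (coord_le_enorm _ _ _) (ad_sigma data x Qt).
have := trace_form_bound SM Xm; rewrite ler_norml => /andP[h1 _].
have : `|dot (b t x) p| <= M * r.
  apply: (le_trans (normr_dot_le _ _)); apply: ler_pM => //; try exact: enorm_ge0.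
  exact: (ad_b data x Qt).
rewrite ler_norml => /andP[h2 _].
have /andP[_ h3] := ad_H_between data x Qt p.
have := hi_bound hr pr; rewrite ler_norml => /andP[_ h4].
rewrite /pde_const; move: h1 h2 h3 h4.
move: (trace_form _ _) (dot _ _) (H _ _ _) (hi _) => a1 a2 a3 a4; move: (N * _) (M * r) => a5 a6.
lra.
Qed.

(** Up to the Taylor remainder, the increment of the smoothed scheme is the
    Hamiltonian evaluated at the nearly optimal bounded control given by
    [approximate_duality]; the coefficients are then moved from [(a, x - D q)] to
    [(t, x)], and the derivatives from one end of the slab to time [t]. *)
Lemma consistency (bf : R) f g a t x :
  let G := fun y => D^-1 * g y + - D^-1 * f y in
  times_Q T a -> times_Q T t -> a < t < a + D ->
  lip lip_const f -> lip lip_const g -> (forall z, `|f z| <= bf) ->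
  (forall y, `|g y - f y| <= increment_const * Num.sqrt D) ->
  (forall y q, moll e g y <= cost a (moll e f) y y q) ->
  pde_at sigma b H t x (- moll e G x) (mgrad e f x + (a + D - t) *: mgrad e G x)
    (mhess e f x + (a + D - t) *: mhess e G x) <=
  slope_const * (Num.sqrt D / e ^+ 2).
Proof.
move=> G Qa Qt /andP[aT tD] hf hg fb gf hmoll.
have D0 := D_gt0.
pose tau := Num.sqrt D; have tau0 : 0 < tau by rewrite sqrtr_gt0.
have tauD : tau ^+ 2 = D by rewrite sqr_sqrtr// ltW.
pose k := tau / e ^+ 2; have k0 : 0 < k by rewrite divr_gt0// exprn_gt0.
have em0 : 0 < em by exact: lt_le_trans e_le.
have taue : tau / e <= k * em.
  have -> : tau / e = k * e by rewrite /k; field; rewrite gt_eqF.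
  by rewrite ler_wpM2l// ltW.
have tauk : tau <= k * em ^+ 2.
  have -> : tau = k * e ^+ 2 by rewrite /k divfK// gt_eqF// exprn_gt0.
  by rewrite ler_wpM2l ?(ltW k0)// ler_sqr ?nnegrE ?(ltW e_gt0) ?(ltW em0).
have N0 : 0 <= N by exact: ler0n.
have l0D : 0 <= a + D - t <= D by apply/andP; split; lra.
set l := a + D - t in l0D *.
have ta : `|t - a| <= D by rewrite ger0_norm; lra.
have sta : Num.sqrt `|t - a| <= tau by rewrite ler_wsqrtr.
set p0 := mgrad e f x; set p := p0 + _.
set X0 := mhess e f x; set X := X0 + _.
have p0K i : `|p0 i 0| <= lip_const by rewrite mxE; exact: moll1_bound.
have p0n : enorm p0 <= N * lip_const by exact: enorm_le_coord.
have X0m i j : `|X0 i j| <= 2 * lip_const / e by rewrite mxE; exact: moll2_bound.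
have ppi i : `|(p0 - p) i 0| <= 2 * (increment_const * tau) / e.
  rewrite /p opprD addrA subrr sub0r !mxE normrN (moll1_lin e_gt0 _ _ _ _ hg hf).
  by apply: interpolation_step => //; exact: (moll1_dist e_gt0 i x hg hf gf).
have pp : enorm (p0 - p) <= N * (2 * increment_const * em) * k.
  apply: (le_trans (enorm_le_coord ppi)); rewrite -[leRHS]mulrA ler_wpM2l//.
  have -> : 2 * (increment_const * tau) / e = 2 * increment_const * (tau / e) by ring.
  by rewrite -[leRHS]mulrA (mulrC em) ler_wpM2l// mulr_ge0.
have XX i j : `|X0 i j - X i j| <= 4 * increment_const * k.
  rewrite /X !mxE opprD addrA subrr sub0r normrN (moll2_lin e_gt0 _ _ _ _ _ hg hf).
  apply: interpolation_step => //.
  apply: (le_trans (moll2_dist e_gt0 i j x hg hf gf)).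
  by rewrite le_eqVlt; apply/orP; left; apply/eqP; rewrite -/tau /k; field; rewrite gt_eqF.
have p1n : enorm p <= 3 * (N * lip_const).
  have g1 i : `|(mgrad e g x - p0) i 0| <= lip_const + lip_const.
    rewrite !mxE (le_trans (ler_normB _ _))// lerD//; exact: moll1_bound.
  have g2 i : `|(l *: mgrad e G x) i 0| <= lip_const + lip_const.
    rewrite !mxE (moll1_lin e_gt0 _ _ _ _ hg hf); apply: interpolation_step => //.
    by have := g1 i; rewrite !mxE.
  apply: (le_trans (ler_enormD _ _)).
  by have := enorm_le_coord g2; lra.
have hB1 p' : enorm p' <= N * lip_const + N + 1 -> `|lo p'| <= B /\ `|hi p'| <= B.
  by move=> h; apply: B_bound; apply: (le_trans h); have := NK_ge0; lra.
have [q qB hq] := approximate_duality env (ad_H_convex data x Qa)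
  (ad_H_between data x Qa) hB1 tau0 p0n.
have q0 := enorm_ge0 q.
pose y := x - D *: q; pose S := sigma a y; pose v := - (D *: q) + D *: b a y.
have SM i j : `|S i j| <= M.
  exact: le_trans (coord_le_enorm _ _ _) (ad_sigma data y Qa).
have sM i j : `|sigma t x i j| <= M.
  exact: le_trans (coord_le_enorm _ _ _) (ad_sigma data x Qt).
have vb i : `|v i 0| <= D * (4 * B + M).
  rewrite /v -scalerN -scalerDr mxE normrM gtr0_norm// ler_wpM2l ?(ltW D0)//.
  apply: (le_trans (coord_le_enorm _ i 0)); rewrite (le_trans (ler_enormD _ _))// enormN.
  by apply: lerD => //; exact: (ad_b data y Qa).
have be0 : 0 <= 4 * B + M by rewrite addr_ge0 ?mulr_ge0// ltW.
have h1 := gm_taylor (gm Qa) x e_gt0 e_le D_le lip_const_ge0 be0 (ltW M_gt0) hf fb vb SM.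
have h2 := hmoll x q; rewrite /cost -/y -/S in h2.
have vE : x + v = y + D *: b a y by rewrite /v /y addrA.
rewrite vE -dot_mgrad -trace_form_mhess -/p0 -/X0 -/tau in h1.
set TC := taylor_const _ _ _ _ _ in h1.
have hG : moll e G x <= conjugate (H a x) q + dot (b a y - q) p0 +
    2^-1 * trace_form S X0 + TC * k.
  rewrite (moll_lin e_gt0 _ _ _ hg hf) mulNr -mulrBr ler_pdivrMl//.
  have -> : D * (conjugate (H a x) q + dot (b a y - q) p0 + 2^-1 * trace_form S X0 + TC * k) =
     D * conjugate (H a x) q + dot v p0 + D / 2 * trace_form S X0 +
     TC * (D * tau / e ^+ 2).
    rewrite /v -scalerN -scalerDr dotZl (addrC (- q)) /k; ring.
  move: h1 h2; move: (E a _) => A1; lra.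
have b1 : dot (b a y - q) p0 = dot (b a y) p0 - dot p0 q.
  by rewrite dotDl dotNl (dotC q).
have xy : enorm (x - y) <= D * (4 * B).
  by rewrite /y opprB addrC subrK enormZ gtr0_norm// ler_wpM2l// ltW.
have Dt : D <= tau * Num.sqrt T.
  by rewrite -tauD expr2 ler_wpM2l ?(ltW tau0)// ler_wsqrtr.
pose W := Num.sqrt T * (4 * B) + 1.
have W0 : 0 <= W by rewrite addr_ge0// mulr_ge0 ?sqrtr_ge0// mulr_ge0.
have DW : D * (4 * B) + tau <= tau * W.
  by rewrite /W mulrDr mulr1 lerD2r (mulrA tau) ler_wpM2r// mulr_ge0.
have bd : enorm (b a y - b t x) <= M * W * tau.
  have -> : b a y - b t x = (b a y - b a x) + (b a x - b t x) by rewrite addrA subrK.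
  apply: (le_trans (ler_enormD _ _)).
  have h3 := ad_b_x data y x Qa; have h4 := ad_b_t data x Qa Qt.
  have h5 : M * enorm (y - x) <= M * (D * (4 * B)).
    by rewrite ler_wpM2l ?(ltW M_gt0)// -enormN opprB.
  have h6 : M * Num.sqrt `|a - t| <= M * tau by rewrite ler_wpM2l ?(ltW M_gt0)// distrC.
  have h7 : M * (D * (4 * B) + tau) <= M * (tau * W) by rewrite ler_wpM2l ?(ltW M_gt0).
  lra.
have sd i j : `|S i j - sigma t x i j| <= M * W * tau.
  have h3 := le_trans (coord_le_enorm _ i j) (ad_sigma_x data y x Qa).
  have h4 := le_trans (coord_le_enorm _ i j) (ad_sigma_t data x Qa Qt).
  rewrite !mxE -/S in h3 h4.
  have h5 : M * enorm (y - x) <= M * (D * (4 * B)).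
    by rewrite ler_wpM2l ?(ltW M_gt0)// -enormN opprB.
  have h6 : M * Num.sqrt `|a - t| <= M * tau by rewrite ler_wpM2l ?(ltW M_gt0)// distrC.
  have h7 : M * (D * (4 * B) + tau) <= M * (tau * W) by rewrite ler_wpM2l ?(ltW M_gt0).
  have -> : S i j - sigma t x i j = (S i j - sigma a x i j) + (sigma a x i j - sigma t x i j).
    by rewrite addrA subrK.
  apply: (le_trans (ler_normD _ _)); lra.
have E1 : trace_form S X0 - trace_form (sigma t x) X <=
    N * (N * (N * (2 * M * (M * W)) * (2 * lip_const * em) + N * (M * M) * (4 * increment_const))) * k.
  apply: (le_trans (ler_norm _)).
  apply: (le_trans (trace_form_dist SM sM sd X0m XX)).
  rewrite -[leRHS]mulrA ler_wpM2l// -[leRHS]mulrA ler_wpM2l// [leRHS]mulrDl lerD//.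
    have -> : N * (2 * M * (M * W * tau)) * (2 * lip_const / e) =
      N * (2 * M * (M * W)) * (2 * lip_const) * (tau / e) by ring.
    have -> : N * (2 * M * (M * W)) * (2 * lip_const * em) * k =
      N * (2 * M * (M * W)) * (2 * lip_const) * (k * em) by ring.
    rewrite ler_wpM2l//; have M0 := ltW M_gt0.
    by apply: mulr_ge0; apply: mulr_ge0 => //; apply: mulr_ge0; apply: mulr_ge0.
  by rewrite -[leRHS]mulrA.
have E2 : dot (b a y) p0 - dot (b t x) p <=
    (M * W * (N * lip_const) * em ^+ 2 + M * (N * (2 * increment_const * em))) * k.
  have -> : dot (b a y) p0 - dot (b t x) p = dot (b a y - b t x) p0 + dot (b t x) (p0 - p).
    by rewrite dotDl dotNl dotDr dotNr; ring.
  rewrite mulrDl; apply: lerD.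
    apply: (le_trans (dot_le_enorm _ _)).
    apply: (@le_trans _ _ (M * W * tau * (N * lip_const))).
      by apply: ler_pM => //; exact: enorm_ge0.
    have -> : M * W * (N * lip_const) * em ^+ 2 * k = M * W * (N * lip_const) * (k * em ^+ 2) by ring.
    have -> : M * W * tau * (N * lip_const) = M * W * (N * lip_const) * tau by ring.
    rewrite ler_wpM2l//.
    by apply: mulr_ge0 => //; apply: mulr_ge0 => //; exact: ltW.
  apply: (le_trans (dot_le_enorm _ _)); rewrite -[leRHS]mulrA.
  by apply: ler_pM => //; [exact: enorm_ge0|exact: enorm_ge0|exact: (ad_b data x Qt)].
have E3 : H t x p - H a x p0 <= (M * em ^+ 2 + 2 * B * (N * (2 * increment_const * em))) * k.
  have h3 := le_trans (ler_norm _) (ad_H_t data x p Qt Qa).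
  have h4 : M * Num.sqrt `|t - a| <= M * em ^+ 2 * k.
    rewrite -[leRHS]mulrA ler_wpM2l ?(ltW M_gt0)// (le_trans sta)// mulrC.
    by rewrite mulrC (mulrC (em ^+ 2)).
  have h5 : H a x p - H a x p0 <= 2 * B * (N * (2 * increment_const * em)) * k.
    have hB2 p' : enorm p' <= 3 * (N * lip_const) + 1 -> `|H a x p'| <= B.
      move=> h; apply: (between_bound (ad_H_between data x Qa) B_bound).
      by apply: (le_trans h); rewrite lerD2r lerDl.
    apply: (le_trans (ler_norm _)).
    have p0n3 : enorm p0 <= 3 * (N * lip_const) by rewrite (le_trans p0n)// ler_peMl// (ler_nat _ 1 3).
    apply: (le_trans (convex_lipschitz (ad_H_convex data x Qa) hB2 p1n p0n3)).
    rewrite -[leRHS]mulrA ler_wpM2l// ?mulr_ge0//.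
    by rewrite -enormN opprB.
  lra.
rewrite /pde_at opprK trace_formE.
have -> : slope_const * k =
  k * em ^+ 2 + TC * k +
  2^-1 * (N * (N * (N * (2 * M * (M * W)) * (2 * lip_const * em) + N * (M * M) * (4 * increment_const))) * k) +
  (M * W * (N * lip_const) * em ^+ 2 + M * (N * (2 * increment_const * em))) * k +
  (M * em ^+ 2 + 2 * B * (N * (2 * increment_const * em))) * k.
  by rewrite /slope_const -/TC -/W; ring.
move: hG b1 hq E1 E2 E3 tauk.
move: (moll e G x) (conjugate _ _) (dot _ _) (dot _ _) (dot _ _) (dot _ _) (trace_form _ _)
  (trace_form _ _) (TC * k) (H t x p) (H a x p0).
move: ((M * em ^+ 2 + _) * k) ((M * W * (N * lip_const) * em ^+ 2 + _) * k) (k * em ^+ 2).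
move: (N * (N * _) * k).
move=> *; lra.
Qed.

(** * The error estimate *)

Definition terminal_const : R :=
  Num.sqrt T * C0 + M * (M * (Num.sqrt T + 1)).

Definition rate_const : R :=
  terminal_const * em ^+ 4 + 2 * (lip_const * (n + n)%:R) + M * (n + n)%:R +
  (2^-1 * (N * (N * (N * (M * M) * (2 * M)))) * em ^+ 8 + (M * (N * M) + B) * em ^+ 9) +
  slope_const * T * em ^+ 2.

Variable v : R -> 'cV[R]_n -> R.
Hypothesis v_cont : forall s, times_Qbar T s -> bounded_cont (v s).
Hypothesis v_step : forall s x q, 0 <= s <= T - D ->
  v s x <= cost s (v (s + D)) x x q.
Hypothesis v_last : forall s x, T - D < s <= T -> exists2 r : R,
  r <= cost (T - D) U x x 0 &
  v s x = (s + D - T) / D * U x + (T - s) / D * r.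

Variables (u : R -> 'cV[R]_n -> R) (Bu : R).
Hypothesis u_cont : cont_on (times_Qbar T) u.
Hypothesis u_super : viscosity_supersolution T sigma b H u.
Hypothesis u_bound : forall t x, times_Qbar T t -> `|u t x| <= Bu.
Hypothesis u_terminal : forall x, u T x = U x.

(** A closed form dominating the recursion for Lipschitz constants. *)
Definition lip_rate j : R := (1 + growth * D) ^+ j * (M + 2 * M * D * j%:R).

Let M_le_lip_rate j : M <= lip_rate j.
Proof.
rewrite /lip_rate -[leLHS]mul1r ler_pM//; first exact: ltW.
  by rewrite exprn_ege1// lerDl mulr_ge0// ltW.
by rewrite lerDl !mulr_ge0// ltW.
Qed.

Let lip_rate_ge0 j : 0 <= lip_rate j.
Proof. exact: le_trans (ltW M_gt0) (M_le_lip_rate j). Qed.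

Let lip_rate_le j : j%:R * D <= T -> lip_rate j <= lip_const.
Proof.
move=> jT; rewrite /lip_rate /lip_const; apply: ler_pM.
- by apply: exprn_ge0; apply: addr_ge0 => //; apply: mulr_ge0 => //; exact: ltW.
- by rewrite addr_ge0 ?(ltW M_gt0)// !mulr_ge0// ltW.
- apply: (@le_trans _ _ (expR (growth * D) ^+ j)).
    rewrite lerXn2r ?nnegrE ?expR_ge0 ?expR_ge1Dx//.
    by rewrite addr_ge0// mulr_ge0// ltW.
  rewrite -expRM_natl ler_expR mulrCA ler_wpM2l//.
- rewrite lerD2l -[leLHS]mulrA ler_wpM2l ?mulr_ge0 ?(ltW M_gt0)//.
  by rewrite mulrC.
Qed.

Let lip_rateS j :
  lip_rate j * (1 + growth * D) + 2 * M * D <= lip_rate j.+1.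
Proof.
have g1 : 1 <= (1 + growth * D) ^+ j.+1.
  by rewrite exprn_ege1// lerDl mulr_ge0// ltW.
have -> : lip_rate j.+1 = lip_rate j * (1 + growth * D) +
    (1 + growth * D) ^+ j.+1 * (2 * M * D).
  by rewrite /lip_rate exprSr -natr1; ring.
by rewrite lerD2l ler_peMl// !mulr_ge0// ltW.
Qed.

Let slope_const_ge0 : 0 <= slope_const.
Proof.
have M0 := ltW M_gt0; have T0 := ltW T_gt0; have em0 : 0 <= em := le_trans (ltW e_gt0) e_le.
have s0 := sqrtr_ge0 T; rewrite /slope_const /taylor_const.
by repeat first [exact: ler0n | assumption | apply: addr_ge0 | apply: mulr_ge0
  | apply: exprn_ge0 | rewrite invr_ge0].
Qed.

Section Iterates.
Variable c : R.
Hypothesis c_le : c <= T.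

Fixpoint iterate j : 'cV[R]_n -> R :=
  if j is j'.+1 then shaken_step (c - j'.+1%:R * D) (iterate j') else U.

Let times_Q_step j : 0 <= c - j.+1%:R * D -> times_Q T (c - j.+1%:R * D).
Proof.
move=> h; rewrite /times_Q/= h/= ltrBlDr (le_lt_trans c_le)// ltrDl.
by rewrite mulr_gt0// ltr0n.
Qed.

Let step_back j : 0 <= c - j.+1%:R * D -> 0 <= c - j%:R * D.
Proof.
by rewrite -natr1 mulrDl mul1r opprD addrA subr_ge0; apply: le_trans; exact: ltW.
Qed.

Let steps_le j : 0 <= c - j%:R * D -> j%:R * D <= T.
Proof. by rewrite subr_ge0 => /le_trans; apply. Qed.

Lemma iterate_regular j : 0 <= c - j%:R * D ->
  lip (lip_rate j) (iterate j) /\ exists bf : R, forall z, `|iterate j z| <= bf.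
Proof.
elim: j => [_|j IH h].
  by split; [apply: lip_le U_lip|exists M].
have [hl [bf hb]] := IH (step_back h); have Qs := times_Q_step h.
split; last by exact: (shaken_bound Qs (lip_rate_ge0 j) hl hb).
apply: (lip_le (lip_rateS j)).
exact: (shaken_lip Qs (lip_rate_ge0 j) hl hb).
Qed.

Lemma iterate_lip j : 0 <= c - j%:R * D -> lip lip_const (iterate j).
Proof.
move=> h; have [hl _] := iterate_regular h.
by apply: lip_le hl; apply: lip_rate_le; exact: steps_le.
Qed.

Lemma iterate_increment j x : 0 <= c - j.+1%:R * D ->
  `|iterate j.+1 x - iterate j x| <= increment_const * Num.sqrt D.
Proof.
move=> h; have Qs := times_Q_step h; have hl := iterate_lip (step_back h).
have [_ [bf hb]] := iterate_regular (step_back h).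
have h1 := shaken_le_self Qs x lip_const_ge0 hl hb.
have hK p : enorm p <= lip_const -> `|hi p| <= B.
  apply: hi_bound; have := ler_wpM2r lip_const_ge0 N_ge1; rewrite mul1r.
  have := N_ge1; have := NK_ge0; lra.
have h2 := shaken_ge_self Qs x lip_const_ge0 hl hb B_ge0 hK.
rewrite /= ler_distl /increment_const.
have t0 : 0 <= Num.sqrt D by exact: sqrtr_ge0.
have v0 : 0 <= Num.sqrt T by exact: sqrtr_ge0.
have h3 : 0 <= Num.sqrt D * (Num.sqrt T * B) by rewrite !mulr_ge0.
have h4 : 0 <= Num.sqrt D * (Num.sqrt T * C0) by rewrite !mulr_ge0.
have -> : (Num.sqrt T * (C0 + B) + lip_const * (M * (Num.sqrt T + 1))) * Num.sqrt D =
  Num.sqrt D * (Num.sqrt T * C0) + Num.sqrt D * (Num.sqrt T * B) +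
  Num.sqrt D * (lip_const * (M * (Num.sqrt T + 1))) by ring.
move: h1 h2; move: (shaken_step _ _ _) => r; rewrite !mulrDr => {}h1 {}h2.
by apply/andP; split; lra.
Qed.

Lemma scheme_terminal s x : T - D < s <= T -> v s x <= U x + terminal_const * Num.sqrt D.
Proof.
move=> /andP[s1 s2]; have [|r hr ->] := v_last (s := s) x; first by rewrite s1.
have QTD : times_Q T (T - D).
  by rewrite /times_Q/= subr_ge0 D_le ltrBlDr ltrDl.
have h := cost_zero_le QTD x (ltW M_gt0) U_lip U_bound.
have {h}hr := le_trans hr h; rewrite -/terminal_const in hr.
have w0 : 0 <= (T - s) / D by rewrite divr_ge0 ?subr_ge0// ltW.
have w1 : (T - s) / D <= 1 by rewrite ler_pdivrMr// mul1r; lra.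
have -> : (s + D - T) / D = 1 - (T - s) / D by field; rewrite gt_eqF.
have t0 : 0 <= Num.sqrt D * terminal_const.
  apply: mulr_ge0; first exact: sqrtr_ge0.
  have s0 := sqrtr_ge0 T; have M0 := ltW M_gt0.
  by apply: addr_ge0; apply: mulr_ge0 => //; rewrite mulr_ge0// addr_ge0.
move: ((T - s) / D) w0 w1 => l l0 l1.
have h1 : l * r <= l * (U x + Num.sqrt D * terminal_const) by rewrite ler_wpM2l.
have h2 : l * (Num.sqrt D * terminal_const) <= Num.sqrt D * terminal_const by rewrite ler_piMl.
rewrite mulrDr in h1; rewrite mulrBl mul1r (mulrC terminal_const); lra.
Qed.

(** The scheme enters through its inequality with the cost of each control; the
    distance of the two states absorbs the shaking at every step. *)
Lemma scheme_le_iterate j x x' : T - D < c -> 0 <= c - j%:R * D ->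
  v (c - j%:R * D) x - iterate j x' <= terminal_const * Num.sqrt D +
    lip_rate j * Num.sqrt (enorm (x - x') ^+ 2 + rho ^+ 2).
Proof.
move=> Tc; elim: j x x' => [|j IH] x x' h.
  rewrite mul0r subr0/= /lip_rate expr0 mul1r mulr0 addr0.
  have hc : T - D < c <= T by rewrite Tc.
  have h1 := scheme_terminal x hc.
  have h2 := le_trans (ler_norm _) (U_lip x x').
  have h3 : M * enorm (x - x') <= M * Num.sqrt (enorm (x - x') ^+ 2 + rho ^+ 2).
    rewrite ler_wpM2l ?(ltW M_gt0)// -[leLHS]ger0_norm ?enorm_ge0// -sqrtr_sqr.
    by rewrite ler_wsqrtr// lerDl sqr_ge0.
  move: (M * _) (M * _) h2 h3 => A1 A2 h2 h3; lra.
have hj := step_back h; have Qs := times_Q_step h.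
have [hl [bf hb]] := iterate_regular hj.
have sD : c - j.+1%:R * D + D = c - j%:R * D by rewrite -natr1; ring.
have hv : bounded_cont (v (c - j%:R * D)).
  apply: v_cont; rewrite /times_Qbar/= hj/= (le_trans _ c_le)// gerBl.
  by rewrite mulr_ge0// ltW.
have hs : 0 <= c - j.+1%:R * D <= T - D.
  rewrite h/= -natr1 mulrDl mul1r opprD addrA lerD2r (le_trans _ c_le)// gerBl.
  by rewrite mulr_ge0// ltW.
have vle y q : v (c - j.+1%:R * D) y <=
    cost (c - j.+1%:R * D) (v (c - j%:R * D)) y y q.
  by rewrite -sD; exact: v_step.
have := shaken_coupling Qs hv (lip_bounded_cont hl hb)
  (lip_rate_ge0 j) (fun z z' => IH z z' hj) vle x x'.
move=> /le_trans; apply; rewrite lerD2l ler_wpM2r ?sqrtr_ge0//.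
Qed.

Lemma scheme_le_iterate_at j x : T - D < c -> 0 <= c - j%:R * D ->
  v (c - j%:R * D) x - iterate j x <= terminal_const * Num.sqrt D + lip_const * rho.
Proof.
move=> Tc h; apply: (le_trans (scheme_le_iterate x x Tc h)).
rewrite subrr enorm0 expr0n add0r sqrtr_sqr (gtr0_norm rho_gt0) lerD2l.
by rewrite ler_wpM2r ?(ltW rho_gt0)// lip_rate_le// steps_le.
Qed.

Let last_slope := pde_const (N * M) (2 * M / e).
Let slope := slope_const * (Num.sqrt D / e ^+ 2).

Let penalty t x : times_Q T t ->
  pde_at sigma b H t x 0 (- mgrad e enorm x) (- mhess e enorm x) <=
  pde_const (N * 1) (2 * 1 / e).
Proof.
have l1 := @lip_enorm R n.
move=> Qt; apply: (pde_at_bound x Qt).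
- rewrite enormN; apply: enorm_le_coord => i; rewrite mxE; exact: (moll1_bound e_gt0 i x l1).
- by rewrite mulr1; have := NK_ge0; lra.
- by move=> i j; rewrite !mxE normrN; exact: (moll2_bound e_gt0 i j x l1).
Qed.

Let last_slope_ge0 : 0 <= last_slope.
Proof.
have M0 := ltW M_gt0; rewrite /last_slope /pde_const.
have h : 0 <= 2 * M / e by rewrite divr_ge0 ?mulr_ge0// ltW.
apply: addr_ge0 => //; apply: addr_ge0; last by rewrite !mulr_ge0.
by repeat first [exact: ler0n | assumption | apply: mulr_ge0 | rewrite invr_ge0].
Qed.

Let slope_ge0 : 0 <= slope.
Proof.
apply: mulr_ge0; first exact: slope_const_ge0.
by rewrite divr_ge0 ?sqrtr_ge0// exprn_ge0// ltW.
Qed.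

(** On the last slab, shorter than a step, the smoothed terminal value is constant
    in time; the defect [O(1 / e)] in the equation is affordable there. *)
Lemma terminal_comparison x : 0 <= c ->
  moll e U x - u c x <= M * ((n + n)%:R * e) + last_slope * (T - c).
Proof.
move=> c0; have near y : moll e U y - u T y <= M * ((n + n)%:R * e).
  by rewrite u_terminal; apply: le_trans (ler_norm _) (moll_near e_gt0 y U_lip).
have [cT|cT] := eqVneq c T; first by rewrite cT subrr mulr0 addr0.
have {}cT : c < T by rewrite lt_neqAle cT.
have l0 : lip 0 (fun _ : 'cV[R]_n => 0 : R).
  by move=> y y'; rewrite subrr normr0 mul0r.
have m1 (i : 'I_n) y : moll1 e i (fun _ : 'cV[R]_n => 0 : R) y = 0.
  by apply/eqP; rewrite -normr_le0; exact: moll1_bound.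
have m2 (i j : 'I_n) y : moll2 e i j (fun _ : 'cV[R]_n => 0 : R) y = 0.
  apply/eqP; rewrite -normr_le0; have := moll2_bound e_gt0 i j y l0.
  by rewrite mulr0 mul0r.
have m0 y : moll e (fun _ : 'cV[R]_n => 0 : R) y = 0.
  apply/eqP; rewrite -normr_le0; have := moll_near e_gt0 y l0.
  by rewrite mul0r subr0.
have := slab_comparison (fun t x Qt => ad_H_convex data x Qt) u_cont u_super e_gt0
  u_bound penalty c0 cT (lexx T) last_slope_ge0 U_lip l0 U_bound
  (fun _ => _) _ near x.
rewrite m0 mulr0 addr0; apply => [y|t y /andP[t1 t2]].
  by rewrite normr0 ltW.
have Qt : times_Q T t by rewrite /times_Q/= t2 (le_trans c0 (ltW t1)).
have -> : mgrad e (fun _ : 'cV[R]_n => 0 : R) y = 0.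
  by apply/colP => i; rewrite !mxE m1.
have -> : mhess e (fun _ : 'cV[R]_n => 0 : R) y = 0.
  by apply/matrixP => i j; rewrite !mxE m2.
rewrite m0 oppr0 !scaler0 !addr0.
apply: (pde_at_bound y Qt).
- apply: enorm_le_coord => i; rewrite mxE; exact: (moll1_bound e_gt0 i y U_lip).
- have : N * M <= N * lip_const by rewrite ler_wpM2l.
  have := NK_ge0; have := N_ge1; lra.
- by move=> i j; rewrite !mxE; exact: (moll2_bound e_gt0 i j y U_lip).
Qed.

(** Between two grid times the smoothed iterates are interpolated linearly; by
    [consistency] the interpolation is a subsolution up to [slope]. *)
Lemma iterate_comparison j x : 0 <= c - j%:R * D ->
  moll e (iterate j) x - u (c - j%:R * D) x <=
    M * ((n + n)%:R * e) + last_slope * (T - c) + slope * (j%:R * D).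
Proof.
elim: j x => [|j IH] x h.
  rewrite mul0r subr0 mulr0 addr0; apply: terminal_comparison.
  by move: h; rewrite mul0r subr0.
have hj := step_back h; have Qs := times_Q_step h.
have [_ [bf hb]] := iterate_regular hj; have [_ [bg hg]] := iterate_regular h.
have l1 := iterate_lip hj; have l2 := iterate_lip h.
set a := c - j.+1%:R * D in h Qs *.
have aD : a + D = c - j%:R * D by rewrite /a -natr1; ring.
pose G y := D^-1 * iterate j.+1 y + - D^-1 * iterate j y.
have lG := lipD (lipZ (D^-1) l2) (lipZ (- D^-1) l1).
have ac : a < a + D by rewrite ltrDl.
have cT : a + D <= T by rewrite aD (le_trans _ c_le)// gerBl mulr_ge0// ltW.
pose Bf := `|bf| + `|D^-1| * `|bg| + `|D^-1| * `|bf|.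
have b1 y : `|iterate j y| <= Bf.
  apply: (le_trans (hb y)); apply: (le_trans (ler_norm _)).
  by rewrite /Bf -[leRHS]addrA lerDl addr_ge0.
have b2 y : `|G y| <= Bf.
  have aux (r1 r2 : R) : `|D^-1 * r1 + - D^-1 * r2| <= `|D^-1| * `|r1| + `|D^-1| * `|r2|.
    by rewrite (le_trans (ler_normD _ _))// !normrM normrN.
  apply: (le_trans (aux _ _)); rewrite /Bf -[leRHS]addrA -[leLHS]add0r lerD//.
  by apply: lerD; rewrite ler_wpM2l// (le_trans _ (ler_norm _)).
have hm y q : moll e (iterate j.+1) y <= cost a (moll e (iterate j)) y y q.
  exact: (shaken_moll Qs y q lip_const_ge0 l1 hb l2).
have hpde t y : a < t < a + D ->
    pde_at sigma b H t y (- moll e G y) (mgrad e (iterate j) y + (a + D - t) *: mgrad e G y)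
      (mhess e (iterate j) y + (a + D - t) *: mhess e G y) <= slope.
  move=> /andP[t1 t2].
  have Qt : times_Q T t.
    by rewrite /times_Q/= (le_trans h (ltW t1))/= (lt_le_trans t2).
  apply: (consistency y Qs Qt _ l1 l2 hb _ hm); first by rewrite t1.
  by move=> z; exact: iterate_increment.
have hterm y : moll e (iterate j) y - u (a + D) y <=
    M * ((n + n)%:R * e) + last_slope * (T - c) + slope * (j%:R * D).
  by rewrite aD; exact: IH.
have := slab_comparison (fun t x Qt => ad_H_convex data x Qt) u_cont u_super e_gt0
  u_bound penalty h ac cT slope_ge0 l1 lG b1 b2 hpde hterm x.
have -> : a + D - a = D by ring.
rewrite (moll_lin e_gt0 _ _ _ l2 l1).
have -> : D * (D^-1 * moll e (iterate j.+1) x + - D^-1 * moll e (iterate j) x) =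
    moll e (iterate j.+1) x - moll e (iterate j) x by field; rewrite gt_eqF.
have -> : j.+1%:R * D = j%:R * D + D by rewrite -natr1; ring.
rewrite (mulrDr slope); move: (moll _ _ _) (moll _ _ _) => A1 A2; lra.
Qed.

End Iterates.

(** Smoothing and shaking at scale [D ^ (1/10)] balance the displacement they
    cause against the accumulated consistency error [sqrt D / e ^ 2]. *)
Lemma error_estimate t x : e ^+ 10 = D -> 0 <= t <= T ->
  v t x - u t x <= rate_const * e.
Proof.
move=> thD /andP[t0 tT].
have N_gt0 : 0 < N by rewrite ltr0n.
have /truncn_itv/andP[k1 k2] : 0 <= (T - t) / D by rewrite divr_ge0 ?subr_ge0// ltW.
set k := Num.truncn _ in k1 k2; rewrite ler_pdivlMr// in k1; rewrite ltr_pdivrMr// in k2.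
pose c := t + k%:R * D.
have cT : c <= T by rewrite /c; move: (k%:R * D) k1 => a; lra.
have Tc : T - D < c by rewrite /c; move: k2; rewrite -natr1 mulrDl; move: (k%:R * D) => a; lra.
have ct : c - k%:R * D = t by rewrite /c addrK.
have kt0 : 0 <= c - k%:R * D by rewrite ct.
have sD : Num.sqrt D = e ^+ 5.
  rewrite -thD (_ : e ^+ 10 = (e ^+ 5) ^+ 2); last by rewrite -exprM.
  by rewrite sqrtr_sqr ger0_norm// exprn_ge0// ltW.
have h1 := scheme_le_iterate_at cT x Tc kt0.
have h2 := iterate_comparison cT x kt0; have hl := iterate_lip cT kt0.
have := moll_near e_gt0 x hl; rewrite ler_norml => /andP[h3 _].
have e_ge0 := ltW e_gt0; have em_ge0 := le_trans e_ge0 e_le.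
have pow i (A : R) : 0 <= A -> A * e ^+ i * e <= A * em ^+ i * e.
  by move=> A0; rewrite ler_wpM2r// ler_wpM2l// lerXn2r.
have M0 := ltW M_gt0; have T0 := ltW T_gt0; have sT0 := sqrtr_ge0 T; have N0 := ltW N_gt0.
have g1 : terminal_const * Num.sqrt D <= terminal_const * em ^+ 4 * e.
  rewrite sD exprSr mulrA; apply: pow; rewrite /terminal_const.
  by repeat first [exact: ler01 | assumption | apply: addr_ge0 | apply: mulr_ge0].
pose A8 := 2^-1 * (N * (N * (N * (M * M) * (2 * M)))); pose A9 := M * (N * M) + B.
pose ls := pde_const (N * M) (2 * M / e).
have g2 : ls * (T - c) <= (A8 * em ^+ 8 + A9 * em ^+ 9) * e.
  have A8_ge0 : 0 <= A8.
    by repeat first [exact: ler0n | assumption | rewrite invr_ge0 | apply: mulr_ge0].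
  have A9_ge0 : 0 <= A9.
    by repeat first [assumption | apply: addr_ge0 | apply: mulr_ge0].
  have lsE : ls = A8 / e + A9.
    by rewrite /ls /pde_const /A8 /A9; field; rewrite gt_eqF.
  apply: (@le_trans _ _ (ls * D)).
    rewrite ler_wpM2l//; last by lra.
    by rewrite lsE addr_ge0// divr_ge0.
  have -> : ls * D = A8 * e ^+ 8 * e + A9 * e ^+ 9 * e.
    by rewrite lsE -thD; field; rewrite gt_eqF.
  by rewrite [leRHS]mulrDl; apply: lerD; exact: pow.
pose sc := slope_const.
have g3 : sc * (Num.sqrt D / e ^+ 2) * (k%:R * D) <= sc * T * em ^+ 2 * e.
  have sc0 : 0 <= sc by exact: slope_const_ge0.
  have -> : Num.sqrt D / e ^+ 2 = e ^+ 3.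
    by rewrite sD; field; rewrite gt_eqF.
  have kT : k%:R * D <= T by apply: (le_trans k1); rewrite gerBl.
  apply: (@le_trans _ _ (sc * e ^+ 3 * T)).
    by rewrite ler_wpM2l// mulr_ge0// exprn_ge0.
  have -> : sc * e ^+ 3 * T = sc * T * e ^+ 2 * e by ring.
  by apply: pow; exact: mulr_ge0.
rewrite ct in h1 h2; rewrite -/ls -/sc in h2.
have -> : rate_const * e =
  terminal_const * em ^+ 4 * e + 2 * (lip_const * ((n + n)%:R * e)) +
  M * ((n + n)%:R * e) + (A8 * em ^+ 8 + A9 * em ^+ 9) * e + sc * T * em ^+ 2 * e.
  by rewrite /rate_const -/A8 -/A9 -/sc; ring.
rewrite rhoE in h1; move: h1 h2 h3 g1 g2 g3.
move: (sc * _ * _ * _) (sc * _ * _) (ls * _) (terminal_const * em ^+ 4 * e)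
  (terminal_const * Num.sqrt D).
move: ((_ + _) * e) (lip_const * _) (M * _) (v t x) (u t x).
move: (moll _ _ _) (iterate _ _ _) => *; lra.
Qed.

End Scheme.

(** * Brownian increments and conclusion *)

Section Increments.
Context {R : realType} {n : nat} {d : measure_display} {Omega : measurableType d}.
Variables (P : probability Omega R) (W : R -> Omega -> 'cV[R]_n).
Hypothesis bm : brownian_motion P W.

Lemma brownian_gaussian_mean (s D : R) : 0 <= s -> 0 < D ->
  gaussian_mean D (average P (fun w => W (s + D) w - W s w)).
Proof.
move=> s0 D0; apply: gaussian_vector_mean; split => //.
- move=> i; have sD0 : 0 <= s + D by rewrite addr_ge0// ltW.
  have := measurable_funB (bm_measurable bm i sD0) (bm_measurable bm i s0).
  by congr measurable_fun; apply/funext => w; rewrite !mxE.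
- move=> B mB; have ssD : s < s + D by rewrite ltrDl.
  by have := bm_gaussian bm s0 ssD mB; rewrite addrAC subrr add0r.
Qed.

(** The whole space belongs to the filtration, so the constants in [backward] are
    plain expectations. *)
Lemma backward_le_cost sigma b (H : R -> 'cV[R]_n -> 'cV[R]_n -> R) s D phi x r q : 0 < D ->
  backward P W sigma b H s D phi x r ->
  r <= cost sigma b H D (fun s => average P (fun w => W (s + D) w - W s w)) s phi x x q.
Proof.
move=> D0 [e [he [_ hr]]]; pose y := x - D *: q.
apply: (le_trans (hr y)); rewrite /cost -/y.
have -> : D^-1 *: (x - y) = q.
  by rewrite /y opprB addrC subrK scalerA mulVf ?scale1r// gt_eqF.
rewrite lerD2l; have [_ _ _ hA] := he y.
have mT : aug_filtration P W s setT.
  by rewrite -(setD0 setT); apply: sigma_algebraCD; exact: sigma_algebra0.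
have h : (\int[P]_(w in setT) (cst (e y) w)%:E = (e y)%:E)%E.
  have -> : (\int[P]_(w in setT) (cst (e y) w)%:E =
    \int[P]_(w in setT) cst (e y)%:E w)%E by [].
  rewrite integral_cst// [X in (_ * X)%E](_ : _ = 1%E) ?mule1//; exact: probability_setT.
rewrite /average /Rintegral le_eqVlt; apply/orP; left; apply/eqP.
have -> : e y = fine (e y)%:E by [].
rewrite -h hA//; congr fine; apply: eq_integral => w _; congr (_%:E); congr phi.
by rewrite /euler_step (addrAC s D) subrr (add0r D).
Qed.

Lemma cont_on_bounded_cont (I : set R) (f : R -> 'cV[R]_n -> R) s :
  in_Cb I Num.norm f -> I s -> bounded_cont (f s).
Proof.
move=> [cf /norm0_bounded[B hB]] Is; split; last by exists B => x; exact: hB.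
move=> x; apply/(@cvgrPdist_lt _ _ _ _ (nbhs_filter x)) => eta eta0.
have [r r0 hr] := cont_on_eps x cf Is eta0.
apply/(@nbhs_normP _ 'cV[R]_n x); exists r => // x' /= xx'.
by apply: hr => //; rewrite subrr normr0.
Qed.

End Increments.

Theorem theorem3p6 (R : realType) (n : nat) (T M : R) (Hlo Hhi : 'cV[R]_n -> R)
    (n_gt0 : (0 < n)%N) (T_gt0 : 0 < T) (M_gt0 : 0 < M) :
  exists C : R,
  forall (sigma : R -> 'cV[R]_n -> 'M[R]_n) (b : R -> 'cV[R]_n -> 'cV[R]_n)
    (U : 'cV[R]_n -> R) (H : R -> 'cV[R]_n -> 'cV[R]_n -> R),
  standing_assumption T M Hlo Hhi sigma b U H ->
  forall (d : measure_display) (Omega : measurableType d)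
    (P : probability Omega R) (W : R -> Omega -> 'cV[R]_n),
  brownian_motion P W ->
  forall (Delta : R) (uDelta u : R -> 'cV[R]_n -> R),
  0 < Delta <= T ->
  in_Cb (times_Qbar T) Num.norm uDelta ->
  approx_scheme P W sigma b U H T Delta uDelta ->
  in_Cb1 (times_Qbar T) Num.norm u ->
  viscosity_solution T sigma b H U u ->
  forall (t : R) (x : 'cV[R]_n), 0 <= t <= T ->
  u t x - uDelta t x >= - C * Delta `^ (10%:R^-1).
Proof.
(* the constants may only depend on the envelopes, which any admissible data control *)
have [env|noenv] := pselect (admissible_envelopes Hlo Hhi); last first.
  by exists 0 => sigma b U H sa; case: noenv; exact: (standing_envelopes T_gt0 sa).
have [C0 C00 hC0] := env_lower_bound env.
have [B B0 hB] := env_bounded env (3 * (n%:R * lip_const T M) + n%:R + 1).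
exists (rate_const (n := n) T M C0 B (T `^ 10%:R^-1)).
move=> sigma b U H sa d Omega P W bm D v u /andP[D0 DT] v_Cb [v_step v_last].
move=> [u_cont u_bd _] [_ u_super u_T] t x tT.
have data := standing_data n_gt0 T_gt0 sa.
have [U_bound U_lip] := standing_terminal n_gt0 sa.
have [Bu hBu] := norm0_bounded u_bd.
have th0 : 0 < D `^ 10%:R^-1 by exact: powR_gt0.
have thD : (D `^ 10%:R^-1) ^+ 10 = D.
  by rewrite -powR_mulrn ?(ltW th0)// -powRrM mulVf ?pnatr_eq0// powRr1// ltW.
have them : D `^ 10%:R^-1 <= T `^ 10%:R^-1.
  by rewrite ge0_ler_powR// ?nnegrE ?invr_ge0// ltW.
pose E s := average P (fun w => W (s + D) w - W s w).
have gm s : times_Q T s -> gaussian_mean D (E s).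
  by move=> /andP[s0 _]; exact: brownian_gaussian_mean.
rewrite mulNr lerNl opprB.
apply: (error_estimate M_gt0 n_gt0 T_gt0 env C00 hC0 B0 hB data U_bound U_lip D0 DT gm
  th0 them (erefl _) _ _ _ u_cont u_super hBu u_T x thD tT).
- by move=> s Qs; exact: cont_on_bounded_cont v_Cb Qs.
- by move=> s y q hs; exact: (backward_le_cost q D0 (v_step s y hs)).
- move=> s y hs; have [r hr ->] := v_last s y hs; exists r => //.
  exact: backward_le_cost.
Qed.
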